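(* Let $\beta\in\mathbb R$ and let $z\in C(\mathbb R;H^1(\mathbb R))$ be a real-valued solution of $$(1-\partial_x^2)z_t+\partial_x\Big(\beta z+\frac{z^2}{2}\Big)=0\qquad\text{on }\mathbb R\times\mathbb R$$ which is supported (in $x$) in a fixed compact interval $[A,B]$ for all $t$ in a nonempty open time interval. Then $z\equiv0$.
   Context: Solutions are understood in the sense of distributions; equivalently, $z\in C^1(\mathbb R;H^1(\mathbb R))$ (time variable first, space $H^1(\mathbb R)$ in $x$) and $z_t=-(1-\partial_x^2)^{-1}\partial_x(\beta z+z^2/2)$, where $(1-\partial_x^2)^{-1}$ is the Fourier multiplier $(1+\xi^2)^{-1}$ on $\mathbb R$. *)

(* Defs.v *)
From HB Require Import structures.
From mathcomp Require Import all_boot all_order all_algebra.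
From mathcomp Require Import all_classical all_reals all_analysis.

Set Implicit Arguments.
Unset Strict Implicit.
Unset Printing Implicit Defensive.

Import Order.TTheory GRing.Theory Num.Theory.
Import numFieldNormedType.Exports.

Local Open Scope classical_set_scope.
Local Open Scope ring_scope.

Section Defs.
Context {R : realType}.
Local Notation mu := (@lebesgue_measure R).

Section test_functions.
Context {V : normedModType R}.
Implicit Types f : V -> R.

Definition iter_derive (vs : seq V) f : V -> R :=
  foldr (fun v g => 'D_v g) f vs.

(* C^oo: on a finite-dimensional V, existence and continuity of all iterated
   directional derivatives is equivalent to that of all iterated partial
   derivatives. *)
Definition smooth f : Prop := forall vs : seq V,
  continuous (iter_derive vs f) /\
  forall x v, derivable (iter_derive vs f) x v.

Definition test_function f : Prop :=
  smooth f /\ compact (closure [set x | f x != 0]).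

End test_functions.

(* Elements of L^2(R) and H^1(R) are handled through representatives
   u : R -> R; the predicates below only depend on u up to a.e. equality
   among measurable functions. *)

Definition L2 (u : R -> R) : Prop := u \in Lfun mu 2%:E.

Definition L2norm (u : R -> R) : R := fine ('N[mu]_2%:E[EFin \o u])%E.

Definition is_weak_derivative (u v : R -> R) : Prop :=
  forall phi : R -> R, test_function phi ->
    \int[mu]_x (u x * derive1 phi x) = - \int[mu]_x (v x * phi x).

Definition H1 (u : R -> R) : Prop :=
  L2 u /\ exists v, L2 v /\ is_weak_derivative u v.

(* A representative of the weak derivative, which is unique up to a.e.
   equality; the zero function when there is none in L^2. *)
Definition weak_derivative (u : R -> R) : R -> R :=
  xget (cst 0) [set v | L2 v /\ is_weak_derivative u v].

Definition H1norm (u : R -> R) : R :=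
  Num.sqrt (L2norm u ^+ 2 + L2norm (weak_derivative u) ^+ 2).

(* z \in C(R; H^1(R)), where z t stands for z(t, .) *)
Definition continuous_H1 (z : R -> R -> R) : Prop :=
  (forall t, H1 (z t)) /\
  forall t0, H1norm (z t \- z t0) @[t --> t0] --> (0 : R).

(* Points of R * R are (t, x): time first, space second. *)
Definition dt (f : R * R -> R) : R * R -> R := 'D_((1, 0) : R * R) f.
Definition dx (f : R * R -> R) : R * R -> R := 'D_((0, 1) : R * R) f.

(* (1 - dx^2) z_t + dx (beta z + z^2 / 2) = 0 in the sense of distributions on
   R x R, all derivatives being moved to the test function (with a global
   change of sign).  For z in C(R; H^1), the distribution defined by z is
   phi |-> \int (\int z(t, x) phi(t, x) dx) dt, and likewise for z^2; the
   iterated integral does not depend on the representatives z t, for which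
   joint measurability in (t, x) is not required. *)
Definition distributional_solution (beta : R) (z : R -> R -> R) : Prop :=
  forall phi : R * R -> R, test_function phi ->
    \int[mu]_t (\int[mu]_x
      (z t x * (dt phi (t, x) - dx (dx (dt phi)) (t, x))
       + (beta * z t x + z t x ^+ 2 / 2) * dx phi (t, x))) = 0.

(* The (essential) support of the class of u is contained in K, K closed. *)
Definition supported_in (K : set R) (u : R -> R) : Prop :=
  {ae mu, forall x, ~ K x -> u x = 0}.

End Defs.

(* Main.v *)
(** Applying [(1 - dx^2)^-1] turns the equation into [u_t = p] with
    [p = - (1 - dx^2)^-1 dx w] and [w = beta u + u^2 / 2], for the continuous
    representative [u].  As [w] is a quadratic polynomial in [u], the time
    Taylor coefficients of [u] satisfy a Cauchy-product recursion and [u] is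
    analytic in time, uniformly in [x]: [u] and [p] vanish outside [[A, B]] at
    all times.  Hence [v = (1 - dx^2)^-1 w], for which [v_x = - p] and
    [p_x = w - v], is also supported in [[A, B]].  Conservation of the [H^1]
    norm bounds [u] and makes it equicontinuous in [x], uniformly in time.

    The weighted Hamiltonian [G = \int e^{-3x} (beta u^2 / 2 + u^3 / 6)] is
    bounded, and [G' = \int e^{-3x} w p = 3/2 \int e^{-3x} ((p + v)^2 + v^2)].
    So the [L^2] norms of [p] and [v] are small at times recurring within
    bounded gaps, and by equicontinuity so are [sup |w|] and [sup |u|].  The
    conserved mass [\int u] is then [0], so that [X = \int x u] satisfies
    [X' = \int w = 1/2 \int u^2 >= 0]; as [X] is small at recurrent times, it
    vanishes identically, and [u = 0]. *)

Require Import Defs.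
From HB Require Import structures.
From mathcomp Require Import all_boot all_order all_algebra.
From mathcomp Require Import all_classical all_reals all_analysis.
From mathcomp Require Import measurable_realfun.
From mathcomp Require Import ring lra.

Import Order.TTheory GRing.Theory Num.Theory.
Import numFieldNormedType.Exports.

Local Open Scope classical_set_scope.
Local Open Scope ring_scope.

Set Implicit Arguments.
Unset Strict Implicit.
Unset Printing Implicit Defensive.

(** * Smooth functions and test functions *)

Section SmoothFunctions.
Context {R : realType}.
Implicit Types (f g : R -> R) (x a b : R).

(** Origin of the weight: as [w p = ((p^2 - v^2) / 2)_x], integration by parts gives [\int e^{-lx} w
    p = l/2 \int e^{-lx} (p^2 - v^2)], which has no visible sign. But [v_x = - p] yields [\int
    e^{-lx} p v = - l/2 \int e^{-lx} v^2], so that [p^2 - v^2] may be replaced by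
    [(p + c v)^2 + (c l - c^2 - 1) v^2]. This is coercive for some [c] exactly when [l > 2]; [l = 3]
    and [c = 1] are used. Three obstacles shape the rest. The kernel [exp (- |y|)] is neither smooth
    nor compactly supported, hence no test function: the pointwise equation is a limit over smooth
    truncated kernels. The space derivative of [u] is only an L^2 class, but [p] is C^1 in space, so
    the rough part of [u_x] is that of time 0 at all times, and the energy can be differentiated.
    Finally, small [w] does not by itself mean small [u], since [flux beta] also vanishes at
    [- 2 beta]; continuity from the edge of the support, where [u = 0], excludes that branch. *)

Lemma derive_cst a x : is_derive x 1 (fun _ : R => a) 0.
Proof. exact: is_derive_cst. Qed.

Lemma derive_id x : is_derive x 1 (fun y : R => y) 1.
Proof. exact: is_derive_id. Qed.

Lemma derive_add f g x a b : is_derive x 1 f a -> is_derive x 1 g b ->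
  is_derive x 1 (fun y => f y + g y) (a + b).
Proof. by move=> ? ?; exact: is_deriveD. Qed.

Lemma derive_sub f g x a b : is_derive x 1 f a -> is_derive x 1 g b ->
  is_derive x 1 (fun y => f y - g y) (a - b).
Proof. by move=> ? ?; exact: is_deriveB. Qed.

Lemma derive_opp f x a : is_derive x 1 f a -> is_derive x 1 (fun y => - f y) (- a).
Proof. by move=> ?; exact: is_deriveN. Qed.

Lemma derive_mul f g x a b : is_derive x 1 f a -> is_derive x 1 g b ->
  is_derive x 1 (fun y => f y * g y) (f x * b + g x * a).
Proof. by move=> ? ?; exact: is_deriveM. Qed.

Lemma derive_scale f x c a : is_derive x 1 f a ->
  is_derive x 1 (fun y => c * f y) (c * a).
Proof.
by move=> df; apply: (is_derive_eq (derive_mul (derive_cst c x) df)); ring.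
Qed.

Lemma derive_exp f x a n : is_derive x 1 f a ->
  is_derive x 1 (fun y => f y ^+ n) (n%:R * f x ^+ n.-1 * a).
Proof.
move=> df; rewrite (_ : (fun y => _) = f ^+ n); first exact: is_deriveX.
by apply/funext => y; rewrite exprfctE.
Qed.

Lemma derive_comp f g x a b : is_derive (g x) 1 f a -> is_derive x 1 g b ->
  is_derive x 1 (fun y => f (g y)) (a * b).
Proof. by move=> ? ?; exact: is_derive1_comp. Qed.

Lemma derive_expR f x a : is_derive x 1 f a ->
  is_derive x 1 (fun y => expR (f y)) (expR (f x) * a).
Proof. by move=> df; apply: (derive_comp (is_derive_expR _) df). Qed.

Lemma derive_inv f x a : f x != 0 -> is_derive x 1 f a ->
  is_derive x 1 (fun y => (f y)^-1) (- a * (f x)^-1 ^+ 2).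
Proof.
move=> fx0 df; apply: (is_derive_eq (is_deriveV fx0 df)).
by rewrite /GRing.scale/= exprVn; ring.
Qed.

Lemma derive_continuous f x a : is_derive x 1 f a -> {for x, continuous f}.
Proof.
move=> [df _]; apply: differentiable_continuous.
exact/derivable1_diffP.
Qed.

Lemma derive1_is f x a : is_derive x 1 f a -> derive1 f x = a.
Proof. by move=> df; rewrite derive1E; exact: derive_val. Qed.

(** The class C^n with the derivative as a witness: stability under products, compositions and
    inverses is then an induction on [n]. The link with the iterated directional derivatives of
    [smooth] is made once in each direction, by [smooth_fun_smooth] and [smooth_smooth_fun]. *)
Fixpoint times_differentiable n f : Prop :=
  if n is m.+1 then
    exists f', (forall x, is_derive x 1 f (f' x)) /\ times_differentiable m f'
  else continuous f.

Lemma tdiff_continuous n f : times_differentiable n f -> continuous f.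
Proof. by case: n => [//|n] [f' [df _]] x; exact: derive_continuous (df x). Qed.

Lemma tdiffS n f : times_differentiable n.+1 f -> times_differentiable n f.
Proof.
elim: n f => [|n IH] f; first exact: tdiff_continuous.
by move=> [f' [df Hf']]; exists f'; split => //; exact: IH.
Qed.

Lemma tdiff_cst n a : times_differentiable n (fun=> a).
Proof.
elim: n a => [|n IH] a; first by move=> x; exact: cvg_cst.
by exists (fun=> 0); split => // x; exact: derive_cst.
Qed.

Lemma tdiff_add n f g : times_differentiable n f -> times_differentiable n g ->
  times_differentiable n (fun x => f x + g x).
Proof.
elim: n f g => [|n IH] f g.
  by move=> cf cg x; apply: cvgD; [exact: cf|exact: cg].
move=> [f' [df nf]] [g' [dg ng]]; exists (fun x => f' x + g' x).
by split; [move=> x; exact: derive_add|exact: IH].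
Qed.

Lemma tdiff_mul n f g : times_differentiable n f -> times_differentiable n g ->
  times_differentiable n (fun x => f x * g x).
Proof.
elim: n f g => [|n IH] f g.
  by move=> cf cg x; apply: cvgM; [exact: cf|exact: cg].
move=> Hf Hg; have [f' [df nf]] := Hf; have [g' [dg ng]] := Hg.
exists (fun x => f x * g' x + g x * f' x).
split; first by move=> x; exact: derive_mul.
by apply: tdiff_add; apply: IH => //; exact: tdiffS.
Qed.

Lemma tdiff_comp n f g : times_differentiable n f -> times_differentiable n g ->
  times_differentiable n (fun x => f (g x)).
Proof.
elim: n f g => [|n IH] f g.
  by move=> cf cg x; apply: (@continuous_comp _ _ _ g f); [exact: cg|exact: cf].
move=> [f' [df nf]] Hg; have [g' [dg ng]] := Hg.
exists (fun x => f' (g x) * g' x).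
split; first by move=> x; exact: derive_comp.
by apply: tdiff_mul => //; apply: IH => //; exact: tdiffS.
Qed.

Definition smooth_fun f := forall n, times_differentiable n f.

Lemma smooth_cst a : smooth_fun (fun=> a).
Proof. by move=> n; exact: tdiff_cst. Qed.

Lemma smooth_id : smooth_fun (fun x => x).
Proof.
case=> [|n]; first by move=> x; exact: cvg_id.
by exists (fun=> 1); split; [move=> x; exact: derive_id|exact: tdiff_cst].
Qed.

Lemma smooth_add f g : smooth_fun f -> smooth_fun g ->
  smooth_fun (fun x => f x + g x).
Proof. by move=> Hf Hg n; exact: tdiff_add. Qed.

Lemma smooth_mul f g : smooth_fun f -> smooth_fun g ->
  smooth_fun (fun x => f x * g x).
Proof. by move=> Hf Hg n; exact: tdiff_mul. Qed.

Lemma smooth_comp f g : smooth_fun f -> smooth_fun g ->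
  smooth_fun (fun x => f (g x)).
Proof. by move=> Hf Hg n; exact: tdiff_comp. Qed.

Lemma smooth_opp f : smooth_fun f -> smooth_fun (fun x => - f x).
Proof.
move=> Hf; rewrite (_ : (fun x => _) = fun x => -1 * f x).
  by apply: smooth_mul => //; exact: smooth_cst.
by apply/funext => x; rewrite mulN1r.
Qed.

Lemma smooth_sub f g : smooth_fun f -> smooth_fun g ->
  smooth_fun (fun x => f x - g x).
Proof. by move=> Hf Hg; apply: smooth_add => //; exact: smooth_opp. Qed.

Lemma smooth_expR : smooth_fun expR.
Proof.
elim=> [|n IH]; first by move=> x; exact: continuous_expR.
by exists expR; split => // x; exact: is_derive_expR.
Qed.

Lemma smooth_inv f : (forall x, f x != 0) -> smooth_fun f ->
  smooth_fun (fun x => (f x)^-1).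
Proof.
move=> f0 Hf; elim=> [|n IH].
  by move=> x; apply: cvgV => //; exact: (tdiff_continuous (Hf 0%N)).
have [f' [df nf]] := Hf n.+1.
exists (fun x => - f' x * ((f x)^-1 * (f x)^-1)); split.
  by move=> x; rewrite -expr2; exact: derive_inv.
apply: tdiff_mul; last exact: tdiff_mul.
rewrite (_ : (fun x => _) = fun x => -1 * f' x).
  by apply: tdiff_mul => //; exact: tdiff_cst.
by apply/funext => x; rewrite mulN1r.
Qed.

Lemma smooth_derive f : smooth_fun f ->
  (forall x, is_derive x 1 f (derive1 f x)) /\ smooth_fun (derive1 f).
Proof.
move=> Hf; split=> [x|n].
  have [f' [df _]] := Hf 1%N; apply: is_derive_eq (df x) _.
  by rewrite (derive1_is (df x)).
have [f' [df nf]] := Hf n.+1.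
rewrite (_ : (derive1 f) = f') //; apply/funext => x; exact: derive1_is.
Qed.

Lemma smooth_continuous f : smooth_fun f -> continuous f.
Proof. by move=> /(_ 0%N). Qed.

Lemma directional_derive1 f x v : derivable f x 1 ->
  is_derive x v f (v * derive1 f x).
Proof.
move=> df; have /derivable1_diffP dif := df.
apply: DeriveDef; first exact: diff_derivable.
by rewrite -[v]mulr1 deriveE// [v * 1]mulr1 -[v in LHS]mulr1 linearZ/= -deriveE// derive1E.
Qed.

Lemma smooth_fun_smooth f : smooth_fun f -> smooth (f : R^o -> R).
Proof.
move=> Hf vs.
suff H : smooth_fun (iter_derive vs (f : R^o -> R)).
  split; first exact: smooth_continuous.
  move=> x v; have [+ _] := smooth_derive H => /(_ x) [dx _].
  by have [] := directional_derive1 v dx.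
elim: vs => [|v vs IH] //=; have [dg ng] := smooth_derive IH.
rewrite (_ : 'D_v _ = fun x => v * derive1 (iter_derive vs (f : R^o -> R)) x).
  by apply: smooth_mul => //; exact: smooth_cst.
apply/funext => x; apply: derive_val; apply: directional_derive1.
by have [] := dg x.
Qed.

End SmoothFunctions.

(** * A smooth step function *)

Section SmoothStep.
Context {R : realType}.

Lemma derive_near (f g : R -> R) (x a : R) : (\forall y \near x, f y = g y) ->
  is_derive x 1 f a -> is_derive x 1 g a.
Proof. by move=> fg df; apply: near_eq_is_derive fg df. Qed.

(* The functions x^-k exp(-1/x), extended by 0 to x <= 0: differentiation
   maps their span into itself. *)
Definition flat_fun (k : nat) (x : R) : R :=
  if 0 < x then x^-1 ^+ k * expR (- x^-1) else 0.

Lemma flat_fun_le0 k x : x <= 0 -> flat_fun k x = 0.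
Proof. by rewrite /flat_fun leNgt; case: ltP. Qed.

Lemma flat_fun_ge0 k x : 0 <= flat_fun k x.
Proof.
rewrite /flat_fun; case: ifP => // x0.
by rewrite mulr_ge0 ?expR_ge0// exprn_ge0// invr_ge0 ltW.
Qed.

Lemma flat_fun_gt0 k x : 0 < x -> 0 < flat_fun k x.
Proof.
by move=> x0; rewrite /flat_fun x0 mulr_gt0 ?expR_gt0// exprn_gt0// invr_gt0.
Qed.

Lemma flat_funS k x : flat_fun k x = flat_fun k.+1 x * x.
Proof.
rewrite /flat_fun; case: ifP => [x0|]; last by rewrite mul0r.
by rewrite exprS; field; rewrite gt_eqF.
Qed.

(** With [y = 1 / x] this is [y ^ k <= C exp y]: clear for [y <= 1], and for [y > 1] one term of the
    exponential series dominates [y ^ k.+1]. *)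
Lemma flat_fun_bound k : exists C : R, forall x, flat_fun k x <= C.
Proof.
exists (1 + k.+1`!%:R) => x; rewrite /flat_fun; case: ifP => [x0|_]; last by rewrite addr_ge0.
set y := x^-1; have y0 : 0 < y by rewrite invr_gt0.
rewrite expRN -ler_pdivlMr ?invr_gt0 ?expR_gt0// invrK.
have [y1|y1] := leP y 1.
  apply: (@le_trans _ _ 1); first by rewrite exprn_ile1// ltW.
  apply: (@le_trans _ _ (1 * expR y)); first by rewrite mul1r ltW// expR_gt1.
  by rewrite ler_wpM2r ?expR_ge0// lerDl.
apply: (@le_trans _ _ (y ^+ k.+1)).
  by rewrite exprS ler_peMl ?exprn_ge0 ?ltW.
have := expR_ge1Dxn k (ltW y0) => H.
apply: (@le_trans _ _ (k.+1`!%:R * expR y)); last first.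
  by rewrite ler_wpM2r ?expR_ge0// lerDr.
by rewrite mulrC -ler_pdivrMr//; apply: le_trans H; rewrite lerDr.
Qed.

Lemma derive_flat_fun (k : nat) (x : R) :
  is_derive x 1 (flat_fun k : R -> R) (- k%:R * flat_fun k.+1 x + flat_fun k.+2 x).
Proof.
have [x0|x0|x0] := ltgtP 0 x.
- apply: (@derive_near (fun y => y^-1 ^+ k * expR (- y^-1))).
    near=> y; rewrite /flat_fun ifT//.
    by near: y; exact: lt_nbhsr.
  have dV : is_derive x 1 (fun y : R => y^-1) (- 1 * x^-1 ^+ 2).
    by apply: derive_inv; rewrite gt_eqF.
  apply: (is_derive_eq (derive_mul (derive_exp k dV) (derive_expR (derive_opp dV)))).
  rewrite /flat_fun x0; case: k => [|k]; first by rewrite !expr0 expr1; ring.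
  by rewrite /= !exprS; ring.
- rewrite !flat_fun_le0 ?ltW// mulr0 addr0.
  apply: (@derive_near (fun=> 0)).
  near=> y; rewrite flat_fun_le0// ltW//.
  by near: y; exact: lt_nbhsl.
- rewrite -x0 !flat_fun_le0// mulr0 addr0.
  (* By [flat_funS] the slope at 0 is [flat_fun k.+1]; it tends to 0 because it equals [x] times the
     bounded function [flat_fun k.+2]. *)
  apply/is_derive1_caratheodory; exists (flat_fun k.+1).
  split; [|rewrite /continuous_at|]; rewrite ?[flat_fun _ 0]flat_fun_le0//.
    by move=> z; rewrite !subr0 flat_funS.
  have [C HC] := flat_fun_bound k.+2.
  have C0 : 0 <= C by apply: le_trans (HC 0); exact: flat_fun_ge0.
  apply/cvgrPdist_le => e e0; near=> z.
  rewrite [flat_fun k.+1 0]flat_fun_le0// sub0r normrN.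
  rewrite ger0_norm ?flat_fun_ge0// flat_funS.
  have [z0|z0] := leP z 0; first by rewrite flat_fun_le0// mul0r ltW.
  apply: (@le_trans _ _ (C * z)); first by rewrite ler_wpM2r// ltW.
  apply: (@le_trans _ _ ((C + 1) * z)); first by rewrite ler_wpM2r ?lerDl// ltW.
  rewrite mulrC -ler_pdivlMr ?ltr_wpDl//.
  apply: le_trans (ler_norm _) _; near: z.
  apply: (@nbhs0_le R R).
  by rewrite divr_gt0// ltr_wpDl.
Unshelve. all: by end_near. Qed.

Lemma smooth_flat_fun k : smooth_fun (flat_fun k).
Proof.
move=> n; elim: n k => [|n IH] k.
  by move=> x; exact: derive_continuous (derive_flat_fun k x).
exists (fun x => - k%:R * flat_fun k.+1 x + flat_fun k.+2 x).
split; first by move=> x; exact: derive_flat_fun.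
by apply: tdiff_add => //; apply: tdiff_mul => //; exact: tdiff_cst.
Qed.

Definition smooth_step (x : R) : R :=
  flat_fun 0 x * (flat_fun 0 x + flat_fun 0 (1 - x))^-1.

Let denom_gt0 x : 0 < flat_fun 0 x + flat_fun 0 (1 - x).
Proof.
have [x0|x0] := ltP 0 x; first by rewrite ltr_pwDl ?flat_fun_gt0 ?flat_fun_ge0.
by rewrite ltr_wpDl ?flat_fun_ge0// flat_fun_gt0//; lra.
Qed.

Lemma smooth_smooth_step : smooth_fun smooth_step.
Proof.
have s1 : smooth_fun (fun x : R => flat_fun 0 (1 - x)).
  apply: (smooth_comp (smooth_flat_fun 0)).
  by apply: smooth_sub; [exact: smooth_cst|exact: smooth_id].
apply: smooth_mul (smooth_flat_fun 0) _; apply: smooth_inv.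
  by move=> x; rewrite gt_eqF.
exact: smooth_add (smooth_flat_fun 0) s1.
Qed.

Lemma smooth_step_le0 x : x <= 0 -> smooth_step x = 0.
Proof. by move=> x0; rewrite /smooth_step flat_fun_le0// mul0r. Qed.

Lemma smooth_step_ge1 x : 1 <= x -> smooth_step x = 1.
Proof.
move=> x1; rewrite /smooth_step [flat_fun 0 (1 - x)]flat_fun_le0 ?subr_le0//.
by rewrite addr0 divff// gt_eqF// flat_fun_gt0// (lt_le_trans ltr01).
Qed.

Lemma smooth_step_ge0 x : 0 <= smooth_step x.
Proof. by rewrite mulr_ge0 ?flat_fun_ge0// invr_ge0 ltW. Qed.

Lemma smooth_step_le1 x : smooth_step x <= 1.
Proof. by rewrite ler_pdivrMr// mul1r lerDl flat_fun_ge0. Qed.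

End SmoothStep.

(** * Products of one-variable functions as test functions in time and space *)

Section TestFunctions.
Context {R : realType}.
Implicit Types (a b f : R -> R).

Lemma near_cst_derive f y c : (\forall x \near y, f x = c) -> derive1 f y = 0.
Proof.
move=> fc; apply: derive1_is; apply: (@derive_near _ (fun=> c)).
by apply: filterS fc => x ->.
Qed.

Lemma test_function1 f (c d : R) : smooth_fun f ->
  (forall x, f x != 0 -> c <= x <= d) -> test_function (f : R^o -> R).
Proof.
move=> sf fcd; split; first exact: smooth_fun_smooth.
apply: (@subclosed_compact _ _ `[c, d]%classic); first exact: closed_closure.
  exact: segment_compact.
rewrite (closure_id `[c, d]%classic).1; last exact: interval_closed.
by apply: closure_subset => x /= /fcd; rewrite in_itv.
Qed.

(** A directional derivative of a product [a(t) b(x)] is a sum of two such products. Finite sums are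
    therefore the smallest convenient class stable under [iter_derive]. *)
Definition tensor_sum (l : seq ((R -> R) * (R -> R))) (p : R * R) : R :=
  \sum_(ab <- l) ab.1 p.1 * ab.2 p.2.

Definition smooth_list (l : seq ((R -> R) * (R -> R))) :=
  forall ab, List.In ab l -> smooth_fun ab.1 /\ smooth_fun ab.2.

Lemma derive_tensor a b (p v : R * R) : smooth_fun a -> smooth_fun b ->
  is_derive p v (fun z : R * R => a z.1 * b z.2)
    (v.1 * derive1 a p.1 * b p.2 + a p.1 * (v.2 * derive1 b p.2)).
Proof.
move=> sa sb; case: p v => t x [r s] /=.
have dline (y q : R) : is_derive (0 : R) 1 (fun h : R => h * q + y) q.
  have d := derive_add (derive_mul (derive_id (0 : R)) (derive_cst q 0)) (derive_cst y 0).
  by apply: (is_derive_eq d); ring.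
have da : is_derive (0 : R) 1 (fun h : R => a (h * r + t)) (r * derive1 a t).
  have d : is_derive (0 * r + t) 1 a (derive1 a t).
    by rewrite mul0r add0r; have [] := smooth_derive sa.
  by rewrite mulrC; exact: (@derive_comp _ a (fun h => h * r + t) 0 _ _ d (dline t r)).
have db : is_derive (0 : R) 1 (fun h : R => b (h * s + x)) (s * derive1 b x).
  have d : is_derive (0 * s + x) 1 b (derive1 b x).
    by rewrite mul0r add0r; have [] := smooth_derive sb.
  by rewrite mulrC; exact: (@derive_comp _ b (fun h => h * s + x) 0 _ _ d (dline x s)).
have [] := derive_mul da db.
rewrite /derivable /derive /= !mul0r !add0r.
move=> d1 d2.
have E : (fun h : R => h^-1 *: (a (h *: r + t) * b (h *: s + x) - a t * b x : R)) =
  (fun h : R => h^-1 *: (a ((h%:A + 0) * r + t) * b ((h%:A + 0) * s + x) - a t * b x)).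
  by apply/funext => h; rewrite addr0 /GRing.scale/= mulr1.
apply: DeriveDef; rewrite /derivable /derive /=; first by rewrite E; exact: d1.
by rewrite E [LHS]d2; ring.
Qed.

Lemma derive_tensor_sum l (p v : R * R) : smooth_list l ->
  is_derive p v (tensor_sum l)
    (\sum_(ab <- l) (v.1 * derive1 ab.1 p.1 * ab.2 p.2
                     + ab.1 p.1 * (v.2 * derive1 ab.2 p.2))).
Proof.
elim: l => [|[a b] l IH] sl.
  rewrite big_nil (_ : tensor_sum [::] = cst 0); first exact: is_derive_cst.
  by apply/funext => q; rewrite /tensor_sum big_nil.
rewrite big_cons (_ : tensor_sum _ =
  (fun z : R * R => a z.1 * b z.2) + tensor_sum l).
  apply: is_deriveD.
    by have [] := sl (a, b) (or_introl erefl); exact: derive_tensor.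
  by apply: IH => ab Hab; apply: sl; right.
by apply/funext => q; rewrite /tensor_sum big_cons.
Qed.

Definition tensor_derive (v : R * R) (l : seq ((R -> R) * (R -> R))) :=
  flatten [seq [:: (fun t => v.1 * derive1 ab.1 t, ab.2);
                   (ab.1, fun x => v.2 * derive1 ab.2 x)] | ab <- l].

Lemma tensor_deriveE l v : smooth_list l ->
  smooth_list (tensor_derive v l) /\ 'D_v (tensor_sum l) = tensor_sum (tensor_derive v l).
Proof.
move=> sl; split.
  elim: l sl => [|[a b] l IH] sl ab //=.
  have [/= sa sb] := sl (a, b) (or_introl erefl).
  case=> [<-|[<-|/=]] /=; last by apply: IH => // ab' Hab'; apply: sl; right.
    split=> //; apply: smooth_mul; first exact: smooth_cst.
    by have [] := smooth_derive sa.
  split=> //; apply: smooth_mul; first exact: smooth_cst.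
  by have [] := smooth_derive sb.
apply/funext => p; rewrite (@derive_val _ _ _ _ _ _ _ (derive_tensor_sum p v sl)).
rewrite /tensor_sum /tensor_derive big_flatten/= big_map.
by apply: eq_bigr => ab _; rewrite !big_cons big_nil/= addr0.
Qed.

Lemma continuous_tensor_sum l : smooth_list l -> continuous (tensor_sum l).
Proof.
elim: l => [|[a b] l IH] sl.
  rewrite (_ : tensor_sum [::] = cst 0); first exact: cst_continuous.
  by apply/funext => q; rewrite /tensor_sum big_nil.
have [/= sa sb] := sl (a, b) (or_introl erefl).
rewrite (_ : tensor_sum _ = (fun z : R * R => a z.1 * b z.2 + tensor_sum l z)).
  move=> p; apply: cvgD; last by apply: IH => ab Hab; apply: sl; right.
  apply: cvgM.
    apply: (@continuous_comp _ _ _ fst a); first exact: cvg_fst.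
    exact: smooth_continuous.
  apply: (@continuous_comp _ _ _ snd b); first exact: cvg_snd.
  exact: smooth_continuous.
by apply/funext => q; rewrite /tensor_sum big_cons.
Qed.

Lemma smooth_tensor_sum l : smooth_list l -> smooth (tensor_sum l).
Proof.
move=> sl vs.
suff [l' [sl' ->]] : exists l', smooth_list l' /\
    iter_derive vs (tensor_sum l) = tensor_sum l'.
  split; first exact: continuous_tensor_sum.
  by move=> x v; have [] := derive_tensor_sum x v sl'.
elim: vs => [|v vs [l' [sl' E]]] /=; first by exists l.
by exists (tensor_derive v l'); rewrite E; exact: tensor_deriveE.
Qed.

Lemma test_function_tensor a b (c d r s : R) : smooth_fun a -> smooth_fun b ->
  (forall t, a t != 0 -> c <= t <= d) -> (forall x, b x != 0 -> r <= x <= s) ->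
  test_function (fun p : R * R => a p.1 * b p.2).
Proof.
move=> sa sb acd brs; have E : (fun p : R * R => a p.1 * b p.2) = tensor_sum [:: (a, b)].
  by apply/funext => p; rewrite /tensor_sum big_seq1.
split; first by rewrite E; apply: smooth_tensor_sum => ab [<-|].
have cK : compact (`[c, d]%classic `*` `[r, s]%classic : set (R * R)).
  by apply: compact_setX; exact: segment_compact.
apply: (subclosed_compact _ cK); first exact: closed_closure.
rewrite [X in _ `<=` X](closure_id _).1; last first.
  by apply: compact_closed => //; exact: norm_hausdorff.
apply: closure_subset => -[t x] /=; rewrite mulf_eq0 negb_or !in_itv/=.
by move=> /andP[/acd ? /brs ?].
Qed.

Lemma dt_tensor a b (t x : R) : smooth_fun a -> smooth_fun b ->
  dt (fun p : R * R => a p.1 * b p.2) (t, x) = derive1 a t * b x.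
Proof.
move=> sa sb; rewrite /dt (@derive_val _ _ _ _ _ _ _ (derive_tensor _ _ sa sb))/=.
by ring.
Qed.

Lemma dx_tensor a b (t x : R) : smooth_fun a -> smooth_fun b ->
  dx (fun p : R * R => a p.1 * b p.2) (t, x) = a t * derive1 b x.
Proof.
move=> sa sb; rewrite /dx (@derive_val _ _ _ _ _ _ _ (derive_tensor _ _ sa sb))/=.
by ring.
Qed.

End TestFunctions.

(** * Integrals and one-dimensional weak derivatives *)

Section Integrals.
Context {R : realType}.
Local Notation mu := (@lebesgue_measure R).
Local Notation integ D f := (mu.-integrable D (EFin \o f)).
Implicit Types (f g h F : R -> R) (D : set R) (a b M : R).

Lemma ae_imp (P Q : R -> Prop) : (forall x, P x -> Q x) ->
  {ae mu, forall x, P x} -> {ae mu, forall x, Q x}.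
Proof.
by move=> PQ; apply: filterS; first exact: (ae_filter_ringOfSetsType mu).
Qed.

Lemma ae_and (P Q : R -> Prop) : {ae mu, forall x, P x} ->
  {ae mu, forall x, Q x} -> {ae mu, forall x, P x /\ Q x}.
Proof.
move=> HP HQ; exact: (@filterI _ _ (ae_filter_ringOfSetsType mu) _ _ HP HQ).
Qed.

Lemma cvg_squeeze_dist (u_ v_ : nat -> R) (l : R) :
  (forall n, `|u_ n - l| <= v_ n) -> v_ n @[n --> \oo] --> (0 : R) ->
  u_ n @[n --> \oo] --> l.
Proof.
move=> uv v0; apply/subr_cvg0; apply: norm_cvg0.
apply: (@squeeze_cvgr _ _ _ _ (cst 0) _ _ _ _ _ v0); last exact: cvg_cst.
by apply: nearW => n; rewrite normr_ge0 uv.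
Qed.

Lemma integ_le D f h : measurable D -> integ D h -> measurable_fun D f ->
  (forall x, D x -> `|f x| <= h x) -> integ D f.
Proof.
move=> mD ih mf fh; apply: le_integrable ih => //; first exact/measurable_EFinP.
by move=> x Dx /=; rewrite lee_fin (le_trans (fh x Dx))// ler_norm.
Qed.

Lemma integ_subset (D E : set R) f : measurable D -> measurable E -> D `<=` E ->
  integ E f -> integ D f.
Proof. by move=> mD mE DE; apply: integrableS. Qed.

Lemma integ_measurable D f : integ D f -> measurable_fun D f.
Proof. by move=> /integrableP[/measurable_EFinP]. Qed.

Lemma integ_norm D f : measurable D -> integ D f -> integ D (fun x => `|f x|).
Proof.
by move=> mD intf; have := integrable_abse intf; apply: eq_integrable.
Qed.

Lemma integ_scale D f c : measurable D -> integ D f -> integ D (fun x => c * f x).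
Proof.
move=> mD intf; have := integrableZl (mu := mu) mD c intf.
by apply: eq_integrable => // x _ /=; rewrite EFinM.
Qed.

Lemma integ_add D f g : measurable D -> integ D f -> integ D g ->
  integ D (fun x => f x + g x).
Proof.
by move=> mD fi gi; have := integrableD (mu := mu) mD fi gi; apply: eq_integrable => // x _ /=.
Qed.

Lemma integ_sub D f g : measurable D -> integ D f -> integ D g ->
  integ D (fun x => f x - g x).
Proof.
by move=> mD fi gi; have := integrableB (mu := mu) mD fi gi; apply: eq_integrable => // x _ /=.
Qed.

Lemma integ_mul_bounded D f g M : measurable D -> integ D g ->
  measurable_fun D f -> (forall x, D x -> `|f x| <= M) ->
  integ D (fun x => f x * g x).
Proof.
move=> mD ig mf fM.
apply: (integ_le (h := fun x => M * `|g x|)) => //.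
- exact/integ_scale/integ_norm.
- by apply: measurable_funM => //; exact: integ_measurable ig.
- by move=> x Dx; rewrite normrM ler_wpM2r// fM.
Qed.

Lemma continuous_measurable f D : measurable D -> continuous f -> measurable_fun D f.
Proof.
move=> mD cf; apply: (@measurable_funS _ _ _ _ setT) => //.
exact: continuous_measurable_fun.
Qed.

Lemma continuous_mul (f g : R -> R) : continuous f -> continuous g ->
  continuous (fun s => f s * g s).
Proof. by move=> cf cg s; apply: cvgM; [exact: cf|exact: cg]. Qed.

Lemma continuous_addf (f g : R -> R) : continuous f -> continuous g ->
  continuous (fun s => f s + g s).
Proof. by move=> cf cg s; apply: cvgD; [exact: cf|exact: cg]. Qed.

Lemma continuous_subf (f g : R -> R) : continuous f -> continuous g ->
  continuous (fun s => f s - g s).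
Proof. by move=> cf cg s; apply: cvgB; [exact: cf|exact: cg]. Qed.

Lemma continuous_sqr (f : R -> R) : continuous f -> continuous (fun s => f s ^+ 2).
Proof.
move=> cf; rewrite (_ : (fun s => f s ^+ 2) = (fun s => f s * f s)); first exact: continuous_mul.
by apply/funext => s; rewrite expr2.
Qed.

Lemma continuous_bounded_itv (U : R -> R) x y : continuous U ->
  exists M, forall s, x <= s <= y -> `|U s| <= M.
Proof.
move=> cU; have [xy|yx] := leP x y; last first.
  by exists 0 => s /andP[xs sy]; have := le_lt_trans (le_trans xs sy) yx; rewrite ltxx.
have cn : {within `[x, y], continuous (fun s => `|U s|)}.
  by apply: continuous_subspaceT => s; apply: cvg_norm; exact: cU.
by have [c _ Hc] := EVT_max xy cn; exists `|U c| => s sI; apply: Hc; rewrite in_itv.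
Qed.

Lemma integ_continuous f a b : continuous f -> integ `[a, b] f.
Proof.
move=> cf; apply: continuous_compact_integrable; first exact: segment_compact.
exact: continuous_subspaceT.
Qed.

Lemma integ_cst a b c : integ `[a, b] (fun=> c).
Proof. by apply: integ_continuous => x; exact: cvg_cst. Qed.

Lemma Rint_le_norm D f h : measurable D -> integ D f -> integ D h ->
  (forall x, D x -> `|f x| <= h x) ->
  `|\int[mu]_(x in D) f x| <= \int[mu]_(x in D) h x.
Proof.
move=> mD fi hi fh; apply: le_trans (le_normr_Rintegral (mu := mu) mD fi) _.
by apply: le_Rintegral => //; exact: integ_norm.
Qed.

Lemma Rint_cst a b c : a <= b -> \int[mu]_(x in `[a, b]) c = c * (b - a).
Proof.
by move=> ab; rewrite Rintegral_cst//= lebesgue_measure_itv/= lte_fin; case: ltgtP ab => //= -> _; rewrite subrr.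
Qed.

Lemma Rint_le_cst f a b M : a <= b -> integ `[a, b] f ->
  (forall x, a <= x <= b -> `|f x| <= M) ->
  `|\int[mu]_(x in `[a, b]) f x| <= M * (b - a).
Proof.
move=> ab fi fM; rewrite -Rint_cst//; apply: Rint_le_norm => //; exact: integ_cst.
Qed.

Lemma Rint_supp f D : (forall x, ~ D x -> f x = 0) ->
  \int[mu]_x f x = \int[mu]_(x in D) f x.
Proof.
move=> f0; rewrite [RHS]Rintegral_mkcond; apply: eq_Rintegral => x _.
rewrite patchE; case: ifPn => // /negP nDx; apply: f0 => Dx; apply: nDx.
exact/mem_set.
Qed.

Lemma integ_supp f D : measurable D -> (forall x, ~ D x -> f x = 0) ->
  integ D f -> integ setT f.
Proof.
move=> mD f0 fi; have := (integrable_mkcond (mu := mu) (EFin \o f) mD).1 fi.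
apply: eq_integrable => // x _ /=; rewrite patchE; case: ifPn => // /negP nDx.
by rewrite f0// => Dx; apply: nDx; exact/mem_set.
Qed.

Lemma Rint_dominated_cvg D (f_ : nat -> R -> R) f h : measurable D ->
  (forall n, measurable_fun D (f_ n)) -> measurable_fun D f -> integ D h ->
  (forall n x, D x -> `|f_ n x| <= h x) ->
  {ae mu, forall x, D x -> f_ n x @[n --> \oo] --> f x} ->
  \int[mu]_(x in D) f_ n x @[n --> \oo] --> \int[mu]_(x in D) f x.
Proof.
move=> mD mf_ mf ih fh cf.
have cfE : {ae mu, forall x, D x -> (EFin \o f_ n) x @[n --> \oo] --> (EFin \o f) x}.
  apply: ae_imp cf => x H Dx; apply: cvg_EFin; first exact: nearW.
  exact: H.
have fhE : {ae mu, forall x, forall n, D x -> (`|(EFin \o f_ n) x| <= (EFin \o h) x)%E}.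
  by apply: aeW => x n Dx /=; rewrite lee_fin fh.
have mE n : measurable_fun D (EFin \o f_ n) by exact/measurable_EFinP.
have mEf : measurable_fun D (EFin \o f) by exact/measurable_EFinP.
have [fi _ H] := @dominated_convergence _ _ _ mu D mD
  (fun n => EFin \o f_ n) (EFin \o f) (EFin \o h) mE mEf cfE ih fhE.
have fin : (\int[mu]_(x in D) (EFin \o f) x)%E \is a fin_num.
  exact: integrable_fin_num.
by apply/fine_cvg; rewrite fineK.
Qed.

Lemma Rint_FTC F f a b : a <= b -> (forall x : R, is_derive x 1 F (f x)) ->
  continuous f -> \int[mu]_(x in `[a, b]) f x = F b - F a.
Proof.
rewrite le_eqVlt => /predU1P[<- _ _|ab dF cf].
  by rewrite set_itv1 Rintegral_set1 subrr.
rewrite /Rintegral (@continuous_FTC2 _ f F a b)//.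
- exact: continuous_subspaceT.
- split.
  + by move=> x _; have [] := dF x.
  + by apply: cvg_at_right_filter; exact: derive_continuous (dF a).
  + by apply: cvg_at_left_filter; exact: derive_continuous (dF b).
- by move=> x _; exact: derive1_is.
Qed.

End Integrals.

(** * The fundamental theorem of calculus for weak derivatives, at Lebesgue points *)

Section WeakFTC.
Context {R : realType}.
Local Notation mu := (@lebesgue_measure R).
Local Notation integ D f := (mu.-integrable D (EFin \o f)).

Lemma locally_integrable_itv (u : R -> R) a b :
  locally_integrable setT u -> integ `[a, b] u.
Proof.
move=> [mu_ _ Hu].
have mab : measurable_fun `[a, b]%classic u by apply: (@measurable_funS _ _ _ _ setT).
apply/integrableP; split; first exact/measurable_EFinP.
by apply: (Hu _ (@subsetT _ _) (@segment_compact _ _ _)).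
Qed.

Let rho : R -> R := derive1 smooth_step.

Let cont_rho : continuous rho.
Proof.
exact: (smooth_continuous (smooth_derive (@smooth_smooth_step R)).2).
Qed.

Let rho0 (y : R) : y < 0 -> rho y = 0.
Proof.
move=> y0; apply: (@near_cst_derive _ _ _ 0); near=> z.
by apply: smooth_step_le0; rewrite ltW//; near: z; exact: lt_nbhsl.
Unshelve. all: by end_near. Qed.

Let rho1 (y : R) : 1 < y -> rho y = 0.
Proof.
move=> y0; apply: (@near_cst_derive _ _ _ 1); near=> z.
by apply: smooth_step_ge1; rewrite ltW//; near: z; exact: lt_nbhsr.
Unshelve. all: by end_near. Qed.

Lemma derive_smooth_step_bounded : exists2 M, 0 < M & forall y, `|rho y| <= M.
Proof.
have crho : {within `[0, 1], continuous (fun y => `|rho y|)}.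
  by apply: continuous_subspaceT => y; apply: cvg_norm; exact: cont_rho.
have [c _ Hc] := EVT_max ler01 crho.
exists (`|rho c| + 1) => [|y]; first by rewrite ltr_wpDl.
have [y0|y0] := ltP y 0; first by rewrite rho0// normr0 addr_ge0.
have [y1|y1] := ltP 1 y; first by rewrite rho1// normr0 addr_ge0.
apply: (@le_trans _ _ `|rho c|); last by rewrite lerDl.
by apply: Hc; rewrite in_itv/= y0 y1.
Qed.

(** Derivative of a step of width [1 / n.+1] starting at [x]: a one-sided mollifier of mass 1. *)
Let K (x : R) (n : nat) (s : R) : R := n.+1%:R * rho (n.+1%:R * (s - x)).

Let derive_step x n (s : R) : is_derive s 1 (fun s => smooth_step (n.+1%:R * (s - x))) (K x n s).
Proof.
rewrite /K mulrC.
have d : is_derive s 1 (fun s => n.+1%:R * (s - x)) n.+1%:R.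
  apply: (is_derive_eq (derive_scale n.+1%:R (derive_sub (derive_id s) (derive_cst x s)))).
  by ring.
exact: (derive_comp ((smooth_derive (@smooth_smooth_step R)).1 _) d).
Qed.

Let smooth_bump x n : smooth_fun (fun s : R => smooth_step (n.+1%:R * (s - x))).
Proof.
apply: (smooth_comp (@smooth_smooth_step R)); apply: smooth_mul; first exact: smooth_cst.
by apply: smooth_sub; [exact: smooth_id|exact: smooth_cst].
Qed.

Let cont_K x n : continuous (K x n).
Proof.
move=> s; apply: cvgM; first exact: cvg_cst.
apply: (@continuous_comp _ _ _ (fun s => n.+1%:R * (s - x)) rho); last exact: cont_rho.
apply: cvgM; first exact: cvg_cst.
by apply: cvgB; [exact: cvg_id|exact: cvg_cst].
Qed.

Let K_out x n s : ~ ball x (2 / n.+1%:R) s -> K x n s = 0.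
Proof.
rewrite /K /ball/= => H.
have [s0|s0] := ltP s x; first by rewrite rho0 ?mulr0// pmulr_rlt0// subr_lt0.
have [s1|s1] := ltP (1 / n.+1%:R) (s - x).
  by rewrite rho1 ?mulr0// mulrC -ltr_pdivrMr.
exfalso; apply: H; rewrite distrC ger0_norm ?subr_ge0//.
by apply: le_lt_trans s1 _; rewrite ltr_pM2r ?invr_gt0//; lra.
Qed.

(** The kernel is at most [n.+1 * M] and lives in a ball of radius [2 / n.+1], hence of measure
    [4 / n.+1]: the error is at most [4 M] times the mean of [|u - u x|] on that ball, which tends
    to 0 at a Lebesgue point. *)
Lemma cvg_lebesgue_pt_kernel (u : R -> R) (x : R) :
  locally_integrable setT u -> lebesgue_pt u x ->
  \int[mu]_s (u s * K x n s) @[n --> \oo] --> u x.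
Proof.
move=> lu lx; have [M M0 HM] := derive_smooth_step_bounded.
pose J := `[x - 2, x + 2]%classic.
have uJ : integ J u by exact: locally_integrable_itv.
have mJ : measurable J by exact: measurable_itv.
have mK n : measurable_fun J (K x n) by exact: continuous_measurable.
have KM n s : `|K x n s| <= n.+1%:R * M.
  by rewrite /K normrM ger0_norm// ler_wpM2l// HM.
have BJ n : ball x (2 / n.+1%:R) `<=` J.
  move=> s xs; rewrite /J /= in_itv/=.
  have : `|x - s| < 2.
    by apply: lt_le_trans (xs : `|x - s| < _) _; rewrite ler_pdivrMr// ler_peMr// ler1n.
  by rewrite ltr_norml => /andP[? ?]; apply/andP; split; lra.
have KJ n s : ~ J s -> K x n s = 0.
  by move=> nJ; apply: K_out => xs; apply: nJ; exact: BJ xs.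
have K1 n : \int[mu]_(s in J) K x n s = 1.
  have le2 : x - 2 <= x + 2 by lra.
  rewrite /J (Rint_FTC le2 (derive_step x n) (@cont_K x n)).
  have n1 : 1 <= n.+1%:R :> R by rewrite ler1n.
  by rewrite smooth_step_ge1 ?smooth_step_le0 ?subr0//; nra.
pose v s := u s - u x.
have vJ : integ J v by apply: integ_sub => //; exact: integ_cst.
have uKJ n : integ J (fun s => K x n s * u s) by exact: integ_mul_bounded (fun s _ => KM n s).
have vKJ n : integ J (fun s => K x n s * v s) by exact: integ_mul_bounded (fun s _ => KM n s).
have E n : \int[mu]_s (u s * K x n s) - u x = \int[mu]_(s in J) (K x n s * v s).
  rewrite (@Rint_supp _ _ J); last by move=> s nJ; rewrite KJ// mulr0.
  rewrite -[u x in LHS]mul1r -(K1 n) -RintegralZr//; last first.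
    exact: integ_continuous.
  rewrite -RintegralB//; last 2 first.
  - by apply: eq_integrable (uKJ n) => // s _ /=; rewrite mulrC.
  - by apply: integ_mul_bounded (fun s _ => KM n s) => //; exact: integ_cst.
  by apply: eq_Rintegral => s _; rewrite /v; ring.
pose r n : R := 2 / n.+1%:R.
have r0 n : 0 < r n by rewrite divr_gt0.
have dv : fine (davg u x (r n)) @[n --> \oo] --> 0.
  have lx' : fine (davg u x e) @[e --> (0 : R)^'+] --> (0 : R) by exact: fine_cvg.
  move/cvg_at_rightP : lx'; apply; split => //.
  rewrite -[X in _ --> X](mulr0 2); apply: cvgM; first exact: cvg_cst.
  exact: cvg_harmonic.
apply: (@cvg_squeeze_dist _ _ (fun n => 4 * M * fine (davg u x (r n)))); last first.
  by rewrite -[X in _ --> X](mulr0 (4 * M)); apply: cvgM => //; exact: cvg_cst.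
move=> n; rewrite E.
have mB : measurable (ball x (r n)) by exact: measurable_ball.
have vB : integ (ball x (r n)) v by exact: integ_subset (BJ n) vJ.
have -> : \int[mu]_(s in J) (K x n s * v s) = \int[mu]_(s in ball x (r n)) (K x n s * v s).
  rewrite [LHS]Rintegral_mkcond [RHS]Rintegral_mkcond; apply: eq_Rintegral => s _.
  rewrite !patchE; case: ifPn => sJ; case: ifPn => // sB.
    by rewrite K_out ?mul0r// => xs; move/negP: sB; apply; rewrite inE.
  by move/negP: sJ; case; rewrite inE; apply: (BJ n); rewrite inE in sB.
apply: (@le_trans _ _ (\int[mu]_(s in ball x (r n)) (n.+1%:R * M * `|v s|))).
  apply: Rint_le_norm => //.
  - by apply: integ_subset (BJ n) (vKJ n).
  - exact/integ_scale/integ_norm.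
  - by move=> s _; rewrite normrM ler_wpM2r.
rewrite RintegralZl//; last exact: integ_norm.
have vfin : (\int[mu]_(y in ball x (r n)) (`|v y|)%:E)%E \is a fin_num.
  by apply: (@integrable_fin_num _ _ _ mu) => //; exact: integ_norm.
rewrite /davg /iavg.
rewrite [X in (_ * X)%E](_ : _ = (\int[mu]_(y in ball x (r n)) (`|v y|)%:E)%E)//.
rewrite (lebesgue_measure_ball _ (ltW (r0 n))) inver mulrn_eq0/= gt_eqF// fineM//=.
rewrite le_eqVlt; apply/orP; left; apply/eqP.
rewrite /Rintegral; set I := fine _; clearbody I.
have N0 : n.+1%:R != 0 :> R by rewrite pnatr_eq0.
rewrite -[r n *+ 2]mulr_natr /r; move: n.+1%:R N0 => N N0.
by field.
Qed.

(** Test against the difference [b n] of the steps at [x] and at [y]. Its derivative is a difference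
    of mollifiers, so one side tends to [u y - u x]; on the other side [b n] tends to the indicator
    of []x, y]], half-open because the step vanishes at its starting point. *)
Lemma weak_FTC (u g : R -> R) (x y : R) : locally_integrable setT u ->
  locally_integrable setT g -> is_weak_derivative u g ->
  lebesgue_pt u x -> lebesgue_pt u y -> x <= y ->
  u y - u x = \int[mu]_(s in `[x, y]) g s.
Proof.
move=> lu lg ug lx ly; rewrite le_eqVlt => /predU1P[<-|xy].
  by rewrite set_itv1 Rintegral_set1 subrr.
pose b n (s : R) : R := smooth_step (n.+1%:R * (s - x)) - smooth_step (n.+1%:R * (s - y)).
have N1 n : 1 <= n.+1%:R :> R by rewrite ler1n.
have sb n : smooth_fun (b n) by apply: smooth_sub; exact: smooth_bump.
have b0 n s : b n s != 0 -> x <= s <= y + 1.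
  move=> bs; apply/andP; split; rewrite leNgt; apply/negP => sx; move/negP: bs; apply.
    rewrite /b !smooth_step_le0 ?subr0//; first by have := N1 n; nra.
    by have := N1 n; nra.
  rewrite /b !smooth_step_ge1 ?subrr//; first by have := N1 n; nra.
  by have := N1 n; nra.
have tb n : test_function (b n : R^o -> R) by exact: (test_function1 (sb n) (@b0 n)).
have db n s : derive1 (b n) s = K x n s - K y n s.
  by apply: derive1_is; apply: derive_sub; exact: derive_step.
pose J := `[x, y + 1]%classic.
have mJ : measurable J by exact: measurable_itv.
have gJ : integ J g by exact: locally_integrable_itv.
pose chi (s : R) : R := if (x < s <= y) then 1 else 0.
have E n : \int[mu]_s (u s * K y n s) - \int[mu]_s (u s * K x n s) =
           \int[mu]_(s in J) (g s * b n s).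
  have uK z : integ setT (fun s => u s * K z n s).
    apply: (@integ_supp _ _ `[z - 2, z + 2]%classic) => //.
      move=> s nJ; rewrite K_out ?mulr0// => xs; apply: nJ; rewrite /= in_itv/=.
      move: xs; rewrite /ball/= => xs.
      have : `|z - s| < 2.
        by apply: lt_le_trans xs _; rewrite ler_pdivrMr// ler_peMr.
      by rewrite ltr_norml => /andP[? ?]; apply/andP; split; lra.
    have [M M0 HM] := derive_smooth_step_bounded.
    have uz : integ `[z - 2, z + 2] u by exact: locally_integrable_itv.
    have : integ `[z - 2, z + 2] (fun s => K z n s * u s).
      apply: (@integ_mul_bounded _ _ _ _ (n.+1%:R * M)) => //.
        exact: continuous_measurable.
      by move=> s _; rewrite /K normrM ger0_norm// ler_wpM2l// HM.
    by apply: eq_integrable => // s _ /=; rewrite mulrC.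
  rewrite -RintegralB//; apply: oppr_inj.
  rewrite -(@Rint_supp _ (fun s => g s * b n s)); last first.
    move=> s nJ; case: (eqVneq (b n s) 0) => [->|/b0 sJ]; first by rewrite mulr0.
    by exfalso; apply: nJ; rewrite /J/= in_itv.
  rewrite -(ug _ (tb n)) -[LHS]mulN1r -RintegralZl//; last exact: integ_sub.
  by apply: eq_Rintegral => s _; rewrite db; ring.
have L1 : \int[mu]_(s in J) (g s * b n s) @[n --> \oo] --> u y - u x.
  by under eq_fun do rewrite -E; apply: cvgB; exact: cvg_lebesgue_pt_kernel.
have mg : measurable_fun J g by exact: integ_measurable gJ.
have mchi : measurable_fun J chi.
  rewrite (_ : chi = \1_(`]x, y]%classic)); first exact: measurable_indic.
  by apply/funext => s; rewrite /chi indicE mem_setE in_itv/=; case: ifP.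
have L2 : \int[mu]_(s in J) (g s * b n s) @[n --> \oo] --> \int[mu]_(s in J) (g s * chi s).
  apply: (@Rint_dominated_cvg _ _ _ _ (fun s => `|g s|)) => //.
  - move=> n; apply: measurable_funM => //; apply: continuous_measurable => //.
    exact: smooth_continuous.
  - exact: measurable_funM.
  - exact: integ_norm.
  - move=> n s _; rewrite normrM ler_piMr// /b ler_norml.
    have := smooth_step_ge0 (n.+1%:R * (s - x)).
    have := smooth_step_le1 (n.+1%:R * (s - x)).
    have := smooth_step_ge0 (n.+1%:R * (s - y)).
    have := smooth_step_le1 (n.+1%:R * (s - y)).
    by move=> *; apply/andP; split; lra.
  - apply: aeW => s _; apply: cvgM; first exact: cvg_cst.
    have lim z : smooth_step (n.+1%:R * (s - z)) @[n --> \oo] --> (if z < s then 1 else 0 : R).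
      case: ltP => zs.
        apply: cvg_near_cst; near=> n; apply: smooth_step_ge1.
        rewrite -ler_pdivrMr ?subr_gt0//; apply: (@le_trans _ _ n%:R).
          by near: n; exact: nbhs_infty_ger.
        by rewrite ler_nat.
      apply: cvg_near_cst; apply: nearW => n; apply: smooth_step_le0.
      by rewrite pmulr_rle0// subr_le0.
    rewrite (_ : chi s = (if x < s then 1 else 0) - (if y < s then 1 else 0)).
      by apply: cvgB; exact: lim.
    rewrite /chi; case: (ltP x s) => xs; case: (ltP y s) => ys //=; rewrite ?subrr ?subr0//.
    by exfalso; lra.
have -> : u y - u x = \int[mu]_(s in J) (g s * chi s).
  exact: (cvg_unique _ L1 L2).
rewrite [LHS]Rintegral_mkcond -Rintegral_itv_obnd_cbnd; last first.
  apply: integ_subset (locally_integrable_itv x y lg) => //.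
  by apply: subset_itvr; rewrite bnd_simp.
rewrite [RHS]Rintegral_mkcond; apply: eq_Rintegral => s _.
rewrite !patchE !mem_setE /chi !in_itv/=.
case: (boolP (x < s <= y)) => [/andP[xs sy]|]; last by rewrite mulr0; case: ifP.
by rewrite mulr1 ifT//; apply/andP; split; lra.
Unshelve. all: by end_near. Qed.

End WeakFTC.

(** * Continuous representatives of H^1 functions and the Sobolev bound *)

Section H1Representatives.
Context {R : realType}.
Local Notation mu := (@lebesgue_measure R).
Local Notation integ D f := (mu.-integrable D (EFin \o f)).

Lemma L2_measurable (u : R -> R) : L2 u -> measurable_fun setT u.
Proof. by rewrite /L2 inE => /andP[/[!inE]/= mf _]. Qed.

Lemma L2_integ_sqr (u : R -> R) : L2 u -> integ setT (fun x => u x ^+ 2).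
Proof. exact: Lfun2_integrable_sqr. Qed.

Lemma L2_sub (u v : R -> R) : L2 u -> L2 v -> L2 (u \- v).
Proof.
move=> Lu Lv; have [_ add] := Lfun_addr_closed mu (lee1n 2 : (1 <= 2%:E :> \bar R)%E).
by apply: (add u (- v)) => //; rewrite Lfun_oppr_closed.
Qed.

Lemma ae_ex_itv (P : R -> Prop) (a b : R) : a < b -> {ae mu, forall x, P x} ->
  exists2 x, a <= x <= b & P x.
Proof.
move=> ab aeP; apply: contrapT => nex.
have : mu.-negligible `[a, b]%classic.
  apply: negligibleS aeP => x /=; rewrite in_itv/= => xab Px; apply: nex.
  by exists x.
move=> /negligibleP => /(_ (measurable_itv _)).
change (mu `[a, b]%classic = 0%E -> False).
rewrite lebesgue_measure_itv/= lte_fin ab -EFinB => -[] /eqP.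
by rewrite subr_eq0 gt_eqF.
Qed.

Lemma L2norm_sqr (u : R -> R) : L2 u -> L2norm u ^+ 2 = \int[mu]_x (u x ^+ 2).
Proof.
move=> Lu.
have E : ('N[mu]_2%:E[EFin \o u] `^ 2 = \int[mu]_x (u x ^+ 2)%:E)%E.
  rewrite poweR_Lnorm//; apply: eq_integral => x _ /=.
  by rewrite powR_mulrn// real_normK// num_real.
have Nfin : ('N[mu]_2%:E[EFin \o u])%E \is a fin_num.
  rewrite ge0_fin_numE ?Lnorm_ge0//.
  by move: Lu; rewrite /L2 inE => /andP[_]; rewrite inE.
rewrite /Rintegral -E -(fineK Nfin) /= /L2norm -powR_mulrn//.
by rewrite fine_ge0// Lnorm_ge0.
Qed.

Lemma L2_integ_itv (u : R -> R) (a b : R) : L2 u -> integ `[a, b] u.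
Proof.
move=> Lu; apply: (@integ_le _ _ _ (fun x => 1 + u x ^+ 2)) => //.
- apply: integ_add => //; first exact: integ_cst.
  by apply: integ_subset (L2_integ_sqr Lu).
- by apply: measurable_funTS; exact: L2_measurable.
- move=> x _; have : 0 <= (`|u x| - 1) ^+ 2 by exact: sqr_ge0.
  have : 0 <= `|u x| by []. rewrite -[u x ^+ 2]real_normK ?num_real//.
  by nra.
Qed.

Lemma L2_locally_integrable (u : R -> R) : L2 u -> locally_integrable setT u.
Proof.
move=> Lu; split; [exact: L2_measurable|exact: openT|] => K _ cK.
have /compact_bounded[M [_ HM]] := cK.
have KM : K `<=` `[- (M + 1), M + 1]%classic.
  move=> x Kx /=; rewrite in_itv/= -ler_norml; apply: (HM (M + 1)) => //.
  by rewrite ltrDl.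
have mK : measurable K by apply: closed_measurable; apply: compact_closed => //; exact: Rhausdorff.
have : integ K u by apply: integ_subset KM (L2_integ_itv _ _ Lu).
by move=> /integrableP[].
Qed.

(* The bound [2 I <= e d + G / e], for all [e > 0], is optimal at [e = I / d]. *)
Lemma Rint_cauchy_schwarz (f : R -> R) (a b : R) : a <= b -> integ `[a, b] f ->
  integ `[a, b] (fun x => f x ^+ 2) ->
  (\int[mu]_(x in `[a, b]) `|f x|) ^+ 2 <=
    (b - a) * \int[mu]_(x in `[a, b]) (f x ^+ 2).
Proof.
rewrite le_eqVlt => /predU1P[<- _ _|ab fi f2i].
  by rewrite set_itv1 !Rintegral_set1 expr0n subrr mul0r.
set I := \int[mu]_(x in _) `|f x|; set G := \int[mu]_(x in _) _.
have I0 : 0 <= I by apply: Rintegral_ge0.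
have G0 : 0 <= G by apply: Rintegral_ge0 => x _; exact: sqr_ge0.
have d0 : 0 < b - a by rewrite subr_gt0.
have [->|In0] := eqVneq I 0; first by rewrite expr0n/= mulr_ge0// ltW.
have Igt0 : 0 < I by rewrite lt_def In0.
have key e : 0 < e -> I <= 2^-1 * (e * (b - a)) + (2 * e)^-1 * G.
  move=> e0.
  rewrite -(Rint_cst e (ltW ab)) /G -RintegralZl//; last exact: integ_cst.
  rewrite -RintegralZl// -RintegralD//; last 2 first.
  - by apply: integ_scale => //; exact: integ_cst.
  - exact: integ_scale.
  apply: le_Rintegral => //; first exact: integ_norm.
    by apply: integ_add => //; apply: integ_scale => //; exact: integ_cst.
  move=> x _; have H : 0 <= (`|f x| - e) ^+ 2 by exact: sqr_ge0.
  have e2 : 0 < (2 * e)^-1 by rewrite invr_gt0 mulr_gt0.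
  have E : 2^-1 * e + (2 * e)^-1 * f x ^+ 2 - `|f x| = (2 * e)^-1 * (`|f x| - e) ^+ 2.
    by rewrite sqrrB real_normK ?num_real//; field; rewrite gt_eqF.
  by rewrite -subr_ge0 E mulr_ge0// ltW.
have := key (I / (b - a)) (divr_gt0 Igt0 d0).
have -> : 2^-1 * (I / (b - a) * (b - a)) + (2 * (I / (b - a)))^-1 * G =
  (I ^+ 2 + (b - a) * G) / (2 * I).
  by field; rewrite ?gt_eqF.
by rewrite ler_pdivlMr ?mulr_gt0//; nra.
Qed.

Definition primitive_of (u g : R -> R) : Prop :=
  L2 g /\ forall x y, x <= y -> u y - u x = \int[mu]_(s in `[x, y]) g s.

Lemma Rint_itv_split (f : R -> R) (a b c : R) : a <= b -> b <= c -> integ `[a, c] f ->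
  \int[mu]_(s in `[a, c]) f s = \int[mu]_(s in `[a, b]) f s + \int[mu]_(s in `[b, c]) f s.
Proof.
move=> ab bc fi.
have := @Rintegral_itvB _ f (BLeft a) (BRight c) b fi.
rewrite !bnd_simp => /(_ ab bc) E.
rewrite -[X in _ + X]Rintegral_itv_obnd_cbnd.
  by rewrite -E; ring.
by apply: integ_subset fi => //; apply: subset_itvr; rewrite bnd_simp.
Qed.

Lemma primitive_holder (u g : R -> R) (x y : R) : primitive_of u g -> x <= y ->
  (u y - u x) ^+ 2 <= (y - x) * \int[mu]_s (g s ^+ 2).
Proof.
move=> [Lg H] xy; rewrite H//.
have gi := L2_integ_itv x y Lg.
have g2 : integ `[x, y] (fun x => g x ^+ 2) by apply: integ_subset (L2_integ_sqr Lg).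
apply: (@le_trans _ _ ((\int[mu]_(s in `[x, y]) `|g s|) ^+ 2)).
  rewrite -[X in X <= _]real_normK ?num_real// ler_sqr ?nnegrE ?normr_ge0 ?Rintegral_ge0//.
  exact: le_normr_Rintegral.
apply: le_trans (Rint_cauchy_schwarz xy gi g2) _.
rewrite ler_wpM2l ?subr_ge0// fine_le//.
- exact: (integrable_fin_num _ g2).
- exact: (integrable_fin_num _ (L2_integ_sqr Lg)).
- apply: ge0_subset_integral => //.
  by apply/measurable_EFinP; apply: measurable_funX; exact: L2_measurable.
  by move=> s _; rewrite lee_fin sqr_ge0.
Qed.

Lemma primitive_continuous (u g : R -> R) : primitive_of u g -> continuous u.
Proof.
move=> ug x.
set G := \int[mu]_s (g s ^+ 2).
have G0 : 0 <= G by apply: Rintegral_ge0 => s _; exact: sqr_ge0.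
have key y : (u x - u y) ^+ 2 <= `|x - y| * G.
  have [xy|yx] := leP x y.
    by rewrite -sqrrN opprB distrC ger0_norm ?subr_ge0//; exact: primitive_holder.
  by rewrite ger0_norm ?subr_ge0 ?(ltW yx)//; exact: primitive_holder (ltW yx).
apply/cvgrPdist_le => e e0; near=> y.
rewrite -ler_sqr ?nnegrE// ?(ltW e0)// real_normK ?num_real//.
apply: le_trans (key y) _.
apply: (@le_trans _ _ (`|x - y| * (G + 1))); first by rewrite ler_wpM2l// lerDl.
rewrite -ler_pdivlMr ?ltr_wpDl//.
near: y; exists (e ^+ 2 / (G + 1)) => /=.
  by rewrite divr_gt0 ?exprn_gt0// ltr_wpDl.
by move=> y /= /ltW.
Unshelve. all: by end_near. Qed.

(** The base point [x0] is a Lebesgue point of [u], so that [weak_FTC] identifies the primitive of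
    [g] with [u] at every Lebesgue point, that is, almost everywhere. *)
Lemma H1_representative (u g : R -> R) : L2 u -> L2 g -> is_weak_derivative u g ->
  exists uc, {ae mu, forall x, u x = uc x} /\ primitive_of uc g.
Proof.
move=> Lu Lg ug.
have lu := L2_locally_integrable Lu; have lg := L2_locally_integrable Lg.
have lae := lebesgue_differentiation lu.
have [x0 lx0] : exists x0, lebesgue_pt u x0.
  by have [x0 _ lx0] := ae_ex_itv ltr01 lae; exists x0.
pose uc y := u x0 + (if x0 <= y then \int[mu]_(s in `[x0, y]) g s
                     else - \int[mu]_(s in `[y, x0]) g s).
exists uc; split.
  apply: ae_imp lae => x lx; rewrite /uc; case: leP => xx.
    by rewrite -(weak_FTC lu lg ug lx0 lx xx); ring.
  by rewrite -(weak_FTC lu lg ug lx lx0 (ltW xx)); ring.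
split => // x y xy; rewrite /uc.
have gi a b : integ `[a, b] g by exact: L2_integ_itv.
case: (leP x0 x) => x0x; case: (leP x0 y) => x0y.
- by rewrite (Rint_itv_split x0x xy (gi _ _)); ring.
- by exfalso; lra.
- by rewrite (Rint_itv_split (ltW x0x) x0y (gi _ _)); ring.
- by rewrite (Rint_itv_split xy (ltW x0y) (gi _ _)); ring.
Qed.

(** Sobolev embedding with an explicit constant: [|u x| <= |u y| + \int |g|] for [y] in
    [[x, x + 1]]; after averaging over [y], each term is at most [e] by Cauchy-Schwarz on an
    interval of length 1. *)
Lemma primitive_sup_bound (u g : R -> R) (e x : R) : L2 u -> primitive_of u g ->
  0 < e -> \int[mu]_s (u s ^+ 2) + \int[mu]_s (g s ^+ 2) <= e ^+ 2 ->
  `|u x| <= 2 * e.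
Proof.
move=> Lu [Lg ug] e0 He.
have L2b (f : R -> R) : L2 f -> \int[mu]_s (f s ^+ 2) <= e ^+ 2 ->
    \int[mu]_(s in `[x, x + 1]) `|f s| <= e.
  move=> Lf fe; rewrite -ler_sqr ?nnegrE; [|exact: Rintegral_ge0|exact: ltW].
  have f2 : integ `[x, x + 1] (fun x => f x ^+ 2) by apply: integ_subset (L2_integ_sqr Lf).
  have xx : x <= x + 1 by rewrite lerDl.
  apply: le_trans (Rint_cauchy_schwarz xx (L2_integ_itv _ _ Lf) f2) _.
  rewrite addrAC subrr add0r mul1r; apply: le_trans fe; rewrite fine_le//.
  - exact: (integrable_fin_num _ f2).
  - exact: (integrable_fin_num _ (L2_integ_sqr Lf)).
  - apply: ge0_subset_integral => //.
      by apply/measurable_EFinP; apply: measurable_funX; exact: L2_measurable.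
    by move=> s _; rewrite lee_fin sqr_ge0.
have u2 : 0 <= \int[mu]_s (u s ^+ 2) by apply: Rintegral_ge0 => s _; exact: sqr_ge0.
have g2 : 0 <= \int[mu]_s (g s ^+ 2) by apply: Rintegral_ge0 => s _; exact: sqr_ge0.
have iu : \int[mu]_(s in `[x, x + 1]) `|u s| <= e.
  by apply: L2b => //; apply: le_trans He; rewrite lerDl.
have ig : \int[mu]_(s in `[x, x + 1]) `|g s| <= e.
  by apply: L2b => //; apply: le_trans He; rewrite lerDr.
have gi : integ `[x, x + 1] g by exact: L2_integ_itv.
have ui : integ `[x, x + 1] u by exact: L2_integ_itv.
rewrite mulr_natl mulr2n -lerBlDr; apply: le_trans iu.
have -> : `|u x| - e = \int[mu]_(s in `[x, x + 1]) (`|u x| - e).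
  by rewrite Rint_cst ?lerDl// addrAC subrr add0r mulr1.
apply: le_Rintegral => //; [exact: integ_cst|exact: integ_norm|].
move=> y /=; rewrite in_itv/= => /andP[xy yx].
have : `|u y - u x| <= e.
  rewrite ug//; apply: le_trans ig.
  rewrite (Rint_itv_split xy yx (integ_norm _ gi))//.
  apply: (@le_trans _ _ (\int[mu]_(s in `[x, y]) `|g s|)).
    by apply: le_normr_Rintegral => //; exact: L2_integ_itv.
  by rewrite lerDl Rintegral_ge0.
move=> uxy; rewrite lerBlDr.
have -> : u x = u y - (u y - u x) by rewrite subKr.
by apply: le_trans (ler_normB _ _) _; rewrite lerD2l.
Qed.

Lemma continuous_ae_eq (f g : R -> R) : continuous f -> continuous g ->
  {ae mu, forall x, f x = g x} -> f = g.
Proof.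
move=> cf cg fg; apply/funext => x; apply: contrapT => /eqP nfg.
have : \forall y \near x, f y - g y != 0.
  have cfg : {for x, continuous (fun y => f y - g y)} by apply: cvgB; [exact: cf|exact: cg].
  by apply: (cvgr_neq0 _ cfg); rewrite subr_eq0.
move=> [e /= e0 He].
have xe : x < x + e / 2 by rewrite ltrDl divr_gt0.
have [y /andP[xy yx] fgy] := ae_ex_itv xe fg.
have /He : ball_ Num.norm x e y by rewrite /ball_/= distrC ger0_norm; lra.
by rewrite fgy subrr eqxx.
Qed.

End H1Representatives.

(** * Continuous representatives and weak evolution *)

Section ContinuousRepresentative.
Context {R : realType}.
Local Notation mu := (@lebesgue_measure R).
Local Notation integ D f := (mu.-integrable D (EFin \o f)).

Lemma Rint_ae_eq (D : set R) (f g : R -> R) : measurable D -> measurable_fun D f ->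
  measurable_fun D g -> {ae mu, forall x, f x = g x} ->
  \int[mu]_(x in D) f x = \int[mu]_(x in D) g x.
Proof.
move=> mD mf mg fg; congr fine; apply: ae_eq_integral => //.
- exact/measurable_EFinP.
- exact/measurable_EFinP.
- by apply: ae_imp fg => x -> _.
Qed.

Lemma L2_ae_eq (u v : R -> R) : L2 u -> measurable_fun setT v ->
  {ae mu, forall x, u x = v x} -> L2 v.
Proof.
move=> Lu mv uv; have u2 := L2_integ_sqr Lu.
rewrite /L2 inE; apply/andP; split; rewrite inE//=.
rewrite /finite_norm; apply: (@lty_poweRy _ _ 2) => //.
rewrite poweR_Lnorm//.
have [_] := integrableP _ _ _ u2; congr (_ < _)%E.
apply: ae_eq_integral => //.
- by apply: measurableT_comp => //; apply/measurable_EFinP; apply: measurable_funX; exact: L2_measurable.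
- apply/measurable_EFinP; apply: (@measurableT_comp _ _ _ _ _ _ (fun x : R => x `^ 2)) => //.
  by apply: measurableT_comp.
apply: ae_imp uv => x uvx _ /=.
by rewrite -uvx powR_mulrn// normrX.
Qed.

Lemma smooth_smooth_fun (f : R^o -> R) : smooth f -> smooth_fun (f : R -> R).
Proof.
move=> sf n; elim: n f sf => [|n IH] f sf; first by have [] := sf [::].
exists ('D_1 f); split=> [x|].
  have [_ df] := sf [::]; by apply: DeriveDef; first exact: df.
(* [iter_derive] applies the last vector of the list first. *)
apply: IH => vs; have := sf (rcons vs 1).
by rewrite /iter_derive -cats1 foldr_cat.
Qed.

Lemma test_function_support (f : R^o -> R) : test_function f ->
  exists M, forall x, f x != 0 -> - M <= x <= M.
Proof.
move=> [_ /compact_bounded[M [_ HM]]].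
exists (M + 1) => x fx; rewrite -ler_norml; apply: (HM (M + 1)); first by rewrite ltrDl.
exact: subset_closure.
Qed.

Lemma derive_support (f : R -> R) M : (forall x, f x != 0 -> - M <= x <= M) ->
  forall x, derive1 f x != 0 -> - M <= x <= M.
Proof.
move=> fM x; apply: contra_neqT => nxM; apply: (@near_cst_derive _ _ _ 0).
have : \forall y \near x, ~~ (- M <= y <= M).
  have oM : open (~` `[- M, M]%classic : set R) by apply: closed_openC; exact: interval_closed.
  have xM : (~` `[- M, M]%classic : set R) x by rewrite /= in_itv/=; exact/negP.
  have := open_nbhs_nbhs (conj oM xM); apply: filterS => y /=.
  by rewrite in_itv/= => /negP.
by apply: filterS => y; apply: contraNeq => /fM.
Qed.

Lemma smooth_support_bounded (f : R -> R) M : continuous f ->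
  (forall x, f x != 0 -> - M <= x <= M) -> exists C, forall x, `|f x| <= C.
Proof.
move=> cf fM; have [M0|M0] := leP (- M) M; last first.
  exists 0 => x; have [->|/fM xM] := eqVneq (f x) 0; first by rewrite normr0.
  by exfalso; lra.
have cnf : {within `[- M, M], continuous (fun y => `|f y|)}.
  by apply: continuous_subspaceT => y; apply: cvg_norm; exact: cf.
have [c _ Hc] := EVT_max M0 cnf.
exists `|f c| => x; have [->|/fM xM] := eqVneq (f x) 0; first by rewrite normr0.
by apply: Hc; rewrite in_itv.
Qed.

Lemma L2_test_integ (u f : R -> R) M : L2 u -> continuous f ->
  (forall x, f x != 0 -> - M <= x <= M) -> integ setT (fun x => u x * f x).
Proof.
move=> Lu cf fM; have [C HC] := smooth_support_bounded cf fM.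
apply: (@integ_supp _ _ `[- M, M]%classic) => //.
  move=> x nx; case: (eqVneq (f x) 0) => [->|/fM xM]; first by rewrite mulr0.
  by exfalso; apply: nx; rewrite /= in_itv.
have : integ `[- M, M] (fun x => f x * u x).
  apply: (@integ_mul_bounded _ _ _ _ C) => //; first exact: L2_integ_itv.
  exact: continuous_measurable.
by apply: eq_integrable => // x _ /=; rewrite mulrC.
Qed.

Lemma weak_derivative_sub (u1 v1 u2 v2 : R -> R) : L2 u1 -> L2 v1 -> L2 u2 -> L2 v2 ->
  is_weak_derivative u1 v1 -> is_weak_derivative u2 v2 ->
  is_weak_derivative (u1 \- u2) (v1 \- v2).
Proof.
move=> Lu1 Lv1 Lu2 Lv2 H1 H2 phi tphi.
have sphi := smooth_smooth_fun tphi.1.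
have [M HM] := test_function_support tphi.
have cphi := smooth_continuous sphi.
have cdphi := smooth_continuous (smooth_derive sphi).2.
have HM' := derive_support HM.
transitivity (\int[mu]_x (u1 x * derive1 phi x) - \int[mu]_x (u2 x * derive1 phi x)).
  rewrite -RintegralB//; try by apply: L2_test_integ HM'.
  by apply: eq_Rintegral => x _ /=; rewrite mulrBl.
rewrite H1// H2// -opprD; congr (- _).
transitivity (\int[mu]_x (v1 x * phi x) - \int[mu]_x (v2 x * phi x)); first by [].
rewrite -RintegralB//; try by apply: L2_test_integ HM.
by apply: eq_Rintegral => x _ /=; rewrite mulrBl.
Qed.

Variable z : R -> R -> R.
Hypothesis z_cont : continuous_H1 z.

Lemma H1_continuous_representative : exists u : R -> R -> R,
  [/\ forall t, {ae mu, forall x, z t x = u t x},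
      forall t, L2 (u t) /\ exists g, primitive_of (u t) g &
      forall t0 e, 0 < e -> exists2 d, 0 < d &
        forall t, `|t - t0| < d -> forall x, `|u t x - u t0 x| <= e].
Proof.
have [zH1 znorm] := z_cont.
have rep t : exists uc, {ae mu, forall x, z t x = uc x} /\ exists g, primitive_of uc g.
  have [Lz [g [Lg zg]]] := zH1 t.
  by have [uc [zu ug]] := H1_representative Lz Lg zg; exists uc; split => //; exists g.
have [u Hu] := choice rep.
have Lut t : L2 (u t).
  have [zu [g ug]] := Hu t; have [Lz _] := zH1 t.
  by apply: L2_ae_eq Lz _ zu; apply: continuous_measurable => //; exact: primitive_continuous ug.
exists u; split => [t|t|t0 e e0]; first by have [] := Hu t.
  by have [] := Hu t.
have [/= d d0 Hd] := (cvgrPdist_lt _ _).1 (znorm t0) (e / 2) (divr_gt0 e0 (ltr0Sn _ 1)).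
exists d => // t td x.
have /Hd : ball_ Num.norm t0 d t by rewrite /ball_/= distrC.
rewrite /= sub0r normrN => Hn.
set w := z t \- z t0 in Hn.
have [Lzt [g1 [Lg1 zg1]]] := zH1 t; have [Lz0 [g2 [Lg2 zg2]]] := zH1 t0.
have Lw : L2 w by exact: L2_sub.
(* [g1 \- g2] is an L^2 weak derivative of [w], so [xget] does not fall back on its default
   value. *)
have [Lh wh] : L2 (weak_derivative w) /\ is_weak_derivative w (weak_derivative w).
  rewrite /weak_derivative; case: xgetP => [h _ //|/(_ (g1 \- g2))]; case.
  by split; [exact: L2_sub|exact: weak_derivative_sub].
have [uc [wu ucp]] := H1_representative Lw Lh wh.
have [zu1 [k1 uk1]] := Hu t; have [zu2 [k2 uk2]] := Hu t0.
have cuc := primitive_continuous ucp.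
(* Both sides are continuous and agree almost everywhere, so the Sobolev bound on [uc] bounds the
   difference of the chosen representatives. Its factor 2 is the reason for [e / 2] above. *)
have Euc : uc = (fun x => u t x - u t0 x).
  apply: continuous_ae_eq => //.
    by move=> y; apply: cvgB; [exact: (primitive_continuous uk1)|exact: (primitive_continuous uk2)].
  by apply: ae_imp (ae_and wu (ae_and zu1 zu2)) => y [<- [<- <-]].
have Luc : L2 uc by apply: L2_ae_eq Lw _ wu; exact: continuous_measurable.
have e2 : 0 < e / 2 by rewrite divr_gt0.
have -> : u t x - u t0 x = uc x by rewrite Euc.
have := primitive_sup_bound x Luc ucp e2.
rewrite [2 * _]mulrC divfK//; apply.
rewrite (_ : \int[mu]_s (uc s ^+ 2) = \int[mu]_s (w s ^+ 2)); last first.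
  apply: Rint_ae_eq => //; first by apply: measurable_funX; exact: L2_measurable.
    by apply: measurable_funX; exact: L2_measurable.
  by apply: ae_imp wu => y ->.
rewrite -!L2norm_sqr//.
have s0 : 0 <= L2norm w ^+ 2 + L2norm (weak_derivative w) ^+ 2 by rewrite addr_ge0 ?sqr_ge0.
rewrite -(sqr_sqrtr s0) ler_sqr ?nnegrE ?sqrtr_ge0 ?ltW//.
by exact: le_lt_trans (ler_norm _) Hn.
Qed.

End ContinuousRepresentative.

(** * Evolution of the integrals of [u] against a fixed test function in space *)

Section WeakEvolution.
Context {R : realType}.
Local Notation mu := (@lebesgue_measure R).
Local Notation integ D f := (mu.-integrable D (EFin \o f)).

(** Continuity in time with values in the bounded continuous functions under the sup norm, spelled
    out pointwise. *)
Definition sup_continuous (f : R -> R -> R) : Prop :=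
  (forall t, continuous (f t)) /\ (forall t, exists M, forall x, `|f t x| <= M) /\
  forall t0 e, 0 < e -> exists2 d, 0 < d &
    forall t, `|t - t0| < d -> forall x, `|f t x - f t0 x| <= e.

Lemma integ_bounded_mul (f k : R -> R) M : continuous f -> (forall x, `|f x| <= M) ->
  integ setT k -> integ setT (fun x => f x * k x).
Proof.
move=> cf fM ki; apply: (@integ_mul_bounded _ _ _ _ M) => //.
exact: continuous_measurable.
Qed.

Lemma Rint_bounded_mul (f k : R -> R) M : continuous f -> (forall x, `|f x| <= M) ->
  integ setT k -> `|\int[mu]_x (f x * k x)| <= M * \int[mu]_x `|k x|.
Proof.
move=> cf fM ki; rewrite -RintegralZl//; last exact: integ_norm.
apply: Rint_le_norm => //; first exact: integ_bounded_mul fM _.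
  by apply: integ_scale => //; exact: integ_norm.
by move=> x _; rewrite normrM ler_wpM2r.
Qed.

Lemma sup_continuous_Rint (f : R -> R -> R) (k : R -> R) : sup_continuous f ->
  integ setT k -> continuous (fun t => \int[mu]_x (f t x * k x)).
Proof.
move=> [cf [bf sf]] ki t0; apply/cvgrPdist_le => e e0.
set I := \int[mu]_x `|k x|.
have I0 : 0 <= I by apply: Rintegral_ge0.
have I1 : 0 < I + 1 by rewrite ltr_wpDl.
have [d d0 Hd] := sf t0 (e / (I + 1)) (divr_gt0 e0 I1).
exists d => // t; rewrite /ball_/= distrC => /Hd tt0.
have [M HM] := bf t; have [M0 HM0] := bf t0.
rewrite distrC -RintegralB//; try by apply: integ_bounded_mul; [exact: cf|eassumption|].
rewrite (_ : \int[mu]_x _ = \int[mu]_x ((f t x - f t0 x) * k x)); last first.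
  by apply: eq_Rintegral => x _; rewrite mulrBl.
have cff : continuous (fun x => f t x - f t0 x) by move=> x; apply: cvgB; exact: cf.
apply: le_trans (Rint_bounded_mul cff tt0 ki) _.
rewrite -/I -mulrA ler_piMr ?(ltW e0)// mulrC ler_pdivrMr// mul1r lerDl//.
Qed.

Variables (beta : R) (z u : R -> R -> R).
Hypothesis z_sol : distributional_solution beta z.
Hypothesis zL2 : forall t, L2 (z t).
Hypothesis zu : forall t, {ae mu, forall x, z t x = u t x}.
Hypothesis su : sup_continuous u.

Definition flux (beta : R) (v : R) : R := beta * v + v ^+ 2 / 2.

Lemma sup_continuous_flux : sup_continuous (fun t x => flux beta (u t x)).
Proof.
have [cu [bu scu]] := su; split; [|split].
- move=> t x; apply: cvgD; first by apply: cvgM; [exact: cvg_cst|exact: cu].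
  by apply: cvgM; [apply: cvgM; exact: cu|exact: cvg_cst].
- move=> t; have [M HM] := bu t; exists (`|beta| * M + M ^+ 2 / 2) => x.
  rewrite /flux (le_trans (ler_normD _ _))// lerD//; first by rewrite normrM ler_wpM2l.
  rewrite normrM normrX [`|2^-1|]ger0_norm// ler_wpM2r// ler_sqr ?nnegrE//.
  exact: le_trans (HM x).
move=> t0 e e0; have [M HM] := bu t0.
have M0 : 0 <= M by apply: le_trans (HM 0).
pose C := `|beta| + M + 1.
have C0 : 0 < C by rewrite /C ltr_wpDl// addr_ge0.
have e1 : 0 < Num.min 1 (e / C) by rewrite lt_min ltr01 divr_gt0.
have [d d0 Hd] := scu t0 _ e1.
exists d => // t /Hd tt0 x.
have := tt0 x; rewrite le_min => /andP[t1 te].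
have -> : flux beta (u t x) - flux beta (u t0 x) =
  (u t x - u t0 x) * (beta + u t0 x + (u t x - u t0 x) / 2) by rewrite /flux; field.
rewrite normrM; apply: (@le_trans _ _ (e / C * C)); last by rewrite divfK// gt_eqF.
rewrite ler_pM// /C (le_trans (ler_normD _ _))// lerD//.
  by rewrite (le_trans (ler_normD _ _))// lerD2l.
by rewrite normrM [`|2^-1|]ger0_norm//; lra.
Qed.

(** Testing the equation against [a(t) b(x)] for every [a] says that [m] has weak derivative [n] in
    time. Both are continuous, so every time is a Lebesgue point and [weak_FTC] holds between any
    two times. *)
Lemma weak_evolution (b : R -> R) (M s t : R) : smooth_fun b ->
  (forall x, b x != 0 -> - M <= x <= M) -> s <= t ->
  \int[mu]_x (u t x * (b x - derive1 (derive1 b) x)) -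
  \int[mu]_x (u s x * (b x - derive1 (derive1 b) x)) =
  \int[mu]_(r in `[s, t]) \int[mu]_x (flux beta (u r x) * derive1 b x).
Proof.
move=> sb bM st.
have sb1 := (smooth_derive sb).2; have sb2 := (smooth_derive sb1).2.
have bM1 := derive_support bM; have bM2 := derive_support bM1.
have cint (f : R -> R) : continuous f -> (forall x, f x != 0 -> - M <= x <= M) -> integ setT f.
  move=> cf fM; apply: (@integ_supp _ _ `[- M, M]%classic) => //.
    by move=> x nx; apply/eqP; apply: contra_notT nx => /fM; rewrite /= in_itv.
  exact: integ_continuous.
pose k x := b x - derive1 (derive1 b) x.
have ki : integ setT k.
  by apply: integ_sub => //; apply: cint => //; exact: smooth_continuous.
have b1i : integ setT (derive1 b) by apply: cint => //; exact: smooth_continuous.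
pose m r := \int[mu]_x (u r x * k x).
pose n r := \int[mu]_x (flux beta (u r x) * derive1 b x).
have cm : continuous m by exact: sup_continuous_Rint.
have cn : continuous n by exact: (sup_continuous_Rint sup_continuous_flux).
have loc (f : R -> R) : continuous f -> locally_integrable setT f.
  move=> cf; split; [exact: continuous_measurable|exact: openT|] => K _ cK.
  have : integ K f by apply: continuous_compact_integrable => //; exact: continuous_subspaceT.
  by move=> /integrableP[].
have leb (f : R -> R) r : continuous f -> lebesgue_pt f r.
  move=> cf; apply: (@continuous_lebesgue_pt _ _ _ setT) => //; last exact: cf.
    by split; [exact: openT|].
  exact: continuous_measurable.
apply: (weak_FTC (loc m cm) (loc n cn) _ (leb m s cm) (leb m t cm) st).
move=> a ta; have sa := smooth_smooth_fun ta.1.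
have [N aN] := test_function_support ta; have aN1 := derive_support aN.
have sa1 := (smooth_derive sa).2.
have tphi := test_function_tensor sa sb aN bM.
have := z_sol tphi.
have Edt : dt (fun p : R * R => a p.1 * b p.2) = (fun p => derive1 a p.1 * b p.2).
  by apply/funext => -[r x]; rewrite dt_tensor.
have Edx : dx (dx (dt (fun p : R * R => a p.1 * b p.2))) =
    (fun p => derive1 a p.1 * derive1 (derive1 b) p.2).
  have E1 : dx (fun p : R * R => derive1 a p.1 * b p.2) = fun p => derive1 a p.1 * derive1 b p.2.
    by apply/funext => -[r x]; rewrite dx_tensor.
  rewrite Edt E1.
  by apply/funext => -[r x]; rewrite dx_tensor.
rewrite Edx Edt => H.
have cia (f g : R -> R) : continuous f -> continuous g ->
    (forall x, g x != 0 -> - N <= x <= N) -> integ setT (fun r => f r * g r).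
  move=> cf cg gN; apply: (@integ_supp _ _ `[- N, N]%classic) => //.
    move=> x nx; have [->|/gN xN] := eqVneq (g x) 0; first by rewrite mulr0.
    by exfalso; apply: nx; rewrite /= in_itv.
  by apply: integ_continuous => x; apply: cvgM; [exact: cf|exact: cg].
apply/eqP; rewrite -addr_eq0 -RintegralD//; last 2 first.
- by apply: cia => //; exact: smooth_continuous.
- by apply: cia => //; exact: smooth_continuous.
rewrite -[X in _ == X]H; apply/eqP; apply: eq_Rintegral => r _.
have [cu [bu scu]] := su; have [C HC] := bu r.
have [cfl [bfl _]] := sup_continuous_flux; have [C' HC'] := bfl r.
rewrite /m /n mulrC [X in _ + X]mulrC.
rewrite -RintegralZl//; last by apply: integ_bounded_mul HC _ => //; exact: cu.
rewrite -RintegralZl//; last by apply: integ_bounded_mul HC' _ => //; exact: cfl.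
rewrite -RintegralD//; last 2 first.
- by apply: integ_scale => //; apply: integ_bounded_mul HC _ => //; exact: cu.
- by apply: integ_scale => //; apply: integ_bounded_mul HC' _ => //; exact: cfl.
have mk : measurable_fun setT k by exact: integ_measurable ki.
have mb1 : measurable_fun setT (derive1 b) by exact: integ_measurable b1i.
have mz : measurable_fun setT (z r) by exact: L2_measurable.
have mfu : measurable_fun setT (u r) by apply: continuous_measurable => //; exact: cu.
(* The equation is stated for [z]; at each time it is carried over to the representative [u]. *)
transitivity (\int[mu]_x (derive1 a r * (z r x * k x) + a r * (flux beta (z r x) * derive1 b x))).
  apply: Rint_ae_eq => //.
  - apply: measurable_funD; apply: measurable_funM => //; apply: measurable_funM => //.
    by apply: continuous_measurable => //; exact: cfl.
  - apply: measurable_funD; apply: measurable_funM => //; apply: measurable_funM => //.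
    apply: measurable_funD; apply: measurable_funM => //.
    exact: measurable_funX.
  - by apply: ae_imp (zu r) => x ->.
apply: eq_Rintegral => x _; rewrite dx_tensor// /k /flux/=; ring.
Qed.

End WeakEvolution.

(** * The pointwise evolution equation *)

Section ExponentialKernel.
Context {R : realType}.
Local Notation mu := (@lebesgue_measure R).
Local Notation integ D f := (mu.-integrable D (EFin \o f)).
Local Notation S := (@smooth_step R).

(** Twice the Green function of [1 - dx^2]. *)
Definition exp_abs (y : R) : R := expR (- `|y|).

Lemma exp_abs_gt0 y : 0 < exp_abs y.
Proof. exact: expR_gt0. Qed.

Lemma exp_abs_le1 y : exp_abs y <= 1.
Proof. by rewrite /exp_abs -[leRHS]expR0 ler_expR oppr_le0. Qed.

Lemma continuous_exp_abs : continuous exp_abs.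
Proof.
move=> y; apply: continuous_cvg; first exact: continuous_expR.
by apply: cvgN; exact: (@norm_continuous _ R).
Qed.

Lemma exp_abs_integral0 : (\int[mu]_y (exp_abs y)%:E = 2%:E)%E.
Proof.
rewrite ge0_symfun_integralT; last 3 first.
- by move=> y; rewrite ltW// exp_abs_gt0.
- exact: continuous_exp_abs.
- by move=> y /=; rewrite /exp_abs normrN.
rewrite (_ : [set x : R | 0 <= x] = `[0, +oo[%classic); last by rewrite set_itvcy.
rewrite (@ge0_continuous_FTC2y _ _ (fun y => - expR (- y)) 0 0)//.
- by rewrite oppr0 expR0 -EFinB sub0r opprK -EFinM mulr1.
- by move=> y _; rewrite ltW// exp_abs_gt0.
- by apply: continuous_subspaceT; exact: continuous_exp_abs.
- by rewrite -oppr0; apply: cvgN; exact: cvgr_expR.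
- apply: cvg_at_right_filter.
  exact: (derive_continuous (derive_opp (derive_expR (derive_opp (derive_id (0 : R)))))).
- move=> y; rewrite in_itv/= andbT => y0.
  rewrite (derive1_is (derive_opp (derive_expR (derive_opp (derive_id y))))).
  by rewrite /exp_abs gtr0_norm//; ring.
Qed.

Lemma exp_abs_integral x : (\int[mu]_s (exp_abs (s - x))%:E = 2%:E)%E.
Proof.
have d (s : R) : is_derive s 1 (fun s : R => s - x) 1.
  by apply: (is_derive_eq (derive_sub (derive_id s) (derive_cst x s))); rewrite subr0.
have d1 : derive1 (fun s : R => s - x) = cst 1 by apply/funext => s; exact: derive1_is.
rewrite -exp_abs_integral0 [RHS](@increasing_ge0_integration_by_substitutionT _ (fun s => s - x))//.
- by apply: eq_integral => s _; rewrite d1 /= mulr1.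
- by move=> a b ab; rewrite ltrD2r.
- by rewrite d1 => s; exact: cvg_cst.
- by rewrite d1; exact: is_cvg_cst.
- by rewrite d1; exact: is_cvg_cst.
- by apply: cvg_addrr_Ny.
- by apply: cvg_addrr.
- exact: continuous_exp_abs.
- by move=> y; rewrite ltW// exp_abs_gt0.
Qed.

Lemma continuous_exp_abs_shift x : continuous (fun s => exp_abs (s - x)).
Proof.
move=> s; apply: continuous_cvg; first exact: continuous_exp_abs.
by apply: cvgB; [exact: cvg_id|exact: cvg_cst].
Qed.

Lemma integ_exp_abs x : integ setT (fun s => exp_abs (s - x)).
Proof.
apply/integrableP; split.
  apply/measurable_EFinP; apply: continuous_measurable => //.
  exact: continuous_exp_abs_shift.
rewrite (_ : (\int[mu]_s _)%E = 2%:E) ?ltry// -(exp_abs_integral x).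
by apply: eq_integral => s _ /=; rewrite ger0_norm// ltW// exp_abs_gt0.
Qed.

Lemma Rint_exp_abs x : \int[mu]_s exp_abs (s - x) = 2.
Proof. by rewrite /Rintegral exp_abs_integral. Qed.

(** A smooth substitute for the absolute value, exact for [|y| >= 1]: rescaled to [sabs (N y) / N],
    it can differ from [|y|] only within [1 / N] of the origin. *)
Let sabs (y : R) : R := y * (2 * S ((y + 1) / 2) - 1).

Let sabs_ge1 y : 1 <= y -> sabs y = y.
Proof. by move=> y1; rewrite /sabs smooth_step_ge1; [ring|lra]. Qed.

Let sabs_leN1 y : y <= -1 -> sabs y = - y.
Proof. by move=> y1; rewrite /sabs smooth_step_le0; [ring|lra]. Qed.

Let sabs_geN y : - sabs y <= `|y|.
Proof.
apply: le_trans (ler_norm _) _; rewrite normrN /sabs normrM ler_piMr// ler_norml.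
have := smooth_step_ge0 ((y + 1) / 2); have := smooth_step_le1 ((y + 1) / 2).
by move=> *; apply/andP; split; lra.
Qed.

Let smooth_sabs : smooth_fun sabs.
Proof.
apply: smooth_mul; first exact: smooth_id.
apply: smooth_sub; last exact: smooth_cst.
apply: smooth_mul; first exact: smooth_cst.
apply: (smooth_comp (@smooth_smooth_step R)).
apply: smooth_mul; last exact: smooth_cst.
by apply: smooth_add; [exact: smooth_id|exact: smooth_cst].
Qed.

Let D1 := derive1 sabs.
Let D2 := derive1 D1.
Let smooth_D1 : smooth_fun D1. Proof. exact: (smooth_derive smooth_sabs).2. Qed.
Let dsabs (y : R) : is_derive y 1 sabs (D1 y). Proof. exact: (smooth_derive smooth_sabs).1. Qed.
Let dD1 (y : R) : is_derive y 1 D1 (D2 y). Proof. exact: (smooth_derive smooth_D1).1. Qed.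

Let D1_gt1 y : 1 < y -> D1 y = 1.
Proof.
move=> y1; apply: derive1_is; apply: (@derive_near _ (fun y => y)).
by near=> w; rewrite sabs_ge1// ltW//; near: w; exact: lt_nbhsr.
Unshelve. all: by end_near. Qed.

Let D1_ltN1 y : y < -1 -> D1 y = -1.
Proof.
move=> y1; apply: derive1_is; apply: (@derive_near _ (fun y => - y)).
by near=> w; rewrite sabs_leN1// ltW//; near: w; exact: lt_nbhsl.
Unshelve. all: by end_near. Qed.

Let D2_out y : 1 < `|y| -> D2 y = 0.
Proof.
rewrite lter_normr => /orP[y1|y1].
  apply: (@near_cst_derive _ _ _ 1); near=> w; apply: D1_gt1.
  by near: w; exact: lt_nbhsr.
apply: (@near_cst_derive _ _ _ (-1)); near=> w; apply: D1_ltN1.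
by near: w; apply: lt_nbhsl; lra.
Unshelve. all: by end_near. Qed.

Let D1_out y : 1 < `|y| -> 1 - D1 y ^+ 2 = 0.
Proof.
rewrite lter_normr => /orP[y1|y1]; first by rewrite D1_gt1//; ring.
by rewrite D1_ltN1; [ring|lra].
Qed.

Let out_bounded (f : R -> R) : continuous f -> (forall y, 1 < `|y| -> f y = 0) ->
  exists C, forall y, `|f y| <= C.
Proof.
move=> cf f0; apply: (@smooth_support_bounded _ f 1 cf) => y.
by rewrite -ler_norml; apply: contra_neqT; rewrite -ltNge; exact: f0.
Qed.

Let chi (y : R) : R := S (y + 2) * S (2 - y).
Let chi1 := derive1 chi.
Let chi2 := derive1 chi1.
Let smooth_chi : smooth_fun chi.
Proof.
apply: smooth_mul; apply: (smooth_comp (@smooth_smooth_step R)).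
  by apply: smooth_add; [exact: smooth_id|exact: smooth_cst].
by apply: smooth_sub; [exact: smooth_cst|exact: smooth_id].
Qed.
Let smooth_chi1 : smooth_fun chi1. Proof. exact: (smooth_derive smooth_chi).2. Qed.
Let dchi (y : R) : is_derive y 1 chi (chi1 y). Proof. exact: (smooth_derive smooth_chi).1. Qed.
Let dchi1 (y : R) : is_derive y 1 chi1 (chi2 y). Proof. exact: (smooth_derive smooth_chi1).1. Qed.

Let chi_in y : `|y| <= 1 -> chi y = 1.
Proof. by rewrite ler_norml => /andP[? ?]; rewrite /chi !smooth_step_ge1 ?mulr1//; lra. Qed.

Let chi1_in y : `|y| < 1 -> chi1 y = 0.
Proof.
move=> y1; apply: (@near_cst_derive _ _ _ 1); near=> w; apply: chi_in.
rewrite ltW//; near: w.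
by apply: (cvgr_lt `|y|) => //; exact: (@norm_continuous _ R).
Unshelve. all: by end_near. Qed.

Let chi_supp y : chi y != 0 -> - 2 <= y <= 2.
Proof.
apply: contra_neqT; rewrite negb_and -!ltNge => /orP[y2|y2]; rewrite /chi.
  by rewrite smooth_step_le0 ?mul0r//; lra.
by rewrite [S (2 - y)]smooth_step_le0 ?mulr0//; lra.
Qed.

Let chi_norm y : `|chi y| <= 1.
Proof.
rewrite /chi normrM !ger0_norm ?smooth_step_ge0//.
by rewrite mulr_ile1 ?smooth_step_ge0 ?smooth_step_le1.
Qed.

Let N (n : nat) : R := n.+1%:R.
Let N_ge1 n : 1 <= N n. Proof. by rewrite ler1n. Qed.
Let N_gt0 n : 0 < N n. Proof. by rewrite ltr0n. Qed.
Let N_neq0 n : N n != 0. Proof. by rewrite pnatr_eq0. Qed.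
Let h n (y : R) : R := expR (- ((N n)^-1 * sabs (N n * y))).

Let h_ge0 n y : 0 <= h n y. Proof. exact: expR_ge0. Qed.

Let h_out n y : 1 <= N n * `|y| -> h n y = exp_abs y.
Proof.
move=> Ny; rewrite /h /exp_abs; congr (expR (- _)).
have [y0|y0] := leP 0 y.
  by rewrite ger0_norm// in Ny *; rewrite sabs_ge1// mulKf.
rewrite ltr0_norm// in Ny *; rewrite sabs_leN1; first by rewrite mulrN mulKf.
by rewrite -lerN2 opprK -mulrN.
Qed.

Let h_le n y : h n y <= expR 2 * exp_abs y.
Proof.
have [Ny|Ny] := leP 1 (N n * `|y|).
  by rewrite h_out// ler_peMl ?ltW ?exp_abs_gt0// expR_gt1.
rewrite /h /exp_abs -expRD ler_expR.
have y1 : `|y| <= 1.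
  by apply: le_trans (ltW Ny); rewrite ler_peMl.
have : - ((N n)^-1 * sabs (N n * y)) <= `|y|.
  rewrite -mulrN -(ler_pM2l (N_gt0 n)) mulrA divff// mul1r.
  by apply: le_trans (sabs_geN _) _; rewrite normrM ger0_norm.
by move=> H; apply: le_trans H _; lra.
Qed.

(** The kernel [exp_abs] rounded off at scale [1 / N] near the origin and cut off at scale [N] at
    infinity; [b1] and [b2] are its first two derivatives in closed form. *)
Let b n (y : R) : R := h n y * chi ((N n)^-1 * y).
Let b1 n (y : R) : R :=
  h n y * (- D1 (N n * y) * chi ((N n)^-1 * y) + (N n)^-1 * chi1 ((N n)^-1 * y)).
Let b2 n (y : R) : R :=
  h n y * ((D1 (N n * y) ^+ 2 - N n * D2 (N n * y)) * chi ((N n)^-1 * y)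
    - 2 * (N n)^-1 * D1 (N n * y) * chi1 ((N n)^-1 * y)
    + (N n)^-1 ^+ 2 * chi2 ((N n)^-1 * y)).

Let dh n (y : R) : is_derive y 1 (h n) (- D1 (N n * y) * h n y).
Proof.
have dN : is_derive y 1 (fun y => N n * y) (N n).
  by apply: (is_derive_eq (derive_scale (N n) (derive_id y))); rewrite mulr1.
have d := derive_expR (derive_opp (derive_scale (N n)^-1 (derive_comp (dsabs _) dN))).
by apply: (is_derive_eq d); rewrite /h [_ * N n]mulrC mulKf//; ring.
Qed.

Let dscale (f : R -> R) (f' c y : R) : is_derive (c * y) 1 f f' ->
  is_derive y 1 (fun y => f (c * y)) (c * f').
Proof.
move=> df; have dc : is_derive y 1 (fun y => c * y) c.
  by apply: (is_derive_eq (derive_scale c (derive_id y))); rewrite mulr1.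
by rewrite mulrC; exact: (@derive_comp _ f (fun y => c * y) y _ _ df dc).
Qed.

Let db n (y : R) : is_derive y 1 (b n) (b1 n y).
Proof.
apply: (is_derive_eq (derive_mul (dh n y) (dscale (dchi ((N n)^-1 * y))))).
by rewrite /b1; ring.
Qed.

Let db1 n (y : R) : is_derive y 1 (b1 n) (b2 n y).
Proof.
have e1 := derive_opp (dscale (dD1 (N n * y))).
have e2 := derive_mul e1 (dscale (dchi ((N n)^-1 * y))).
have e3 := derive_scale (N n)^-1 (dscale (dchi1 ((N n)^-1 * y))).
apply: (is_derive_eq (derive_mul (dh n y) (derive_add e2 e3))).
by rewrite /b2; ring.
Qed.

Let smooth_b n : smooth_fun (b n).
Proof.
apply: smooth_mul.
  apply: (smooth_comp (@smooth_expR R)); apply: smooth_opp.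
  apply: smooth_mul; first exact: smooth_cst.
  apply: (smooth_comp smooth_sabs).
  by apply: smooth_mul; [exact: smooth_cst|exact: smooth_id].
apply: (smooth_comp smooth_chi).
by apply: smooth_mul; [exact: smooth_cst|exact: smooth_id].
Qed.

(** The smooth form of [(1 - dx^2) exp (- |y|) = 2 delta]: [b n - b2 n] is [O(N)] everywhere and
    [O(1 / N) exp_abs] away from a window of width of order [1 / N], while [b1 n] tends to the
    kernel of [dx] composed with the resolvent, with an integrable majorant. *)
Lemma exp_abs_approximation : exists (b b1 b2 : nat -> R -> R) (C : R), 0 <= C /\
  (forall n, smooth_fun (b n)) /\
  (forall n (y : R), is_derive y 1 (b n) (b1 n y)) /\
  (forall n (y : R), is_derive y 1 (b1 n) (b2 n y)) /\
  (forall n, exists M, forall y, b n y != 0 -> - M <= y <= M) /\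
  (forall n y, `|b n y| <= C * exp_abs y) /\
  (forall n y, `|b1 n y| <= C * exp_abs y) /\
  (forall n y, 1 < n.+1%:R * `|y| -> `|b n y - b2 n y| <= C / n.+1%:R * exp_abs y) /\
  (forall n y, `|b n y - b2 n y| <= C * n.+1%:R) /\
  (forall y, y != 0 -> b n y @[n --> \oo] --> exp_abs y) /\
  (forall y, y != 0 -> b1 n y @[n --> \oo] --> - Num.sg y * exp_abs y).
Proof.
have [C1 HC1] : exists C, forall y, `|1 - D1 y ^+ 2| <= C.
  apply: out_bounded => // y; apply: cvgB; first exact: cvg_cst.
  by rewrite expr2; apply: cvgM; exact: (smooth_continuous smooth_D1).
have [C2 HC2] : exists C, forall y, `|D2 y| <= C.
  by apply: out_bounded => //; exact: (smooth_continuous (smooth_derive smooth_D1).2).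
have [C3 HC3] : exists C, forall y, `|chi1 y| <= C.
  apply: (@smooth_support_bounded _ chi1 2); first exact: smooth_continuous.
  exact: derive_support chi_supp.
have [C4 HC4] : exists C, forall y, `|chi2 y| <= C.
  apply: (@smooth_support_bounded _ chi2 2).
    exact: (smooth_continuous (smooth_derive smooth_chi1).2).
  exact: derive_support (derive_support chi_supp).
have C10 : 0 <= C1 by apply: le_trans (HC1 0).
have C20 : 0 <= C2 by apply: le_trans (HC2 0).
have C30 : 0 <= C3 by apply: le_trans (HC3 0).
have C40 : 0 <= C4 by apply: le_trans (HC4 0).
have HD1 y : `|D1 y| <= 1 + C1.
  rewrite -ler_sqr ?nnegrE//; last by rewrite addr_ge0.
  rewrite real_normK ?num_real//; have := HC1 y; rewrite ler_norml => /andP[? ?].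
  by nra.
(* [expR 2] is the loss of [h_le]; the second factor dominates every bracket multiplying [h]
   below. *)
pose C := expR 2 * (1 + C1 + C2 + 2 * (1 + C1) * C3 + C3 + C4).
have Nv n : 0 <= (N n)^-1 by rewrite invr_ge0 ltW.
have Nv1 n : (N n)^-1 <= 1 by rewrite invf_le1.
have hb n y K : 0 <= K -> K <= 1 + C1 + C2 + 2 * (1 + C1) * C3 + C3 + C4 ->
    h n y * K <= C * exp_abs y.
  move=> K0 KC; rewrite /C mulrAC ler_pM//.
have C130 : 0 <= 2 * (1 + C1) * C3 by rewrite !mulr_ge0// addr_ge0.
have Cge0 : 0 <= C by apply: mulr_ge0; [exact: ltW|rewrite !addr_ge0].
(* For [N |y| > 1] both [1 - D1 ^+ 2] and [D2] vanish, because [sabs] is exact there; only the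
   cut-off terms remain, and they carry a factor [1 / N]. *)
have bE n y : b n y - b2 n y = h n y *
   (((1 - D1 (N n * y) ^+ 2) + N n * D2 (N n * y)) * chi ((N n)^-1 * y)
    + (N n)^-1 * (2 * D1 (N n * y) * chi1 ((N n)^-1 * y)
       - (N n)^-1 * chi2 ((N n)^-1 * y))) by rewrite /b /b2; ring.
have tail n y : `|2 * D1 (N n * y) * chi1 ((N n)^-1 * y) - (N n)^-1 * chi2 ((N n)^-1 * y)|
    <= 2 * (1 + C1) * C3 + C4.
  apply: le_trans (ler_normB _ _) _; rewrite lerD//.
    by rewrite !normrM ger0_norm// ler_pM// ler_wpM2l.
  rewrite normrM ger0_norm//; apply: le_trans (HC4 ((N n)^-1 * y)).
  by rewrite ler_piMl.
exists b, b1, b2, C; split; first exact: Cge0.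
split; first exact: smooth_b.
split; first exact: db.
split; first exact: db1.
split.
  move=> n; exists (2 * N n) => y; rewrite /b mulf_eq0 negb_or => /andP[_ /chi_supp].
  by rewrite ler_pdivlMl// ler_pdivrMl// mulrN [N n * 2]mulrC.
split.
  move=> n y; rewrite /b normrM ger0_norm//; apply: hb => //.
  by apply: le_trans (chi_norm _) _; nra.
split.
  move=> n y; rewrite /b1 normrM ger0_norm//; apply: hb => //.
  apply: (@le_trans _ _ (1 + C1 + C3)); last by nra.
  apply: le_trans (ler_normD _ _) _; rewrite lerD//.
    by rewrite normrM normrN -[leRHS]mulr1 ler_pM.
  by rewrite normrM ger0_norm//; apply: le_trans (HC3 ((N n)^-1 * y)); rewrite ler_piMl.
split.
  move=> n y Ny; have Ny' : 1 < `|N n * y| by rewrite normrM ger0_norm// ltW.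
  rewrite bE D1_out// D2_out// mulr0 addr0 mul0r add0r.
  rewrite normrM [X in _ * X]normrM (ger0_norm (h_ge0 n y)) (ger0_norm (Nv n)) mulrCA.
  rewrite (_ : C / n.+1%:R * exp_abs y = (N n)^-1 * (C * exp_abs y)); last by rewrite /N; ring.
  rewrite ler_wpM2l//.
  by apply: hb => //; apply: le_trans (tail n y) _; nra.
split.
  move=> n y; rewrite bE normrM ger0_norm// -/(N n).
  apply: (@le_trans _ _ (h n y * (N n * (C1 + C2 + (2 * (1 + C1) * C3 + C4))))).
    rewrite ler_wpM2l//; apply: le_trans (ler_normD _ _) _.
    rewrite [leRHS]mulrDr lerD//.
      rewrite normrM -[leRHS]mulr1 ler_pM//; apply: le_trans (ler_normD _ _) _.
      rewrite [leRHS]mulrDr lerD//.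
        by apply: le_trans (HC1 _) _; rewrite ler_peMl.
      by rewrite normrM ger0_norm ?ler_wpM2l// ltW.
    rewrite normrM ger0_norm//; apply: (@le_trans _ _ (1 * (2 * (1 + C1) * C3 + C4))).
      by rewrite ler_pM.
    by rewrite ler_wpM2r// addr_ge0.
  rewrite mulrCA [C * _]mulrC ler_wpM2l ?(ltW (N_gt0 n))//.
  apply: (@le_trans _ _ (C * exp_abs y)); last by rewrite ler_piMr// exp_abs_le1.
  by apply: hb; nra.
have big (y : R) : y != 0 -> \forall n \near \oo, 1 < N n * `|y| /\ `|(N n)^-1 * y| < 1.
  move=> y0; have yn : 0 < `|y| by rewrite normr_gt0.
  near=> n; split.
    rewrite -ltr_pdivrMr//; apply: (@le_lt_trans _ _ n%:R); last by rewrite ltr_nat.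
    by near: n; exact: nbhs_infty_ger.
  rewrite normrM ger0_norm// mulrC ltr_pdivrMr// mul1r.
  apply: (@le_lt_trans _ _ n%:R); last by rewrite ltr_nat.
  by near: n; exact: nbhs_infty_ger.
split=> y y0.
  apply: cvg_near_cst; apply: filterS (big y y0) => n [Ny yN].
  by rewrite /b h_out ?ltW// chi_in ?mulr1// ltW.
apply: cvg_near_cst; apply: filterS (big y y0) => n [Ny yN].
rewrite /b1 h_out ?ltW// chi_in ?ltW// chi1_in// mulr0 addr0 mulr1 mulrC; congr (- _ * _).
have [yp|yp|yz] := ltgtP y 0.
- rewrite ltr0_norm// mulrN in Ny; rewrite D1_ltN1 ?ltr0_sg//.
  by rewrite -ltrN2 opprK.
- by rewrite gtr0_norm// in Ny; rewrite D1_gt1// gtr0_sg.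
- by rewrite yz eqxx in y0.
Unshelve. all: by end_near. Qed.

End ExponentialKernel.

(** * The integral operator of the evolution and the pointwise equation as a limit *)

Section Resolvent.
Context {R : realType}.
Local Notation mu := (@lebesgue_measure R).
Local Notation integ D f := (mu.-integrable D (EFin \o f)).

Lemma ae_neq (x : R) : {ae mu, forall s, s != x}.
Proof.
apply/negligibleP => /=.
  by rewrite (_ : ~` _ = [set x]); [exact: measurable_set1|apply/seteqP; split => s /=; [move/negP/negPn/eqP|move=> ->; rewrite eqxx]].
rewrite (_ : ~` _ = [set x]); first exact: lebesgue_measure_set1.
by apply/seteqP; split => s /=; [move/negP/negPn/eqP|move=> ->; rewrite eqxx].
Qed.

(* The kernel [- sgn (s - x) exp (- |s - x|)] of [2 (1 - dx^2)^-1 dx], up to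
   sign. *)
Definition dx_kernel (x s : R) : R :=
  (\1_(`]-oo, x[%classic) s - \1_(`]x, +oo[%classic) s) * exp_abs (s - x).

Lemma dx_kernelE x s : s != x -> dx_kernel x s = - Num.sg (s - x) * exp_abs (s - x).
Proof.
move=> sx; rewrite /dx_kernel !indicE !mem_setE !in_itv/= andbT.
have [s0|s0|s0] := ltgtP s x; last by rewrite s0 eqxx in sx.
  by rewrite ltr0_sg ?subr_lt0//= subr0 opprK.
by rewrite gtr0_sg ?subr_gt0//= sub0r.
Qed.

Lemma dx_kernel_le x s : `|dx_kernel x s| <= exp_abs (s - x).
Proof.
rewrite /dx_kernel normrM [X in _ * X]gtr0_norm ?exp_abs_gt0//.
rewrite ler_piMl ?(ltW (exp_abs_gt0 _))// !indicE !mem_setE !in_itv/= andbT.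
by case: ltgtP => _ /=; rewrite ?subr0 ?sub0r ?normrN ?normr1 ?normr0.
Qed.

Lemma measurable_dx_kernel x : measurable_fun setT (dx_kernel x).
Proof.
apply: measurable_funM; last first.
  by apply: continuous_measurable => //; exact: continuous_exp_abs_shift.
by apply: measurable_funB; exact: measurable_indic.
Qed.

Lemma integ_dx_kernel x : integ setT (dx_kernel x).
Proof.
apply: (integ_le measurableT (integ_exp_abs x)); first exact: measurable_dx_kernel.
by move=> s _; exact: dx_kernel_le.
Qed.

Lemma Rint_dx_kernel x : \int[mu]_s `|dx_kernel x s| <= 2.
Proof.
rewrite -(Rint_exp_abs x); apply: le_Rintegral => //.
- by apply: integ_norm => //; exact: integ_dx_kernel.
- exact: integ_exp_abs.
- by move=> s _; exact: dx_kernel_le.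
Qed.

(** The sup norm of [f r] is a continuous function of [r], hence has a maximum on a segment. *)
Lemma sup_continuous_bounded (f : R -> R -> R) s t : sup_continuous f ->
  exists M, forall r, s <= r <= t -> forall y, `|f r y| <= M.
Proof.
move=> [cf [bf sf]].
have [ts|st] := ltP t s.
  by exists 0 => r /andP[sr rt]; have := le_lt_trans (le_trans sr rt) ts; rewrite ltxx.
pose A r := [set `|f r y| | y in [set: R]].
have supA r : has_sup (A r).
  split; first by exists `|f r 0|, 0.
  by have [M HM] := bf r; exists M => _ [y _ <-].
have leA r y : `|f r y| <= sup (A r).
  by apply: (ub_le_sup (supA r).2); exists y.
have Adist r r0 e : (forall y, `|f r y - f r0 y| <= e) -> sup (A r) <= sup (A r0) + e.
  move=> H; apply: ge_sup; first exact: (supA r).1.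
  move=> _ [y _ <-]; have -> : f r y = f r0 y + (f r y - f r0 y) by ring.
  by apply: le_trans (ler_normD _ _) _; rewrite lerD.
have cA : continuous (fun r => sup (A r)).
  move=> r0; apply/cvgrPdist_le => e e0; have [d d0 Hd] := sf r0 e e0.
  exists d => // r; rewrite /ball_/= distrC => /Hd H.
  rewrite ler_distl; apply/andP; split; first by rewrite lerBlDr; exact: Adist.
  by apply: Adist => y; rewrite distrC.
have [c _ Hc] := EVT_max st (continuous_subspaceT cA).
exists (sup (A c)) => r rst y; apply: le_trans (leA r y) _.
by apply: Hc; rewrite in_itv.
Qed.

(* [- (1 - dx^2)^-1 dx f] *)
Definition resolvent_dx (f : R -> R) (x : R) : R :=
  2^-1 * \int[mu]_s (f s * dx_kernel x s).

Lemma derive_of_integral (F f : R -> R) (t0 : R) : continuous f ->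
  (forall s t, s <= t -> F t - F s = \int[mu]_(r in `[s, t]) f r) ->
  is_derive t0 1 F (f t0).
Proof.
move=> cf HF.
have t1 : t0 < t0 + 1 by rewrite ltrDl.
have t2 : t0 - 1 < t0 by rewrite ltrBlDr ltrDl.
have fi : integ `[t0 - 1, t0 + 1] f by exact: integ_continuous.
have [dG G'] := continuous_FTC1_closed t1 fi t2 (cf t0).
apply: (@derive_near _ (fun t => F (t0 - 1) + \int[mu]_(r in `[t0 - 1, t]) f r)).
  near=> t; rewrite -HF; first by rewrite addrC subrK.
  by rewrite ltW//; near: t; exact: lt_nbhsr.
apply: (is_derive_eq (derive_add (derive_cst _ _) (DeriveDef dG (esym _)))); last by rewrite add0r.
by rewrite -G' derive1E.
Unshelve. all: by end_near. Qed.

Lemma continuous_shift (f : R -> R) (x : R) : continuous f ->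
  continuous (fun s : R => f (s - x)).
Proof.
move=> cf s; apply: (@continuous_comp R R R (fun s => s - x) f s); last exact: cf.
by apply: cvgB; [exact: cvg_id|exact: cvg_cst].
Qed.

Lemma derive_shift (f f' : R -> R) (x s : R) : (forall y : R, is_derive y 1 f (f' y)) ->
  is_derive s 1 (fun s => f (s - x)) (f' (s - x)).
Proof.
move=> df; have d := @derive_comp _ f (fun s => s - x) s _ _ (df (s - x)) (derive_sub (derive_id s) (derive_cst x s)).
by apply: (is_derive_eq d); rewrite subr0 mulr1.
Qed.

Section Approximation.
Variables (b b1 b2 : nat -> R -> R) (C : R).
Hypothesis C0 : 0 <= C.
Hypothesis sb : forall n, smooth_fun (b n).
Hypothesis db : forall n (y : R), is_derive y 1 (b n) (b1 n y).
Hypothesis db1 : forall n (y : R), is_derive y 1 (b1 n) (b2 n y).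
Hypothesis b_supp : forall n, exists M, forall y, b n y != 0 -> - M <= y <= M.
Hypothesis b_le : forall n y, `|b n y| <= C * exp_abs y.
Hypothesis b1_le : forall n y, `|b1 n y| <= C * exp_abs y.
Hypothesis b2_far : forall n y, 1 < n.+1%:R * `|y| ->
  `|b n y - b2 n y| <= C / n.+1%:R * exp_abs y.
Hypothesis b2_near : forall n y, `|b n y - b2 n y| <= C * n.+1%:R.
Hypothesis b_cvg : forall y, y != 0 -> b n y @[n --> \oo] --> exp_abs y.
Hypothesis b1_cvg : forall y, y != 0 -> b1 n y @[n --> \oo] --> - Num.sg y * exp_abs y.

Let b1E n : derive1 (b n) = b1 n.
Proof. by apply/funext => y; exact: derive1_is. Qed.
Let b2E n : derive1 (b1 n) = b2 n.
Proof. by apply/funext => y; exact: derive1_is. Qed.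
Let sb1 n : smooth_fun (b1 n). Proof. by rewrite -b1E; exact: (smooth_derive (sb n)).2. Qed.
Let sb2 n : smooth_fun (b2 n). Proof. by rewrite -b2E; exact: (smooth_derive (sb1 n)).2. Qed.

(** So [b n - b2 n] has the mass of [b n], which tends to 2. *)
Lemma Rint_second_derivative0 n x : \int[mu]_s b2 n (s - x) = 0.
Proof.
have [M HM] := b_supp n.
have HM1 : forall y, b1 n y != 0 -> - M <= y <= M by rewrite -b1E; exact: derive_support.
have HM2 : forall y, b2 n y != 0 -> - M <= y <= M by rewrite -b2E; exact: derive_support.
rewrite (@Rint_supp _ _ `[x - (`|M| + 1), x + (`|M| + 1)]%classic); last first.
  move=> s ns; apply/eqP; apply: contra_notT ns => /HM2 sM.
  by rewrite /= in_itv/=; have := ler_norm M; lra.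
have le : x - (`|M| + 1) <= x + (`|M| + 1) by have := normr_ge0 M; lra.
rewrite (Rint_FTC le (fun s => derive_shift x s (db1 n))); last first.
  by apply: continuous_shift; exact: smooth_continuous.
have b10 y : `|M| < `|y| -> b1 n y = 0.
  move=> My; apply/eqP; apply: contraTT isT => /HM1; rewrite -ler_norml => yM.
  by have := le_lt_trans (le_trans yM (ler_norm M)) My; rewrite ltxx.
have M1 : 0 <= `|M| + 1 by rewrite addr_ge0.
rewrite !b10 ?subrr//.
  have -> : x - (`|M| + 1) - x = - (`|M| + 1) by ring.
  by rewrite normrN (ger0_norm M1) ltrDl.
have -> : x + (`|M| + 1) - x = `|M| + 1 by ring.
by rewrite (ger0_norm M1) ltrDl.
Qed.

(** Subtracting [f x] times the mass leaves the integral of [(f s - f x) * k n s]. Within [1 / N] of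
    [x] the first factor is small and the second has bounded integral; farther away the first is at
    most [2 M] and the second has integral [O(1 / N)]. *)
Lemma cvg_approx_identity (f : R -> R) M x : continuous f -> (forall s, `|f s| <= M) ->
  \int[mu]_s (f s * (b n (s - x) - b2 n (s - x))) @[n --> \oo] --> 2 * f x.
Proof.
move=> cf fM; have M0 : 0 <= M by apply: le_trans (fM 0).
have cb n : continuous (fun s => b n (s - x)) by apply: continuous_shift; exact: smooth_continuous.
have cb2 n : continuous (fun s => b2 n (s - x)) by apply: continuous_shift; exact: smooth_continuous.
have Eint := integ_exp_abs x.
have bi n : integ setT (fun s => b n (s - x)).
  apply: (integ_le measurableT (integ_scale C measurableT Eint)) => //.
  exact: continuous_measurable.
have b2i n : integ setT (fun s => b2 n (s - x)).
  have [L HL] := b_supp n.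
  have HL2 : forall y, b2 n y != 0 -> - L <= y <= L.
    by rewrite -b2E -b1E; exact: derive_support (derive_support HL).
  apply: (@integ_supp _ _ `[x - L, x + L]%classic) => //; last exact: integ_continuous.
  move=> s ns; apply/eqP; apply: contra_notT ns => /HL2 sM.
  by rewrite /= in_itv/=; lra.
pose k n s := b n (s - x) - b2 n (s - x).
have ki n : integ setT (k n) by exact: integ_sub.
have Lb : \int[mu]_s b n (s - x) @[n --> \oo] --> (2 : R).
  rewrite -(Rint_exp_abs x); apply: (@Rint_dominated_cvg _ _ _ _ (fun s => C * exp_abs (s - x))) => //.
  - by move=> n; exact: continuous_measurable.
  - by apply: continuous_measurable => //; exact: continuous_exp_abs_shift.
  - exact: integ_scale.
  - by apply: ae_imp (ae_neq x) => s sx _; apply: b_cvg; rewrite subr_eq0.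
have fki n : integ setT (fun s => f s * k n s) by exact: integ_bounded_mul fM _.
have E n : \int[mu]_s (f s * k n s) - f x * \int[mu]_s b n (s - x) =
    \int[mu]_s ((f s - f x) * k n s).
  transitivity (\int[mu]_s (f s * k n s) - f x * \int[mu]_s (k n s)).
    by rewrite [in RHS]/k RintegralB// Rint_second_derivative0 subr0.
  rewrite -RintegralZl// -RintegralB//; last exact: integ_scale.
  by apply: eq_Rintegral => s _; ring.
have dfM s : `|f s - f x| <= 2 * M.
  by apply: le_trans (ler_normB _ _) _; have := fM s; have := fM x; lra.
have Lrest : \int[mu]_s ((f s - f x) * k n s) @[n --> \oo] --> (0 : R).
  apply/cvgrPdist_le => e e0.
  (* A height [C N] over a width [2 / N] contributes [2 C] times this tolerance, thus at most
     [e / 2]; the summand 1 covers [C = 0]. *)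
  have e1 : 0 < e / (4 * C + 1) by rewrite divr_gt0// ltr_wpDl// mulr_ge0.
  have [/= d d0 Hd] := (cvgrPdist_le _ _).1 (cf x) _ e1.
  near=> n; rewrite sub0r normrN.
  pose N := n.+1%:R : R.
  pose J := `[x - N^-1, x + N^-1]%classic.
  pose g s := e / (4 * C + 1) * (C * N) * \1_J s + 2 * M * (C / N) * exp_abs (s - x).
  have iJ : integ setT (\1_J : R -> R) by apply: integrable_indic_itv.
  have gi : integ setT g.
    by apply: integ_add => //; apply: integ_scale.
  have Nd : N^-1 < d.
    rewrite -[d]invrK ltf_pV2 ?posrE ?invr_gt0// (@le_lt_trans _ _ n%:R) ?ltr_nat//.
    by near: n; exact: nbhs_infty_ger.
  have CN' : 0 <= C / N by rewrite divr_ge0// ltW.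
  apply: (@le_trans _ _ (\int[mu]_s g s)).
    apply: Rint_le_norm => //.
      have c1 : continuous (fun s => f s - f x) by move=> s; apply: cvgB; [exact: cf|exact: cvg_cst].
      exact: integ_bounded_mul dfM _.
    move=> s _; rewrite normrM /g indicE mem_setE in_itv/=.
    have [sJ|sJ] := boolP (x - N^-1 <= s <= x + N^-1).
      rewrite mulr1 ler_wpDr//.
        by rewrite mulr_ge0 ?(ltW (exp_abs_gt0 _))// mulr_ge0// mulr_ge0.
      rewrite ler_pM//; last exact: b2_near.
      rewrite distrC; apply: Hd; rewrite /ball_/= distrC.
      by apply: le_lt_trans Nd; rewrite ler_distl.
    rewrite mulr0 add0r -mulrA ler_pM//; apply: b2_far.
    rewrite -ltr_pdivrMl// mulr1 ltNge; apply: contra sJ.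
    by rewrite ler_distl.
  rewrite /g RintegralD//; [|exact: integ_scale|exact: integ_scale].
  rewrite !RintegralZl// Rint_exp_abs.
  have -> : \int[mu]_s \1_J s = 2 / N.
    transitivity (\int[mu]_(s in J) (1 : R)).
      rewrite [RHS]Rintegral_mkcond; apply: eq_Rintegral => s _.
      by rewrite patchE indicE; case: ifP.
    have Nv : 0 < N^-1 by rewrite invr_gt0.
    have le : x - N^-1 <= x + N^-1.
      by rewrite lerD2l; apply: (@le_trans _ _ 0); [rewrite oppr_le0; exact: ltW|exact: ltW].
    by rewrite /J (Rint_cst 1 le); ring.
  have -> : e / (4 * C + 1) * (C * N) * (2 / N) = e * (2 * C / (4 * C + 1)).
    have C4 : 4 * C + 1 != 0 by rewrite gt_eqF// ltr_wpDl// mulr_ge0.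
    have Nn : N != 0 by rewrite gt_eqF.
    by move: (N) Nn => N' Nn; field; rewrite ?C4 ?Nn.
  apply: (@le_trans _ _ (e / 2 + e / 2)); last by rewrite -splitr.
  rewrite lerD//.
    rewrite ler_wpM2l ?(ltW e0)// ler_pdivrMr ?ltr_wpDl ?mulr_ge0//; lra.
  rewrite (_ : _ * 2 = 4 * M * C / N); last by ring.
  rewrite ler_pdivrMr// -ler_pdivrMl ?divr_gt0//.
  apply: (@le_trans _ _ n%:R); last by rewrite ler_nat.
  by near: n; exact: nbhs_infty_ger.
have L3 : f x * \int[mu]_s b n (s - x) + \int[mu]_s ((f s - f x) * k n s) @[n --> \oo]
    --> f x * 2 + 0.
  by apply: cvgD => //; apply: cvgM => //; exact: cvg_cst.
rewrite addr0 mulrC in L3.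
suff -> : (fun n => \int[mu]_s (f s * (b n (s - x) - b2 n (s - x)))) =
  (fun n => f x * \int[mu]_s b n (s - x) + \int[mu]_s ((f s - f x) * k n s)) by [].
by apply/funext => n; rewrite -E addrC subrK.
Unshelve. all: by end_near. Qed.

Variables (beta : R) (u : R -> R -> R).
Hypothesis su : sup_continuous u.
Hypothesis u_weak : forall (b : R -> R) (M s t : R), smooth_fun b ->
  (forall x, b x != 0 -> - M <= x <= M) -> s <= t ->
  \int[mu]_x (u t x * (b x - derive1 (derive1 b) x)) -
  \int[mu]_x (u s x * (b x - derive1 (derive1 b) x)) =
  \int[mu]_(r in `[s, t]) \int[mu]_x (flux beta (u r x) * derive1 b x).

(** [weak_evolution] tested against [b n] centred at [x]. As [n] grows, the left side tends to
    [2 (u t x - u s x)] and the right side converges by domination, first in space and then in time;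
    the factor 2 is the one divided out in [resolvent_dx]. *)
Lemma integral_evolution x s t : s <= t ->
  u t x - u s x = \int[mu]_(r in `[s, t]) resolvent_dx (fun y => flux beta (u r y)) x.
Proof.
move=> st; have [cu [bu scu]] := su.
have sf := sup_continuous_flux beta su; have [cfl [bfl scfl]] := sf.
have b1i n : integ setT (fun s => b1 n (s - x)).
  apply: (integ_le measurableT (integ_scale C measurableT (integ_exp_abs x))) => //.
  by apply: continuous_measurable => //; apply: continuous_shift; exact: smooth_continuous.
have W n : \int[mu]_y (u t y * (b n (y - x) - b2 n (y - x))) -
    \int[mu]_y (u s y * (b n (y - x) - b2 n (y - x))) =
    \int[mu]_(r in `[s, t]) \int[mu]_y (flux beta (u r y) * b1 n (y - x)).
  have [M HM] := b_supp n.
  have d1 : derive1 (fun y => b n (y - x)) = (fun y => b1 n (y - x)).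
    by apply/funext => y; apply: derive1_is; exact: derive_shift.
  have d2 : derive1 (fun y => b1 n (y - x)) = (fun y => b2 n (y - x)).
    by apply/funext => y; apply: derive1_is; exact: derive_shift.
  have sbx : smooth_fun (fun y => b n (y - x)).
    by apply: (smooth_comp (sb n)); apply: smooth_sub; [exact: smooth_id|exact: smooth_cst].
  have HMx y : b n (y - x) != 0 -> - (`|M| + `|x|) <= y <= `|M| + `|x|.
    by move=> /HM yM; have := ler_norm M; have := ler_norm x; have := ler_norm (- x); rewrite normrN; lra.
  by have := u_weak sbx HMx st; rewrite d1 d2.
have [Mt HMt] := bu t; have [Ms HMs] := bu s.
have L1 : \int[mu]_(r in `[s, t]) \int[mu]_y (flux beta (u r y) * b1 n (y - x)) @[n --> \oo]
    --> 2 * u t x - 2 * u s x.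
  under eq_fun do rewrite -W.
  by apply: cvgB; apply: cvg_approx_identity => //; eassumption.
have kx := integ_dx_kernel x.
have cK : continuous (fun r => \int[mu]_y (flux beta (u r y) * dx_kernel x y)).
  exact: sup_continuous_Rint.
have [F HF] := sup_continuous_bounded s t sf.
have F0 : 0 <= F by apply: le_trans (HF s _ 0); rewrite ?lexx.
have L2 : \int[mu]_(r in `[s, t]) \int[mu]_y (flux beta (u r y) * b1 n (y - x)) @[n --> \oo]
    --> \int[mu]_(r in `[s, t]) \int[mu]_y (flux beta (u r y) * dx_kernel x y).
  apply: (@Rint_dominated_cvg _ _ _ _ (fun=> F * (C * 2))) => //.
  - move=> n; apply: continuous_measurable => //; exact: sup_continuous_Rint.
  - exact: continuous_measurable.
  - exact: integ_cst.
  - move=> n r; rewrite /= in_itv/= => rst.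
    apply: le_trans (Rint_bounded_mul (cfl r) (HF r rst) (b1i n)) _.
    rewrite ler_wpM2l// -(Rint_exp_abs x) -RintegralZl//; last exact: integ_exp_abs.
    apply: le_Rintegral => //; first exact: integ_norm.
    by apply: integ_scale => //; exact: integ_exp_abs.
  - apply: aeW => r rst; rewrite /= in_itv/= in rst.
    apply: (@Rint_dominated_cvg _ _ _ _ (fun y => F * (C * exp_abs (y - x)))) => //.
    + move=> n; apply: measurable_funM; first by apply: continuous_measurable => //; exact: cfl.
      exact: integ_measurable (b1i n).
    + apply: measurable_funM; last exact: measurable_dx_kernel.
      by apply: continuous_measurable => //; exact: cfl.
    + by do 2 apply: integ_scale => //; exact: integ_exp_abs.
    + by move=> n y _; rewrite normrM ler_pM// HF.
    + apply: ae_imp (ae_neq x) => y yx _; apply: cvgM; first exact: cvg_cst.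
      by rewrite dx_kernelE//; apply: b1_cvg; rewrite subr_eq0.
rewrite /resolvent_dx RintegralZl//; last exact: integ_continuous.
have E : 2 * u t x - 2 * u s x =
    \int[mu]_(r in `[s, t]) \int[mu]_y (flux beta (u r y) * dx_kernel x y).
  exact: (cvg_unique _ L1 L2).
by rewrite -E; field.
Qed.

End Approximation.

End Resolvent.

(** * Propagation of the support *)

Section AnalyticVanishing.
Context {R : realType}.

Lemma bin_le_exp2 n m : ('C(n, m) <= 2 ^ n)%N.
Proof.
elim: n m => [|n IH] [|m]; rewrite ?bin0 ?bin0n//; first by rewrite expn_gt0.
by rewrite binS expnS mul2n -addnn leq_add.
Qed.

Lemma derive_power_bound (f f' : R -> R) (p s c : R) m : p <= s -> f p = 0 ->
  (forall r : R, is_derive r 1 f (f' r)) ->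
  (forall r, p <= r <= s -> `|f' r| <= c * (r - p) ^+ m) ->
  `|f s| <= c * (s - p) ^+ m.+1 / m.+1%:R.
Proof.
move=> ps fp df bf.
pose G (r : R) := c * (r - p) ^+ m.+1 / m.+1%:R.
have dG (r : R) : is_derive r 1 G (c * (r - p) ^+ m).
  have d := derive_scale (c / m.+1%:R) (derive_exp m.+1 (derive_sub (derive_id r) (derive_cst p r))).
  rewrite (_ : G = fun r => c / m.+1%:R * (r - p) ^+ m.+1); last first.
    by apply/funext => y; rewrite /G; ring.
  apply: (is_derive_eq d); rewrite subr0 mulr1 /=.
  by rewrite mulrA divfK.
have G0 : G p = 0 by rewrite /G subrr expr0n/= mulr0 mul0r.
have key (g g' : R -> R) : (forall r : R, is_derive r 1 g (g' r)) -> g p = 0 ->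
    (forall r, p <= r <= s -> 0 <= g' r) -> 0 <= g s.
  move=> dg gp g'0.
  have cg : {within `[p, s], continuous g}.
    by apply: continuous_subspaceT => y; exact: derive_continuous (dg y).
  have [r rps] := MVT_segment ps (fun r _ => dg r) cg.
  rewrite gp subr0 => ->; rewrite mulr_ge0 ?subr_ge0//; apply: g'0.
  by move: rps; rewrite in_itv.
rewrite ler_norml; apply/andP; split.
  rewrite -subr_ge0 opprK; apply: (key (fun r => f r + G r) _ (fun r => derive_add (df r) (dG r))).
    by rewrite fp G0 addr0.
  by move=> r /bf; rewrite ler_norml => /andP[+ _]; rewrite -subr_ge0 opprK.
rewrite -subr_ge0; apply: (key (fun r => G r - f r) _ (fun r => derive_sub (dG r) (df r))).
  by rewrite fp G0 subr0.
by move=> r /bf; rewrite ler_norml subr_ge0 => /andP[].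
Qed.

(** [c k] stands for the [k]-th Taylor coefficient along a half-line of times, and [sigma], later
    [1] or [-1], for its direction. *)
Variables (c : nat -> R -> R) (sigma M r L : R).
Hypothesis sigma1 : `|sigma| <= 1.
Hypothesis r0 : 0 <= r.
Hypothesis dc : forall k (s : R), is_derive s 1 (c k) (sigma * (k.+1%:R * c k.+1 s)).
Hypothesis cM : forall k s, 0 <= s <= L -> `|c k s| <= M * r ^+ k.
Hypothesis c0 : forall k, c k 0 = 0.

(** Taylor estimate of order [m] at a point where all coefficients vanish, by [m] successive
    integrations. The binomial is preserved because [k.+1 * 'C(k.+1 + m, m) = m.+1 * 'C(k + m.+1,
    m.+1)]. *)
Lemma taylor_remainder_bound p m k s : 0 <= p -> (forall k, c k p = 0) -> p <= s <= L ->
  `|c k s| <= M * r ^+ (k + m) * 'C(k + m, m)%:R * (s - p) ^+ m.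
Proof.
move=> p0 cp; elim: m k s => [|m IH] k s /andP[ps sL].
  rewrite addn0 bin0 !mulr1; apply: cM; apply/andP; split => //; exact: le_trans ps.
have H := @derive_power_bound (c k) _ p s (k.+1%:R * (M * r ^+ (k.+1 + m) * 'C(k.+1 + m, m)%:R)) m
  ps (cp k) (dc k).
apply: le_trans (H _) _.
  move=> q /andP[pq qs]; rewrite normrM; apply: (@le_trans _ _ (1 * (k.+1%:R * `|c k.+1 q|))).
    by rewrite [X in _ * X <= _]normrM (ger0_norm (ler0n _ _)) ler_pM.
  rewrite mul1r -mulrA ler_wpM2l//; apply: IH.
  by rewrite pq/=; exact: le_trans sL.
have E : (k.+1%:R * 'C(k.+1 + m, m)%:R : R) = m.+1%:R * 'C(k + m.+1, m.+1)%:R.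
  by rewrite -!natrM mul_bin_left addSnnS addnS subSn ?leq_addl// addnK.
rewrite addSnnS in E *; rewrite le_eqVlt; apply/orP; left; apply/eqP.
transitivity (M * r ^+ (k + m.+1) * (k.+1%:R * 'C(k + m.+1, m)%:R) * (s - p) ^+ m.+1 / m.+1%:R).
  by ring.
by rewrite E; field.
Qed.

(** Chosen so that [2 r rho <= 1 / 2]: with binomials at most [2 ^ (k + m)], the Taylor bound then
    decays like [2 ^ -m]. The summand 1 covers [r = 0]. *)
Let rho := (4 * (r + 1))^-1.

Let rho_gt0 : 0 < rho.
Proof. by rewrite invr_gt0 mulr_gt0// ltr_wpDl. Qed.

Lemma vanish_step p k s : 0 <= p -> (forall k, c k p = 0) -> p <= s <= L ->
  s - p <= rho -> c k s = 0.
Proof.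
move=> p0 cp psL sp; have /andP[ps sL] := psL.
have M0 : 0 <= M.
  have /(cM 0) : 0 <= p <= L by rewrite p0 (le_trans ps).
  by rewrite expr0 mulr1; apply: le_trans.
pose D := M * (2 * r) ^+ k.
have D0 : 0 <= D by rewrite mulr_ge0// exprn_ge0// mulr_ge0.
(* The decay [2 ^ -m] is weakened to [1 / m], enough for the Archimedean property to force
   [c k s = 0]. *)
have bound m : `|c k s| * m%:R <= D.
  have H := taylor_remainder_bound m k p0 cp psL.
  have {}H : `|c k s| <= D * (2 * r * (s - p)) ^+ m.
    apply: le_trans H _; rewrite /D.
    have -> : M * (2 * r) ^+ k * (2 * r * (s - p)) ^+ m =
        M * r ^+ (k + m) * 2 ^+ (k + m) * (s - p) ^+ m.
      by rewrite !exprMn !exprD; ring.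
    rewrite ler_wpM2r ?exprn_ge0 ?subr_ge0// ler_wpM2l ?mulr_ge0 ?exprn_ge0//.
    by rewrite -natrX ler_nat bin_le_exp2.
  have q : 2 * r * (s - p) <= 2^-1.
    apply: (@le_trans _ _ (2 * r * rho)); first by rewrite ler_wpM2l// mulr_ge0.
    by rewrite /rho ler_pdivrMr ?mulr_gt0 ?ltr_wpDl//; nra.
  have q0 : 0 <= 2 * r * (s - p) by rewrite !mulr_ge0// subr_ge0.
  apply: (@le_trans _ _ (D * 2^-1 ^+ m * m%:R)).
    by rewrite ler_wpM2r//; apply: le_trans H _; rewrite ler_wpM2l// lerXn2r ?nnegrE.
  rewrite -mulrA ler_piMr// exprVn ler_pdivrMl ?exprn_gt0// mulr1 -natrX ler_nat.
  by rewrite ltnW// ltn_expl.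
apply/eqP; rewrite -normr_le0 leNgt; apply/negP => ck.
have := archi_boundP (divr_ge0 D0 (ltW ck)); rewrite ltNge => /negP; apply.
by rewrite ler_pdivlMr// mulrC.
Qed.

(** The step length [rho] does not depend on the starting point, so finitely many steps cover
    [[0, L]]. *)
Lemma vanish_everywhere k s : 0 <= s <= L -> c k s = 0.
Proof.
suff H n : forall k s, 0 <= s <= L -> s <= n%:R * rho -> c k s = 0.
  move=> /[dup] sL /andP[s0 _].
  have := archi_boundP (divr_ge0 s0 (ltW rho_gt0)) => /ltW.
  by rewrite ler_pdivrMr//; exact: H.
elim: n => [|n IH] {}k {}s /andP[s0 sL] sn.
  have -> : s = 0 by apply/eqP; rewrite eq_le s0 andbT; rewrite mul0r in sn.
  exact: c0.
have [sn'|ns] := leP s (n%:R * rho); first by apply: IH => //; rewrite s0.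
have p0 : 0 <= n%:R * rho by rewrite mulr_ge0// ltW.
apply: (vanish_step (p := n%:R * rho)) => //.
- by move=> j; apply: IH; rewrite ?lexx// p0 (le_trans (ltW ns)).
- by rewrite (ltW ns).
- by move: sn; rewrite -natr1 mulrDl mul1r lerBlDl.
Qed.

End AnalyticVanishing.

(** * Taylor coefficients in time and the support at all times *)

Section Propagation.
Context {R : realType}.
Local Notation mu := (@lebesgue_measure R).
Local Notation integ D f := (mu.-integrable D (EFin \o f)).
Local Notation K := (@resolvent_dx R).

(** The kernel has L^1 norm at most 2 and the factor [1 / 2] compensates: [K] has norm at most 1 for
    the sup norm, which keeps the growth of the Taylor coefficients geometric. *)
Lemma resolvent_dx_bound (f : R -> R) (M x : R) : measurable_fun setT f ->
  (forall s, `|f s| <= M) -> `|K f x| <= M.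
Proof.
move=> mf fM; have M0 : 0 <= M by apply: le_trans (fM 0).
have kn : integ setT (fun s => `|dx_kernel x s|) by apply: integ_norm => //; exact: integ_dx_kernel.
rewrite /resolvent_dx normrM ger0_norm// ler_pdivrMl//.
apply: (@le_trans _ _ (\int[mu]_s (M * `|dx_kernel x s|))).
  apply: Rint_le_norm => //.
  - exact: (integ_mul_bounded measurableT (integ_dx_kernel x) mf (fun s _ => fM s)).
  - exact: integ_scale.
  - by move=> s _; rewrite normrM ler_wpM2r.
by rewrite RintegralZl// [2 * M]mulrC ler_wpM2l// Rint_dx_kernel.
Qed.

Lemma derive_under_Rint (D : set R) (f f' : R -> R -> R) (k : R -> R) (t0 C : R) :
  measurable D -> integ D k ->
  (forall t, t0 - 1 < t < t0 + 1 -> measurable_fun D (f t) /\ exists B, forall s, D s -> `|f t s| <= B) ->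
  (forall t s : R, D s -> is_derive t 1 (f ^~ s) (f' t s)) ->
  (forall t s, t0 - 1 < t < t0 + 1 -> D s -> `|f' t s| <= C) ->
  is_derive t0 1 (fun t => \int[mu]_(s in D) (f t s * k s)) (\int[mu]_(s in D) (f' t0 s * k s)).
Proof.
move=> mD ki mf df f'C.
have dfk (t s : R) : D s -> is_derive t 1 (fun t => f t s * k s) (f' t s * k s).
  move=> Ds; apply: (is_derive_eq (derive_mul (df t s Ds) (derive_cst (k s) t))).
  by rewrite mulr0 add0r mulrC.
have Ia : (`]t0 - 1, t0 + 1[%classic : set R) t0 by rewrite /= in_itv/=; apply/andP; split; lra.
have C0 s : D s -> 0 <= C.
  by move=> Ds; apply: le_trans (f'C t0 s _ Ds) => //; apply/andP; split; lra.
have intf x : (`]t0 - 1, t0 + 1[%classic : set R) x -> integ D (fun s => f x s * k s).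
  rewrite /= in_itv/= => xI; have [mfx [B HB]] := mf x xI.
  exact: (integ_mul_bounded _ _ mfx HB).
have derf1 x y : (`]t0 - 1, t0 + 1[%classic : set R) x -> D y ->
    derivable ((fun t s => f t s * k s) ^~ y) x 1.
  by move=> _ Dy; have [] := dfk x y Dy.
have G_ge0 y : 0 <= `|C| * `|k y| by rewrite mulr_ge0.
have intG : integ D (fun y => `|C| * `|k y|) by apply: integ_scale => //; exact: integ_norm.
have G_ub x y : (`]t0 - 1, t0 + 1[%classic : set R) x -> D y ->
    `|partial1of2 (fun t s => f t s * k s) x y| <= `|C| * `|k y|.
  rewrite /= in_itv/= => xI Dy; rewrite /partial1of2 (derive1_is (dfk x y Dy)) normrM ler_wpM2r//.
  by apply: le_trans (f'C x y xI Dy) (ler_norm _).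
have d1 := @derivable_under_integral R _ _ mu (fun t s => f t s * k s) D mD t0 (t0 - 1) (t0 + 1)
  Ia intf derf1 _ G_ge0 intG G_ub.
have d2 := @differentiation_under_integral R _ _ mu (fun t s => f t s * k s) D mD t0 (t0 - 1) (t0 + 1)
  Ia intf derf1 _ G_ge0 intG G_ub.
apply: DeriveDef; first exact: d1.
rewrite -derive1E d2; apply: eq_Rintegral => s /set_mem Ds.
by rewrite /partial1of2 (derive1_is (dfk t0 s Ds)).
Qed.

(** A time derivative as the limit of a sequence of difference quotients, from which it inherits
    measurability in space. *)
Lemma derive_cvg_seq (f : R -> R) (t a : R) : is_derive t 1 f a ->
  n.+1%:R * (f (n.+1%:R^-1 + t) - f t) @[n --> \oo] --> a.
Proof.
move=> [df <-]; have h0 : (forall n : nat, (n.+1%:R^-1 : R) != 0) /\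
    (n.+1%:R^-1 : R) @[n --> \oo] --> (0 : R).
  by split; [move=> n; rewrite invr_neq0// pnatr_eq0|exact: cvg_harmonic].
move: (df) => /cvgr_dnbhsP/(_ _ h0).
by under eq_fun do rewrite /GRing.scale/= mulr1 invrK.
Qed.

Variables (beta : R) (u : R -> R -> R).
Hypothesis su : sup_continuous u.
Hypothesis du : forall t x : R, is_derive t 1 (u ^~ x) (K (fun y => flux beta (u t y)) x).

(** The [k]-th Taylor coefficient of [flux beta u] when those of [u] are given by [a]; the sum is
    the Cauchy product of [u] with itself. *)
Let cauchy_source (a : nat -> R -> R -> R) (k : nat) (t x : R) : R :=
  beta * a k t x + 2^-1 * \sum_(j < k.+1) a j t x * a (k - j)%N t x.

(** Each coefficient depends on all previous ones. To keep the recursion structural, [iter_coef n]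
    is a whole table, correct for indices up to [n]. *)
Let iter_coef : nat -> nat -> R -> R -> R := fix F n := if n is m.+1 then
  (fun k => if (k <= m)%N then F m k
            else fun t x => (m.+1%:R)^-1 * K (cauchy_source (F m) m t) x)
  else fun _ => u.

(* Taylor coefficients in time of the solution. *)
Let coef k := iter_coef k k.

Let iter_coefE n k : (k <= n)%N -> iter_coef n k = coef k.
Proof.
elim: n => [|n IH]; first by case: k.
rewrite leq_eqVlt => /predU1P[->//|]; rewrite ltnS => kn.
by rewrite /= kn IH.
Qed.

Let g := cauchy_source coef.

Let coefS k t x : k.+1%:R * coef k.+1 t x = K (g k t) x.
Proof.
rewrite /coef /= ltnn mulrA divff ?pnatr_eq0// mul1r; congr (K _ x).
apply/funext => y; rewrite /g /cauchy_source iter_coefE//; congr (_ + _ * _).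
by apply: eq_bigr => j _; rewrite !iter_coefE ?leq_subr// -ltnS.
Qed.

Let flux_g t : g 0 t = (fun y => flux beta (u t y)).
Proof.
by apply/funext => y; rewrite /g /cauchy_source big_ord1 /flux /coef /=; ring.
Qed.

(** With [r = |beta| + M], the [k.+1] terms of the Cauchy product bound the source by
    [k.+1 * M * r ^ k.+1], and the recursion divides by [k.+1]. Measurability is assumed only up to
    [k], so that the bound is available inside the induction of [coef_spec]. *)
Let coef_measurable_bound c d M : (forall r, c <= r <= d -> forall y, `|u r y| <= M) ->
  0 <= M -> forall k,
  (forall j t, (j <= k)%N -> measurable_fun setT (coef j t)) ->
  forall t x, c <= t <= d -> `|coef k t x| <= M * (`|beta| + M) ^+ k.
Proof.
move=> uM M0; elim/ltn_ind => -[|k] IH mk t x tcd.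
  by rewrite expr0 mulr1; exact: uM.
set r := `|beta| + M; have r0 : 0 <= r by rewrite addr_ge0.
have IHj j y : (j <= k)%N -> `|coef j t y| <= M * r ^+ j.
  by move=> jk; apply: IH => // i s ij; apply: mk; exact: leq_trans (leqW jk).
have mg : measurable_fun setT (g k t).
  apply: measurable_funD; first by apply: measurable_funM => //; apply: mk.
  apply: measurable_funM => //; apply: measurable_sum => j.
  by apply: measurable_funM; apply: mk; rewrite ?(leq_trans (leq_subr _ _))// ltnW// ltnS ltnW.
have gb y : `|g k t y| <= k.+1%:R * (M * r ^+ k.+1).
  apply: (@le_trans _ _ (`|beta| * (M * r ^+ k) + 2^-1 * (k.+1%:R * (M * M * r ^+ k)))).
    rewrite (le_trans (ler_normD _ _))// lerD//; first by rewrite normrM ler_wpM2l// IHj.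
    rewrite normrM ger0_norm// ler_wpM2l// (le_trans (ler_norm_sum _ _ _))//.
    rewrite -[k.+1 in leRHS]card_ord mulr_natl -sumr_const ler_sum// => j _.
    have jk : (j <= k)%N by rewrite -ltnS.
    rewrite normrM -[in leRHS](subnKC jk) exprD.
    have -> : M * M * (r ^+ j * r ^+ (k - j)) = (M * r ^+ j) * (M * r ^+ (k - j)) by ring.
    by rewrite ler_pM// IHj// leq_subr.
  rewrite exprS; have k1 : 1 <= k.+1%:R :> R by rewrite ler1n.
  have Mr : 0 <= M * r ^+ k by rewrite mulr_ge0// exprn_ge0.
  have -> : `|beta| * (M * r ^+ k) + 2^-1 * (k.+1%:R * (M * M * r ^+ k)) =
    (`|beta| + 2^-1 * k.+1%:R * M) * (M * r ^+ k) by ring.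
  have -> : k.+1%:R * (M * (r * r ^+ k)) = (k.+1%:R * r) * (M * r ^+ k) by ring.
  rewrite ler_wpM2r// /r mulrDr lerD//; first by rewrite ler_peMl.
  have h2 : 2^-1 <= 1 :> R by lra.
  by rewrite ler_wpM2r// ler_piMl.
have := resolvent_dx_bound x mg gb; rewrite -coefS normrM ger0_norm//.
by rewrite ler_pM2l// ltr0n.
Qed.

(** Leibniz rule for the Cauchy product: after reindexing, the two sums carry the weights [k.+1 - j]
    and [j], which add up to [k.+1]. *)
Let derive_g k : (forall j (t x : R), (j <= k)%N ->
    is_derive t 1 (coef j ^~ x) (j.+1%:R * coef j.+1 t x)) ->
  forall t x : R, is_derive t 1 (g k ^~ x) (k.+1%:R * g k.+1 t x).
Proof.
move=> dk t x.
have ds : is_derive t 1 (fun t => \sum_(j < k.+1) coef j t x * coef (k - j)%N t x)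
    (\sum_(j < k.+1) (coef j t x * ((k - j).+1%:R * coef (k - j).+1 t x) +
                      coef (k - j)%N t x * (j.+1%:R * coef j.+1 t x))).
  rewrite (_ : (fun t => _) = \sum_(j < k.+1) (fun t => coef j t x * coef (k - j)%N t x)).
    apply: is_derive_sum => j; apply: derive_mul; apply: dk; last exact: leq_subr.
    by rewrite -ltnS.
  by apply/funext => s; rewrite fct_sumE.
apply: (is_derive_eq (derive_add (derive_scale beta (dk k t x (leqnn k))) (derive_scale 2^-1 ds))).
rewrite /g /cauchy_source mulrDr; congr (_ + _); first by ring.
rewrite mulrCA; congr (_ * _); rewrite big_split/=.
have -> : \sum_(j < k.+1) coef j t x * ((k - j).+1%:R * coef (k - j).+1 t x) =
    \sum_(j < k.+2) (k.+1 - j)%:R * (coef j t x * coef (k.+1 - j)%N t x).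
  rewrite [RHS]big_ord_recr/= subnn mul0r addr0; apply: eq_bigr => j _.
  by rewrite subSn; [ring|rewrite -ltnS].
have -> : \sum_(j < k.+1) coef (k - j)%N t x * (j.+1%:R * coef j.+1 t x) =
    \sum_(j < k.+2) j%:R * (coef j t x * coef (k.+1 - j)%N t x).
  rewrite [RHS]big_ord_recl/= mul0r add0r; apply: eq_bigr => j _.
  by rewrite /bump/= add1n subSS; ring.
rewrite -big_split mulr_sumr; apply: eq_bigr => j _ /=.
by rewrite -mulrDl -natrD subnK// -ltnS.
Qed.

(** The two properties need each other: [coef k.+1] is measurable as a limit of difference quotients
    of [coef k], and measurability together with the geometric bounds allows differentiation under
    the integral that defines [coef k.+1]. *)
Let coef_spec k : (forall t, measurable_fun setT (coef k t)) /\
  (forall t x : R, is_derive t 1 (coef k ^~ x) (k.+1%:R * coef k.+1 t x)).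
Proof.
have [cu [bu scu]] := su.
elim/ltn_ind: k => -[|k] IH.
  split; first by move=> t; apply: continuous_measurable => //; exact: cu.
  by move=> t x; rewrite coefS flux_g; exact: du.
have mk1 t : measurable_fun setT (coef k.+1 t).
  have [mk dk] := IH k (ltnSn k).
  rewrite (_ : coef k.+1 t = fun x => k.+1%:R^-1 * derive1 (coef k ^~ x) t); last first.
    by apply/funext => x; rewrite (derive1_is (dk t x)) mulrA mulVf ?mul1r// pnatr_eq0.
  apply: measurable_funM => //.
  apply: (@measurable_fun_cvg _ _ _ _
    (fun n x => n.+1%:R * (coef k (n.+1%:R^-1 + t) x - coef k t x))).
    by move=> n; apply: measurable_funM => //; apply: measurable_funB.
  by move=> x _; rewrite (derive1_is (dk t x)); exact: derive_cvg_seq.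
have mle j t : (j <= k.+1)%N -> measurable_fun setT (coef j t).
  rewrite leq_eqVlt => /predU1P[->//|jk]; by have [] := IH j jk.
split => // t x.
have dj j (s y : R) : (j <= k)%N -> is_derive s 1 (coef j ^~ y) (j.+1%:R * coef j.+1 s y).
  by move=> jk; have [_] := IH j jk; exact.
have dg := derive_g dj.
have [M HM] := sup_continuous_bounded (t - 1) (t + 1) su.
have M0 : 0 <= M by apply: le_trans (HM t _ 0) => //; apply/andP; split; lra.
set r := `|beta| + M.
have cb j s y : (j <= k.+1)%N -> t - 1 <= s <= t + 1 -> `|coef j s y| <= M * r ^+ j.
  move=> jk sI; apply: (coef_measurable_bound HM) => // i q ij; apply: mle; exact: leq_trans jk.
have mg j s : (j <= k.+1)%N -> measurable_fun setT (g j s).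
  move=> jk; apply: measurable_funD; first by apply: measurable_funM => //; apply: mle.
  apply: measurable_funM => //; apply: measurable_sum => i.
  apply: measurable_funM; apply: mle; last exact: leq_trans (leq_subr _ _) jk.
  by apply: leq_trans jk; rewrite -ltnS.
have gb j s y : (j <= k.+1)%N -> t - 1 <= s <= t + 1 ->
    `|g j s y| <= `|beta| * (M * r ^+ j) + 2^-1 * \sum_(i < j.+1) (M * r ^+ i * (M * r ^+ (j - i))).
  move=> jk sI; rewrite (le_trans (ler_normD _ _))// lerD//.
    by rewrite normrM ler_wpM2l// cb.
  rewrite normrM ger0_norm// ler_wpM2l// (le_trans (ler_norm_sum _ _ _))// ler_sum// => i _.
  have ij : (i <= j)%N by rewrite -ltnS.
  by rewrite normrM ler_pM// cb// ?(leq_trans ij)// (leq_trans (leq_subr _ _)).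
rewrite coefS.
rewrite (_ : coef k.+1 ^~ x = fun t => k.+1%:R^-1 * K (g k t) x); last first.
  by apply/funext => s; rewrite -coefS mulrA mulVf ?mul1r// pnatr_eq0.
have D : is_derive t 1 (fun t => \int[mu]_s (g k t s * dx_kernel x s))
    (\int[mu]_s (k.+1%:R * g k.+1 t s * dx_kernel x s)).
  apply: (@derive_under_Rint setT _ (fun t s => k.+1%:R * g k.+1 t s) _ _ (k.+1%:R *
    (`|beta| * (M * r ^+ k.+1) + 2^-1 * \sum_(i < k.+2) (M * r ^+ i * (M * r ^+ (k.+1 - i)))))) => //.
  - exact: integ_dx_kernel.
  - move=> s /andP[s1 s2]; split; first exact: mg.
    by eexists => y _; apply: gb => //; rewrite !ltW.
  - by move=> s y /andP[s1 s2] _; rewrite normrM ger0_norm// ler_wpM2l// gb// !ltW.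
apply: (is_derive_eq (derive_scale k.+1%:R^-1 (derive_scale 2^-1 D))).
have gi : integ setT (fun s => g k.+1 t s * dx_kernel x s).
  apply: (integ_mul_bounded _ (integ_dx_kernel x) (mg k.+1 t (leqnn _))) => //.
  by move=> s _; apply: gb => //; apply/andP; split; lra.
rewrite /resolvent_dx; under eq_Rintegral do rewrite -mulrA.
by rewrite RintegralZl//; field.
Qed.

(** At a fixed [x] outside the interval, all coefficients vanish for times near [t0], each being a
    multiple of the time derivative of the previous one; analytic continuation carries this to every
    time. The second conclusion is the vanishing of [coef 1]. *)
Lemma support_propagation (A B t0 d : R) : 0 < d ->
  (forall t, `|t - t0| < d -> forall x, ~~ (A <= x <= B) -> u t x = 0) ->
  forall t x, ~~ (A <= x <= B) -> u t x = 0 /\ K (fun y => flux beta (u t y)) x = 0.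
Proof.
move=> d0 Hu t x xAB.
suff H : forall k, coef k t x = 0.
  split; first by have := H 0%N.
  by rewrite -flux_g -coefS H mulr0.
have van k s : `|s - t0| < d -> coef k s x = 0.
  elim: k s => [|k IH] s sd; first exact: Hu.
  have [_ /(_ s x) dk] := coef_spec k.
  have : derive1 (coef k ^~ x) s = 0.
    apply: (@near_cst_derive _ _ _ 0); near=> q; apply: IH.
    near: q; apply: (cvgr_lt `|s - t0|) => //.
    by apply: cvg_norm; apply: cvgB; [exact: cvg_id|exact: cvg_cst].
  by rewrite (derive1_is dk) => /eqP; rewrite mulf_eq0 pnatr_eq0 => /eqP.
pose L := `|t - t0|.
(* Past times are reached by reversing the half-line of times. *)
pose sigma : R := if t0 <= t then 1 else -1.
have [M HM] := sup_continuous_bounded (t0 - L) (t0 + L) su.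
have L0 : 0 <= L by exact: normr_ge0.
have M0 : 0 <= M by apply: le_trans (HM t0 _ 0) => //; apply/andP; split; lra.
have Hsig : sigma = 1 \/ sigma = -1 by rewrite /sigma; case: ifP; [left|right].
have tE : t = t0 + sigma * L.
  rewrite /sigma /L; case: leP => tt; first by rewrite ger0_norm ?subr_ge0//; ring.
  by rewrite ltr0_norm ?subr_lt0//; ring.
move=> k; rewrite tE.
pose c j s := coef j (t0 + sigma * s) x.
apply: (@vanish_everywhere _ c sigma M (`|beta| + M) L) => //.
- by case: Hsig => ->; rewrite ?normrN normr1.
- by rewrite addr_ge0.
- move=> j s; have [_ dj] := coef_spec j; rewrite mulrC.
  have dl : is_derive s 1 (fun s => t0 + sigma * s) sigma.
    apply: (is_derive_eq (derive_add (derive_cst t0 s) (derive_scale sigma (derive_id s)))).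
    by rewrite add0r mulr1.
  exact: (@derive_comp _ (coef j ^~ x) (fun s => t0 + sigma * s) s _ _ (dj _ x) dl).
- move=> j s /andP[s0 sL]; apply: (coef_measurable_bound HM) => //.
    by move=> i q _; have [] := coef_spec i.
  by case: Hsig => ->; apply/andP; split; lra.
- by move=> j; rewrite /c mulr0 addr0; apply: van; rewrite subrr normr0.
- by rewrite L0 lexx.
Unshelve. all: by end_near. Qed.

End Propagation.

(** * Signed integrals and a product rule for integrable derivatives *)

Section OrientedIntegral.
Context {R : realType}.
Local Notation mu := (@lebesgue_measure R).
Local Notation integ D f := (mu.-integrable D (EFin \o f)).

Definition oint (f : R -> R) (a x : R) : R :=
  if a <= x then \int[mu]_(s in `[a, x]) f s else - \int[mu]_(s in `[x, a]) f s.

Lemma oint_id (f : R -> R) a : oint f a a = 0.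
Proof. by rewrite /oint lexx set_itv1 Rintegral_set1. Qed.

Lemma oint_sub (f : R -> R) (a x y : R) : (forall c d, integ `[c, d] f) -> x <= y ->
  oint f a y - oint f a x = \int[mu]_(s in `[x, y]) f s.
Proof.
move=> fi xy; rewrite /oint.
case: (leP a x) => ax; case: (leP a y) => ay.
- by rewrite (Rint_itv_split ax xy (fi _ _)); ring.
- by exfalso; lra.
- by rewrite (Rint_itv_split (ltW ax) ay (fi _ _)); ring.
- by rewrite (Rint_itv_split xy (ltW ay) (fi _ _)); ring.
Qed.

Lemma derive_oint (f : R -> R) (a x : R) : continuous f ->
  is_derive x 1 (oint f a) (f x).
Proof.
move=> cf; apply: derive_of_integral => // s t st.
by apply: oint_sub => // c d; exact: integ_continuous.
Qed.

Lemma Rint_eq0 (D : set R) (f : R -> R) : (forall s, D s -> f s = 0) ->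
  \int[mu]_(s in D) f s = 0.
Proof.
move=> f0; rewrite (_ : \int[mu]_(s in D) f s = \int[mu]_(s in D) 0).
  by rewrite /Rintegral integral0.
by apply: eq_Rintegral => s /set_mem; exact: f0.
Qed.

Lemma Rint_ae_eq_in (D : set R) (f g : R -> R) : measurable D -> measurable_fun D f ->
  measurable_fun D g -> {ae mu, forall x, D x -> f x = g x} ->
  \int[mu]_(x in D) f x = \int[mu]_(x in D) g x.
Proof.
move=> mD mf mg fg; congr fine; apply: ae_eq_integral => //.
- exact/measurable_EFinP.
- exact/measurable_EFinP.
- by apply: ae_imp fg => x H Dx; rewrite H.
Qed.

Lemma derive_growth (f f' : R -> R) (a x e : R) : a <= x -> f a = 0 ->
  (forall s : R, is_derive s 1 f (f' s)) -> (forall s, a <= s <= x -> `|f' s| <= e) ->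
  `|f x| <= e * (x - a).
Proof.
move=> ax fa df fe.
have cf : {within `[a, x], continuous f}.
  by apply: continuous_subspaceT => y; exact: derive_continuous (df y).
have [s] := MVT_segment ax (fun r _ => df r) cf.
rewrite in_itv/= fa subr0 => sI ->; rewrite normrM [X in _ * X]ger0_norm ?subr_ge0//.
by rewrite ler_wpM2r ?subr_ge0// fe.
Qed.

(** The derivatives are only integrable, so the rule is proved by subdivision: on a piece of length
    at most [d] the error is at most [e \int (|g1| + |g2|)], a bound that adds up over the pieces,
    and [e] is arbitrary. *)
Lemma product_rule (g1 g2 U1 U2 : R -> R) (a b : R) :
  a <= b -> integ `[a, b] g1 -> integ `[a, b] g2 -> continuous U1 -> continuous U2 ->
  (forall x y, a <= x -> x <= y -> y <= b -> U1 y - U1 x = \int[mu]_(s in `[x, y]) g1 s) ->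
  (forall x y, a <= x -> x <= y -> y <= b -> U2 y - U2 x = \int[mu]_(s in `[x, y]) g2 s) ->
  (forall e, 0 < e -> exists2 d, 0 < d & forall x y, a <= x -> x <= y -> y <= b ->
     y - x <= d -> `|U1 y - U1 x| <= e /\ `|U2 y - U2 x| <= e) ->
  U1 b * U2 b - U1 a * U2 a = \int[mu]_(s in `[a, b]) (g1 s * U2 s + U1 s * g2 s).
Proof.
move=> ab ig1 ig2 cU1 cU2 H1 H2 unif.
have sub (g : R -> R) x y : integ `[a, b] g -> a <= x -> y <= b -> integ `[x, y] g.
  move=> ig ax yb; apply: (integ_subset _ _ _ ig) => //.
  by apply: subset_itv; rewrite bnd_simp.
have mulc (U g : R -> R) x y : continuous U -> integ `[x, y] g -> integ `[x, y] (fun s => U s * g s).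
  move=> cU ig; have [M HM] := continuous_bounded_itv x y cU.
  by apply: (@integ_mul_bounded _ _ _ _ M) => //; exact: continuous_measurable.
pose w s := g1 s * U2 s + U1 s * g2 s.
have wi x y : a <= x -> y <= b -> integ `[x, y] w.
  move=> ax yb; apply: integ_add => //; last by apply: mulc => //; exact: sub.
  have := mulc U2 g1 x y cU2 (sub _ _ _ ig1 ax yb).
  by apply: eq_integrable => // s _ /=; rewrite mulrC.
pose V s := `|g1 s| + `|g2 s|.
have Vi x y : a <= x -> y <= b -> integ `[x, y] V.
  by move=> ax yb; apply: integ_add => //; apply: integ_norm => //; exact: sub.
have key e : 0 < e -> `|U1 b * U2 b - U1 a * U2 a - \int[mu]_(s in `[a, b]) w s| <=
    e * \int[mu]_(s in `[a, b]) V s.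
  move=> e0; have [d d0 Hd] := unif e e0.
  have step x y : a <= x -> x <= y -> y <= b -> y - x <= d ->
      `|U1 y * U2 y - U1 x * U2 x - \int[mu]_(s in `[x, y]) w s| <=
      e * \int[mu]_(s in `[x, y]) V s.
    move=> ax xy yb yxd.
    have i1 := sub _ _ _ ig1 ax yb; have i2 := sub _ _ _ ig2 ax yb.
    have c1 : continuous (fun s => U1 y - U1 s) by move=> s; apply: cvgB; [exact: cvg_cst|exact: cU1].
    have c2 : continuous (fun s => U2 x - U2 s) by move=> s; apply: cvgB; [exact: cvg_cst|exact: cU2].
    (* Freezing [U1] at the right end and [U2] at the left end makes the increment of the product
       exact; what remains are increments of [U1] and [U2] within the piece. *)
    have -> : U1 y * U2 y - U1 x * U2 x - \int[mu]_(s in `[x, y]) w s =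
      \int[mu]_(s in `[x, y]) ((U1 y - U1 s) * g2 s + (U2 x - U2 s) * g1 s).
      have -> : U1 y * U2 y - U1 x * U2 x = U1 y * (U2 y - U2 x) + U2 x * (U1 y - U1 x) by ring.
      rewrite H1// H2// -!RintegralZl// -RintegralD//; try exact: integ_scale.
      rewrite -RintegralB//; last exact: wi.
        by apply: eq_Rintegral => s _; rewrite /w; ring.
      by apply: integ_add => //; exact: integ_scale.
    rewrite -RintegralZl//; last exact: Vi.
    apply: Rint_le_norm => //.
    - by apply: integ_add => //; exact: mulc.
    - by apply: integ_scale => //; exact: Vi.
    move=> s; rewrite /= in_itv/= => /andP[xs sy].
    rewrite (le_trans (ler_normD _ _))// /V mulrDr addrC lerD// normrM ler_wpM2r//.
      by rewrite distrC; apply: (Hd x s _ _ _ _).2 => //; lra.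
    by apply: (Hd s y _ _ _ _).1 => //; lra.
  have many n : forall x y, a <= x -> x <= y -> y <= b -> y - x <= n%:R * d ->
      `|U1 y * U2 y - U1 x * U2 x - \int[mu]_(s in `[x, y]) w s| <=
      e * \int[mu]_(s in `[x, y]) V s.
    elim: n => [|n IH] x y ax xy yb yxd.
      by apply: step => //; apply: le_trans yxd _; rewrite mul0r ltW.
    have [yx|yx] := leP (y - x) d; first exact: step.
    have xm : x <= x + d by rewrite lerDl ltW.
    have my : x + d <= y by rewrite -lerBrDl ltW.
    have am : a <= x + d by apply: le_trans xm.
    have mb : x + d <= b by apply: le_trans yb.
    have S1 := step x (x + d) ax xm mb ltac:(by rewrite addrC addKr).
    have yd : y - (x + d) <= n%:R * d.
      by rewrite opprD addrA lerBlDr; move: yxd; rewrite -natr1 mulrDl mul1r.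
    have S2 := IH (x + d) y am my yb yd.
    rewrite (Rint_itv_split xm my (wi _ _ ax yb)) (Rint_itv_split xm my (Vi _ _ ax yb)) mulrDr.
    apply: le_trans (lerD S1 S2); apply: le_trans (ler_normD _ _).
    by rewrite le_eqVlt; apply/orP; left; apply/eqP; congr `|_|; ring.
  apply: (many (Num.bound ((b - a) / d)) a b) => //.
  rewrite -ler_pdivrMr// ltW// archi_boundP// divr_ge0 ?subr_ge0// ltW//.
apply/eqP; rewrite -subr_eq0 -normr_le0 leNgt; apply/negP.
set D := `|_|; set W := \int[mu]_(s in `[a, b]) V s in key *.
move=> D0; have W0 : 0 <= W by apply: Rintegral_ge0 => s _; rewrite addr_ge0.
have W1 : 0 < W + 1 by rewrite ltr_wpDl.
have := key (D / (2 * (W + 1))) (divr_gt0 D0 (mulr_gt0 (ltr0Sn _ 1) W1)).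
rewrite -/D leNgt => /negP; apply.
rewrite mulrAC ltr_pdivrMr ?mulr_gt0// ltr_pM2l//.
by clearbody W; lra.
Qed.

End OrientedIntegral.

(** * The elliptic problem with compactly supported data *)

Section EllipticProblem.
Context {R : realType}.
Local Notation mu := (@lebesgue_measure R).
Local Notation integ D f := (mu.-integrable D (EFin \o f)).
Local Notation K := (@resolvent_dx R).

(* [v] is [(1 - dx^2)^-1 f], and [K f = - v']. *)
Lemma elliptic_compact_support (f : R -> R) (A B : R) : A <= B -> continuous f ->
  (forall x, ~~ (A <= x <= B) -> f x = 0 /\ K f x = 0) ->
  exists v : R -> R, (forall x : R, is_derive x 1 v (- K f x)) /\
    (forall x : R, is_derive x 1 (K f) (f x - v x)) /\
    (forall x, ~~ (A <= x <= B) -> v x = 0).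
Proof.
move=> AB cf f0.
pose a := A - 1; pose b := B + 1.
pose f1 s := expR s * f s; pose f2 s := expR (- s) * f s.
have c1 : continuous f1 by move=> s; apply: cvgM; [exact: continuous_expR|exact: cf].
have cN : continuous (fun s : R => expR (- s)).
  by move=> s; apply: continuous_comp; [apply: cvgN; exact: cvg_id|exact: continuous_expR].
have c2 : continuous f2 by move=> s; apply: cvgM; [exact: cN|exact: cf].
pose e1 := oint f1 a; pose e2 := oint f2 a.
have sub1 x y : x <= y -> e1 y - e1 x = \int[mu]_(s in `[x, y]) f1 s.
  by move=> xy; apply: oint_sub => // c d; exact: integ_continuous.
have sub2 x y : x <= y -> e2 y - e2 x = \int[mu]_(s in `[x, y]) f2 s.
  by move=> xy; apply: oint_sub => // c d; exact: integ_continuous.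
have flat x y : x <= y -> (forall s, x <= s <= y -> ~~ (A <= s <= B)) -> e1 y = e1 x /\ e2 y = e2 x.
  move=> xy out; split; apply/eqP; rewrite -subr_eq0; apply/eqP.
    rewrite sub1//; apply: Rint_eq0 => s; rewrite /= in_itv/= => /out /f0[f0s _].
    by rewrite /f1 f0s mulr0.
  rewrite sub2//; apply: Rint_eq0 => s; rewrite /= in_itv/= => /out /f0[f0s _].
  by rewrite /f2 f0s mulr0.
have e1a : e1 a = 0 by exact: oint_id.
have e2a : e2 a = 0 by exact: oint_id.
have left x : x < A -> e1 x = 0 /\ e2 x = 0.
  move=> xA; have [xa|ax] := leP x a.
    have [|<- <-] // := flat x a xa.
    by move=> s /andP[_ sa]; apply/negP => /andP[As _]; rewrite /a in sa; lra.
  have [|-> ->] // := flat a x (ltW ax).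
  by move=> s /andP[_ sx]; apply/negP => /andP[As _]; lra.
have right x y : B < x -> x <= y -> e1 y = e1 x /\ e2 y = e2 x.
  move=> Bx xy; apply: flat => // s /andP[xs _]; apply/negP => /andP[_ sB]; lra.
(* The kernel split at [x]: on each side [exp (- |s - x|)] factors into a function of [s] and one of
   [x]. *)
have KE0 x : K f x = 2^-1 * (expR (- x) * e1 x - expR x * (e2 b - e2 x)).
  pose lo := Num.min a x; pose hi := Num.max b x.
  have loa : lo <= a by rewrite ge_min lexx.
  have lox : lo <= x by rewrite ge_min lexx orbT.
  have bhi : b <= hi by rewrite le_max lexx.
  have xhi : x <= hi by rewrite le_max lexx orbT.
  have lohi : lo <= hi by exact: le_trans xhi.
  have kx := integ_dx_kernel x.
  have mk (D : set R) : measurable D -> measurable_fun D (dx_kernel x).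
    by move=> mD; apply: measurable_funTS; exact: measurable_dx_kernel.
  rewrite /resolvent_dx; congr (_ * _).
  rewrite (@Rint_supp _ _ `[lo, hi]%classic); last first.
    move=> s ns; rewrite (f0 s _).1 ?mul0r//; apply: contra_notN ns => /andP[As sB].
    by rewrite /= in_itv/=; apply/andP; split; rewrite /a /b in loa bhi; lra.
  have fki : integ `[lo, hi] (fun s => f s * dx_kernel x s).
    have cn : {within `[lo, hi], continuous (fun s => `|f s|)}.
      by apply: continuous_subspaceT => s; apply: cvg_norm; exact: cf.
    have [c _ Hc] := EVT_max lohi cn.
    apply: (@integ_mul_bounded _ _ _ _ `|f c|) => //.
    - exact: (integ_subset _ _ _ kx).
    - exact: continuous_measurable.
  rewrite (Rint_itv_split lox xhi fki); congr (_ + _).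
    transitivity (\int[mu]_(s in `[lo, x]) (expR (- x) * f1 s)).
      apply: Rint_ae_eq_in => //.
      - by apply: measurable_funM; [exact: continuous_measurable|exact: mk].
      - by apply: continuous_measurable => // s; apply: cvgM; [exact: cvg_cst|exact: c1].
      apply: ae_imp (ae_neq x) => s sx; rewrite /= in_itv/= => /andP[_ sx'].
      have {}sx : s < x by rewrite lt_neqAle sx.
      rewrite dx_kernelE ?lt_eqF// ltr0_sg ?subr_lt0// opprK mul1r /exp_abs.
      rewrite ltr0_norm ?subr_lt0// opprK expRD /f1; ring.
    rewrite RintegralZl//; last exact: integ_continuous.
    have [E _] : e1 a = e1 lo /\ e2 a = e2 lo.
      apply: flat => // s /andP[_ sa]; apply/negP => /andP[As _]; rewrite /a in sa; lra.
    by rewrite -sub1// -E e1a subr0.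
  transitivity (\int[mu]_(s in `[x, hi]) (- expR x * f2 s)).
    apply: Rint_ae_eq_in => //.
    - by apply: measurable_funM; [exact: continuous_measurable|exact: mk].
    - by apply: continuous_measurable => // s; apply: cvgM; [exact: cvg_cst|exact: c2].
    apply: ae_imp (ae_neq x) => s sx; rewrite /= in_itv/= => /andP[sx' _].
    have {}sx : x < s by rewrite lt_neqAle eq_sym sx.
    rewrite dx_kernelE ?gt_eqF// gtr0_sg ?subr_gt0// /exp_abs.
    rewrite gtr0_norm ?subr_gt0// opprB expRD /f2; ring.
  rewrite RintegralZl//; last exact: integ_continuous.
  have [_ E] := right b hi ltac:(rewrite /b ltrDl//) bhi.
  by rewrite -sub2// E mulNr.
have aout : ~~ (A <= a <= B) by rewrite negb_and -ltNge /a gtrBl ltr01.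
have bout : ~~ (A <= b <= B) by rewrite negb_and -!ltNge /b ltrDl ltr01 orbT.
(* At [a] and at [b] only one of the two exponential integrals of [f] contributes to [K f]. As [K f]
   vanishes at both points, so do both integrals, and this confines [v] to [[A, B]]. *)
have e2b : e2 b = 0.
  have := KE0 a; rewrite (f0 a aout).2 e1a e2a mulr0 sub0r subr0 mulrN => /esym/eqP.
  by rewrite oppr_eq0 !mulf_eq0 invr_eq0 pnatr_eq0/= gt_eqF ?expR_gt0//= => /eqP.
have e1b : e1 b = 0.
  have := KE0 b; rewrite (f0 b bout).2 subrr mulr0 subr0 => /esym/eqP.
  by rewrite !mulf_eq0 invr_eq0 pnatr_eq0/= gt_eqF ?expR_gt0//= => /eqP.
have out x : ~~ (A <= x <= B) -> e1 x = 0 /\ e2 x = 0.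
  rewrite negb_and -!ltNge => /orP[|Bx]; first exact: left.
  have [xb|bx] := leP x b; first by have [<- <-] := right x b Bx xb.
  by have [-> ->] := right b x ltac:(rewrite /b ltrDl//) (ltW bx).
have KE x : K f x = 2^-1 * (expR (- x) * e1 x + expR x * e2 x) by rewrite KE0 e2b; ring.
have de1 (x : R) : is_derive x 1 e1 (f1 x) by exact: derive_oint.
have de2 (x : R) : is_derive x 1 e2 (f2 x) by exact: derive_oint.
have dE (x : R) : is_derive x 1 expR (expR x) by exact: is_derive_expR.
have dEN (x : R) : is_derive x 1 (fun x => expR (- x)) (- expR (- x)).
  by apply: (is_derive_eq (derive_expR (derive_opp (derive_id x)))); ring.
have EE (x : R) : expR (- x) * expR x = 1 by rewrite -expRD addNr expR0.
(* Half the convolution of [f] with [exp_abs]: since [e2 b = 0], [- e2 x] is the integral of [f2]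
   from [x] to [b]. *)
exists (fun x => 2^-1 * (expR (- x) * e1 x - expR x * e2 x)); split; last split.
- move=> x; apply: (is_derive_eq (derive_scale 2^-1
    (derive_sub (derive_mul (dEN x) (de1 x)) (derive_mul (dE x) (de2 x))))).
  rewrite KE /f1 /f2; have := EE x; move: (expR x) (expR (- x)) => E E' HE.
  have -> : E' * (E * f x) = f x by rewrite mulrA HE mul1r.
  have -> : E * (E' * f x) = f x by rewrite mulrA [E * E']mulrC HE mul1r.
  by ring.
- move=> x; rewrite (_ : K f = fun x => 2^-1 * (expR (- x) * e1 x + expR x * e2 x)); last first.
    by apply/funext => y; exact: KE.
  apply: (is_derive_eq (derive_scale 2^-1
    (derive_add (derive_mul (dEN x) (de1 x)) (derive_mul (dE x) (de2 x))))).
  rewrite /f1 /f2; have := EE x; move: (expR x) (expR (- x)) => E E' HE.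
  have -> : E' * (E * f x) = f x by rewrite mulrA HE mul1r.
  have -> : E * (E' * f x) = f x by rewrite mulrA [E * E']mulrC HE mul1r.
  by field.
- by move=> x /out[-> ->]; rewrite !mulr0 subrr mulr0.
Qed.

Lemma resolvent_dx_sub (f g : R -> R) (M N x : R) : continuous f -> continuous g ->
  (forall s, `|f s| <= M) -> (forall s, `|g s| <= N) ->
  K f x - K g x = K (fun s => f s - g s) x.
Proof.
move=> cf cg fM gN; rewrite /resolvent_dx -mulrBr; congr (_ * _).
rewrite -RintegralB//; [|exact: integ_bounded_mul fM (integ_dx_kernel x)|exact: integ_bounded_mul gN (integ_dx_kernel x)].
by apply: eq_Rintegral => s _; rewrite mulrBl.
Qed.

End EllipticProblem.

(** * Conservation of the energy *)

Section SupContinuity.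
Context {R : realType}.
Local Notation mu := (@lebesgue_measure R).
Local Notation integ D f := (mu.-integrable D (EFin \o f)).

Lemma sup_continuous_sub (f g : R -> R -> R) : sup_continuous f -> sup_continuous g ->
  sup_continuous (fun t x => f t x - g t x).
Proof.
move=> [cf [bf sf]] [cg [bg sg]]; split; [|split].
- by move=> t x; apply: cvgB; [exact: cf|exact: cg].
- move=> t; have [M HM] := bf t; have [N HN] := bg t; exists (M + N) => x.
  by apply: le_trans (ler_normB _ _) _; exact: lerD.
move=> t0 e e0; have e2 : 0 < e / 2 by rewrite divr_gt0.
have [d1 d10 H1] := sf t0 _ e2; have [d2 d20 H2] := sg t0 _ e2.
exists (Num.min d1 d2); first by rewrite lt_min d10.
move=> t; rewrite lt_min => /andP[/H1 t1 /H2 t2] x.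
have -> : f t x - g t x - (f t0 x - g t0 x) = (f t x - f t0 x) - (g t x - g t0 x) by ring.
by rewrite [leRHS]splitr (le_trans (ler_normB _ _))// lerD.
Qed.

Lemma sup_continuous_time (f : R -> R -> R) (y : R) : sup_continuous f ->
  continuous (f ^~ y).
Proof.
move=> [_ [_ sf]] t0; apply/cvgrPdist_le => e e0; have [d d0 Hd] := sf t0 e e0.
by exists d => // t; rewrite /ball_/= distrC => /Hd; rewrite distrC.
Qed.

Lemma continuous_Rint_param (f : R -> R -> R) (c d : R) : sup_continuous f ->
  continuous (fun y => \int[mu]_(r in `[c, d]) f r y).
Proof.
move=> sf y; apply/(@cvg_nbhsP _ R^o) => y_ yy.
have [M HM] := sup_continuous_bounded c d sf.
apply: (@Rint_dominated_cvg _ _ _ _ (fun=> M)) => //.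
- by move=> n; apply: continuous_measurable => //; exact: sup_continuous_time.
- by apply: continuous_measurable => //; exact: sup_continuous_time.
- exact: integ_cst.
- by move=> n r; rewrite /= in_itv/= => rI; exact: HM.
- by apply: aeW => r _; have [cf _] := sf; move/(@cvg_nbhsP _ R^o): (cf r y); exact.
Qed.

(** Hölder continuity of exponent 1/2, in squared form: what an L^2 derivative gives by
    Cauchy-Schwarz, and a source of the moduli required by [product_rule]. *)
Definition half_holder (a b : R) (U : R -> R) : Prop := exists2 H, 0 <= H &
  forall x y, a <= x -> x <= y -> y <= b -> (U y - U x) ^+ 2 <= H * (y - x).

Lemma half_holder_modulus (a b : R) (U : R -> R) : half_holder a b U ->
  forall e, 0 < e -> exists2 d, 0 < d & forall x y, a <= x -> x <= y -> y <= b ->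
    y - x <= d -> `|U y - U x| <= e.
Proof.
move=> [H H0 HU] e e0; have H1 : 0 < H + 1 by rewrite ltr_wpDl.
exists (e ^+ 2 / (H + 1)) => [|x y ax xy yb yx]; first by rewrite divr_gt0// exprn_gt0.
rewrite -ler_sqr ?nnegrE ?(ltW e0)// real_normK ?num_real//.
apply: le_trans (HU x y ax xy yb) _; rewrite ler_pdivlMr// in yx.
apply: le_trans yx; rewrite mulrC ler_wpM2l ?subr_ge0// lerDl//.
Qed.

Lemma half_holder_product_rule (g1 g2 U1 U2 : R -> R) (a b : R) :
  a <= b -> integ `[a, b] g1 -> integ `[a, b] g2 -> continuous U1 -> continuous U2 ->
  (forall x y, a <= x -> x <= y -> y <= b -> U1 y - U1 x = \int[mu]_(s in `[x, y]) g1 s) ->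
  (forall x y, a <= x -> x <= y -> y <= b -> U2 y - U2 x = \int[mu]_(s in `[x, y]) g2 s) ->
  half_holder a b U1 -> half_holder a b U2 ->
  U1 b * U2 b - U1 a * U2 a = \int[mu]_(s in `[a, b]) (g1 s * U2 s + U1 s * g2 s).
Proof.
move=> ab i1 i2 c1 c2 H1 H2 h1 h2; apply: product_rule => // e e0.
have [d1 d10 D1] := half_holder_modulus h1 e0.
have [d2 d20 D2] := half_holder_modulus h2 e0.
exists (Num.min d1 d2); first by rewrite lt_min d10.
by move=> x y ax xy yb; rewrite le_min => /andP[? ?]; split; [exact: D1|exact: D2].
Qed.

End SupContinuity.

(** * The H^1 energy of a compactly supported solution *)

Section CompactlySupportedSolution.
Context {R : realType}.
Local Notation mu := (@lebesgue_measure R).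
Local Notation integ D f := (mu.-integrable D (EFin \o f)).
Variables (beta : R) (u : R -> R -> R) (A B : R).
Hypothesis AB : A <= B.
Hypothesis su : sup_continuous u.
Let w t (y : R) : R := flux beta (u t y).
Let p t (x : R) : R := resolvent_dx (w t) x.
Hypothesis du : forall t x : R, is_derive t 1 (u ^~ x) (p t x).
Hypothesis out : forall t x, ~~ (A <= x <= B) -> u t x = 0 /\ p t x = 0.
Variable v : R -> R -> R.
Hypothesis dv : forall t x : R, is_derive x 1 (v t) (- p t x).
Hypothesis dp : forall t x : R, is_derive x 1 (p t) (w t x - v t x).
Hypothesis v_out : forall t x, ~~ (A <= x <= B) -> v t x = 0.
Variable g0 : R -> R.
Hypothesis u0_primitive : primitive_of (u 0) g0.

Let a : R := A - 1.
Let b : R := B + 1.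

Let ab : a < b.
Proof. by apply: (@lt_trans _ _ A); rewrite /a /b ?gtrBl// ltr_pwDr. Qed.
Let a_out : ~~ (A <= a <= B). Proof. by rewrite negb_and -ltNge /a gtrBl ltr01. Qed.
Let b_out : ~~ (A <= b <= B). Proof. by rewrite negb_and -!ltNge /b ltrDl ltr01 orbT. Qed.
Let outside x : ~~ (a <= x <= b) -> ~~ (A <= x <= B).
Proof.
by apply: contra => /andP[Ax xB]; rewrite /a /b; apply/andP; split; lra.
Qed.

Let sw : sup_continuous w. Proof. exact: sup_continuous_flux. Qed.

Let sp : sup_continuous p.
Proof.
have [cw [bw ssw]] := sw; split; [|split].
- by move=> t x; exact: derive_continuous (dp t x).
- move=> t; have [M HM] := bw t; exists M => x; apply: resolvent_dx_bound => //.
  by apply: continuous_measurable => //; exact: cw.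
move=> t0 e e0; have [d d0 Hd] := ssw t0 e e0; exists d => // t /Hd H x.
have [M HM] := bw t; have [N HN] := bw t0.
rewrite /p (resolvent_dx_sub x (cw t) (cw t0) HM HN); apply: resolvent_dx_bound => //.
apply: continuous_measurable => // y; apply: cvgB; exact: cw.
Qed.

(** [v] is given separately at each time; its continuity in time is recovered from that of [p], by
    integrating [v_x = - p] from the edge [a] where [v] vanishes. *)
Let sv : sup_continuous v.
Proof.
have [cp [bp ssp]] := sp.
have ba : 0 < b - a by rewrite subr_gt0.
have grow (f f' : R -> R) (e : R) : 0 <= e -> (forall x : R, is_derive x 1 f (f' x)) ->
    (forall x, `|f' x| <= e) -> (forall x, ~~ (A <= x <= B) -> f x = 0) ->
    forall x, `|f x| <= e * (b - a).
  move=> e0 df fe f0 x; have [/andP[ax xb]|xo] := boolP (a <= x <= b); last first.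
    by rewrite f0 ?normr0 ?mulr_ge0// ?(ltW ba)//; exact: outside.
  apply: le_trans (derive_growth ax (f0 a a_out) df (fun s _ => fe s)) _.
  by rewrite ler_wpM2l// lerD2r.
split; [|split].
- by move=> t x; exact: derive_continuous (dv t x).
- move=> t; have [M HM] := bp t; exists (M * (b - a)); apply: grow (dv t) _ (v_out t).
    exact: le_trans (HM 0).
  by move=> x; rewrite normrN.
move=> t0 e e0; have e1 : 0 < e / (b - a) by rewrite divr_gt0.
have [d d0 Hd] := ssp t0 _ e1; exists d => // t /Hd H x.
have := grow (fun x => v t x - v t0 x) (fun x => - p t x - - p t0 x) (e / (b - a)) (ltW e1)
  (fun x => derive_sub (dv t x) (dv t0 x)).
rewrite divfK ?gt_eqF//; apply.
- by move=> y; rewrite -opprD normrN.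
- by move=> y yo; rewrite !v_out// subrr.
Qed.

Let psi t (y : R) : R := w t y - v t y.
Let spsi : sup_continuous psi. Proof. exact: sup_continuous_sub. Qed.

(* [u t - u 0] has derivative [gam t] in space. *)
Let gam t (y : R) : R := oint (psi ^~ y) 0 t.

Let dgam (t y : R) : is_derive t 1 (gam ^~ y) (psi t y).
Proof. by apply: derive_oint; exact: sup_continuous_time. Qed.

Let cgam t : continuous (gam t).
Proof.
have E : gam t = fun y => oint (psi ^~ y) 0 t by [].
rewrite E /oint; case: leP => _; first exact: continuous_Rint_param.
by move=> y; apply: cvgN; exact: continuous_Rint_param.
Qed.

Let gam0 y : gam 0 y = 0. Proof. exact: oint_id. Qed.

Let measurable_bounded (f : R -> R) (x y : R) : continuous f -> measurable_fun `[x, y]%classic f /\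
  exists M, forall s, (`[x, y]%classic : set R) s -> `|f s| <= M.
Proof.
move=> cf; split; first exact: continuous_measurable.
by have [M HM] := continuous_bounded_itv x y cf; exists M => s; rewrite /= in_itv; exact: HM.
Qed.

Let near_bound (f : R -> R -> R) t0 : sup_continuous f -> exists C, forall t y,
  t0 - 1 < t < t0 + 1 -> `|f t y| <= C.
Proof.
move=> sf; have [C HC] := sup_continuous_bounded (t0 - 1) (t0 + 1) sf.
by exists C => t y /andP[t1 t2]; apply: HC; rewrite !ltW.
Qed.

(** The space derivative of [u t]: the rough part [g0] does not depend on time, and the
    time-dependent part is continuous. *)
Let g t (y : R) : R := g0 y + gam t y.
Let Lg0 : L2 g0. Proof. by have [] := u0_primitive. Qed.
Let ig0 x y : integ `[x, y] g0. Proof. exact: L2_integ_itv. Qed.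
Let igam t x y : integ `[x, y] (gam t). Proof. exact: integ_continuous. Qed.
Let ig t x y : integ `[x, y] (g t). Proof. exact: integ_add. Qed.
Let ig0gam t x y : integ `[x, y] (fun s => gam t s * g0 s).
Proof.
have [mf [M HM]] := measurable_bounded x y (@cgam t).
exact: (integ_mul_bounded _ _ mf HM).
Qed.
Let ig02 x y : integ `[x, y] (fun s => g0 s ^+ 2).
Proof. by apply: (integ_subset _ _ _ (L2_integ_sqr Lg0)). Qed.
Let igam2 t x y : integ `[x, y] (fun s => gam t s ^+ 2).
Proof. by apply: integ_continuous; exact: continuous_sqr. Qed.
Let ig2 t x y : integ `[x, y] (fun s => g t s ^+ 2).
Proof.
have := integ_add (@measurable_itv R `[x, y]) (ig02 x y) (integ_add (@measurable_itv R `[x, y])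
  (integ_scale 2 (@measurable_itv R `[x, y]) (ig0gam t x y)) (igam2 t x y)).
by apply: eq_integrable => // s _ /=; rewrite /g; congr EFin; ring.
Qed.

(** The time derivative of the integral of [gam t] over [[a, x]] is that of [psi = p_x], namely
    [p t x], as is that of [u t x]. The difference is thus constant in time, and at time 0 it is the
    integral of [g0]. *)
Let u_primitive t x : a <= x -> u t x = \int[mu]_(s in `[a, x]) g t s.
Proof.
move=> ax.
have dQ (t0 : R) : is_derive t0 1 (fun t => \int[mu]_(s in `[a, x]) (gam t s * 1)) (p t0 x).
  have -> : p t0 x = \int[mu]_(s in `[a, x]) (psi t0 s * 1).
    under eq_Rintegral do rewrite mulr1.
    rewrite (Rint_FTC ax (dp t0)); last by have [c _] := spsi; exact: c.
    by rewrite (out t0 a_out).2 subr0.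
  have [C HC] := near_bound t0 spsi.
  apply: (@derive_under_Rint _ _ gam psi _ t0 C) => //.
  - exact: integ_cst.
  - by move=> r _; apply: measurable_bounded; exact: cgam.
  - by move=> r s rI _; exact: HC.
have D0 (r : R) : is_derive r 1 (fun t => u t x - \int[mu]_(s in `[a, x]) (gam t s * 1)) 0.
  by apply: (is_derive_eq (derive_sub (du r x) (dQ r))); rewrite subrr.
have := is_derive_0_is_cst t 0 D0 => /=.
rewrite (@Rint_eq0 _ _ (fun s => gam 0 s * 1)); last by move=> s _; rewrite gam0 mul0r.
under eq_Rintegral do rewrite mulr1.
rewrite subr0 => /eqP; rewrite subr_eq => /eqP ->.
rewrite /g RintegralD//; congr (_ + _).
have [_ /(_ a x ax) <-] := u0_primitive.
by rewrite (out 0 a_out).1 subr0.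
Qed.

Let u_increment t x y : a <= x -> x <= y -> u t y - u t x = \int[mu]_(s in `[x, y]) g t s.
Proof.
move=> ax xy; rewrite !u_primitive//; last exact: le_trans xy.
by rewrite (Rint_itv_split ax xy (ig t a y)); ring.
Qed.

Let u_half_holder_by t : forall x y, a <= x -> x <= y -> y <= b ->
  (u t y - u t x) ^+ 2 <= (\int[mu]_(s in `[a, b]) g t s ^+ 2) * (y - x).
Proof.
move=> x y ax xy yb; rewrite u_increment//.
apply: (@le_trans _ _ ((\int[mu]_(s in `[x, y]) `|g t s|) ^+ 2)).
  rewrite -[X in X <= _]real_normK ?num_real// ler_sqr ?nnegrE ?normr_ge0 ?Rintegral_ge0//.
  exact: le_normr_Rintegral.
apply: le_trans (Rint_cauchy_schwarz xy (ig t x y) (ig2 t x y)) _.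
rewrite mulrC ler_wpM2r ?subr_ge0//.
have ay : a <= y by exact: le_trans xy.
rewrite (Rint_itv_split ay yb (ig2 t a b)) (Rint_itv_split ax xy (ig2 t a y)).
by rewrite -addrA addrC -addrA lerDl addr_ge0// Rintegral_ge0// => s _; exact: sqr_ge0.
Qed.

Let cu t : continuous (u t). Proof. by have [] := su. Qed.
Let cv t : continuous (v t). Proof. by have [] := sv. Qed.
Let cp t : continuous (p t). Proof. by have [] := sp. Qed.
Let cw t : continuous (w t). Proof. by have [] := sw. Qed.

Let u_half_holder t : half_holder a b (u t).
Proof.
exists (\int[mu]_(s in `[a, b]) g t s ^+ 2); last exact: u_half_holder_by.
by apply: Rintegral_ge0 => s _; exact: sqr_ge0.
Qed.

Let half_holder_sub c (U : R -> R) : c <= b -> half_holder a b U -> half_holder a c U.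
Proof.
by move=> cb [H H0 HU]; exists H => // x y ax xy yc; apply: HU => //; exact: le_trans cb.
Qed.

Let igU t (U : R -> R) x y : continuous U -> integ `[x, y] (fun s => U s * g t s).
Proof.
move=> cU; have [mf [M HM]] := measurable_bounded x y cU.
exact: (integ_mul_bounded _ _ mf HM).
Qed.

Let u_sqr_primitive t x : a <= x -> x <= b ->
  u t x ^+ 2 = \int[mu]_(s in `[a, x]) (2 * (u t s * g t s)).
Proof.
move=> ax xb; have h := half_holder_sub xb (u_half_holder t).
have H y z : a <= y -> y <= z -> z <= x -> u t z - u t y = \int[mu]_(s in `[y, z]) g t s.
  by move=> ay yz _; exact: u_increment.
have := half_holder_product_rule ax (ig t a x) (ig t a x) (@cu t) (@cu t) H H h h.
rewrite (out t a_out).1 mulr0 subr0 -expr2 => ->.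
by apply: eq_Rintegral => s _; ring.
Qed.

Let u_sqr_half_holder t : half_holder a b (fun s => u t s ^+ 2).
Proof.
have [H H0 HU] := u_half_holder t; have [M HM] := continuous_bounded_itv a b (@cu t).
exists (H * (2 * M) ^+ 2); first by rewrite mulr_ge0// sqr_ge0.
move=> x y ax xy yb; rewrite subr_sqr exprMn.
rewrite (_ : H * _ * _ = (H * (y - x)) * (2 * M) ^+ 2); last by ring.
apply: ler_pM; rewrite ?sqr_ge0 ?HU//.
rewrite -real_normK ?num_real// ler_sqr ?nnegrE.
- rewrite (le_trans (ler_normD _ _))// mulr_natl mulr2n lerD// HM//.
    by rewrite yb andbT (le_trans ax).
  by rewrite ax (le_trans xy).
- exact: normr_ge0.
- rewrite mulr_ge0//; apply: le_trans (HM a _) => //; rewrite lexx ltW//.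
Qed.

(** This integral and the next two evaluate [\int psi u_x], half the time derivative of
    [\int u_x^2], term by term for [psi = beta u + u^2 / 2 - v]: the first two integrands are exact
    derivatives and the third is integrated by parts. *)
Let Rint_g_u t : \int[mu]_(s in `[a, b]) (u t s * g t s) = 0.
Proof.
have := u_sqr_primitive t (ltW ab) (lexx b).
rewrite (out t b_out).1 expr0n RintegralZl//; last exact: igU.
by move=> /esym/eqP; rewrite mulf_eq0 pnatr_eq0 => /eqP.
Qed.

Let Rint_g_u2 t : \int[mu]_(s in `[a, b]) (u t s ^+ 2 * g t s) = 0.
Proof.
have cu2 : continuous (fun s => u t s ^+ 2).
  exact: continuous_sqr.
have i2 x y : integ `[x, y] (fun s => 2 * (u t s * g t s)).
  by apply: integ_scale => //; exact: igU.
have H1 y z : a <= y -> y <= z -> z <= b -> u t z - u t y = \int[mu]_(s in `[y, z]) g t s.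
  by move=> ay yz _; exact: u_increment.
have H2 y z : a <= y -> y <= z -> z <= b ->
    u t z ^+ 2 - u t y ^+ 2 = \int[mu]_(s in `[y, z]) (2 * (u t s * g t s)).
  move=> ay yz zb; rewrite !u_sqr_primitive//; try by [exact: le_trans ay yz|exact: le_trans yz zb].
  by rewrite (Rint_itv_split ay yz (i2 a z)); ring.
have := half_holder_product_rule (ltW ab) (ig t a b) (i2 a b) (@cu t) cu2 H1 H2
  (u_half_holder t) (u_sqr_half_holder t).
rewrite (out t b_out).1 (out t a_out).1 !mul0r subrr.
rewrite (_ : \int[mu]_(s in _) _ = \int[mu]_(s in `[a, b]) (3 * (u t s ^+ 2 * g t s))).
  rewrite RintegralZl//; last exact: igU.
  by move=> /esym/eqP; rewrite mulf_eq0 pnatr_eq0 => /eqP.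
by apply: eq_Rintegral => s _; ring.
Qed.

Let Rint_g_v t : \int[mu]_(s in `[a, b]) (v t s * g t s) = \int[mu]_(s in `[a, b]) (u t s * p t s).
Proof.
have H1 y z : a <= y -> y <= z -> z <= b -> u t z - u t y = \int[mu]_(s in `[y, z]) g t s.
  by move=> ay yz _; exact: u_increment.
have cnp : continuous (fun s => - p t s) by move=> s; apply: cvgN; exact: cp.
have H2 y z : a <= y -> y <= z -> z <= b -> v t z - v t y = \int[mu]_(s in `[y, z]) - p t s.
  by move=> _ yz _; rewrite (Rint_FTC yz (dv t)).
have hv : half_holder a b (v t).
  have [M HM] := continuous_bounded_itv a b cnp.
  have M0 : 0 <= M by apply: le_trans (HM a _) => //; rewrite lexx ltW.
  exists (M ^+ 2 * (b - a)); first by rewrite mulr_ge0 ?sqr_ge0// subr_ge0 ltW.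
  move=> x y ax xy yb; rewrite H2//.
  apply: (@le_trans _ _ ((M * (y - x)) ^+ 2)).
    rewrite -real_normK ?num_real// ler_sqr ?nnegrE ?mulr_ge0 ?subr_ge0//.
    apply: Rint_le_cst => //; first exact: integ_continuous.
    by move=> s /andP[xs sy]; apply: HM; rewrite (le_trans ax)//= (le_trans sy).
  rewrite (_ : (M * (y - x)) ^+ 2 = M ^+ 2 * (y - x) * (y - x)); last by ring.
  apply: ler_wpM2r; rewrite ?subr_ge0//; apply: ler_wpM2l; rewrite ?sqr_ge0//.
  exact: lerB.
have := half_holder_product_rule (ltW ab) (ig t a b) (integ_continuous a b cnp)
  (@cu t) (@cv t) H1 H2 (u_half_holder t) hv.
rewrite (out t b_out).1 (out t a_out).1 !mul0r subrr => E.
apply/eqP; rewrite -subr_eq0 -RintegralB//; last 2 first.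
- exact: igU.
- by apply: integ_continuous => s; apply: cvgM; [exact: cu|exact: cp].
rewrite [X in _ == X]E; apply/eqP; apply: eq_Rintegral => s _; ring.
Qed.

(** The squared H^1 norm with [(g0 + gam) ^ 2] expanded: [g0] only enters as a fixed integrable
    weight, in the form that [derive_under_Rint] expects, whence also the factors [1]. *)
Let energy t : R := \int[mu]_(s in `[a, b]) (u t s ^+ 2 * 1) +
  (\int[mu]_(s in `[a, b]) g0 s ^+ 2 + (2 * \int[mu]_(s in `[a, b]) (gam t s * g0 s) +
   \int[mu]_(s in `[a, b]) (gam t s ^+ 2 * 1))).

Let energyE t : energy t = \int[mu]_(s in `[a, b]) u t s ^+ 2 + \int[mu]_(s in `[a, b]) g t s ^+ 2.
Proof.
rewrite /energy; congr (_ + _); first by apply: eq_Rintegral => s _; rewrite mulr1.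
rewrite -RintegralZl// -RintegralD//; [|exact: integ_scale|]; last first.
  by apply: eq_integrable (igam2 t a b) => // s _ /=; rewrite mulr1.
rewrite -RintegralD//; last first.
  apply: integ_add => //; first exact: integ_scale.
  by apply: eq_integrable (igam2 t a b) => // s _ /=; rewrite mulr1.
by apply: eq_Rintegral => s _; rewrite /g; ring.
Qed.

(** The [u] part contributes [2 \int u p] and the [g] part [2 \int psi g = - 2 \int v g = - 2 \int u
    p]. *)
Let derive_energy (t0 : R) : is_derive t0 1 energy 0.
Proof.
have [Cu HCu] := near_bound t0 su; have [Cp HCp] := near_bound t0 sp.
have [C HCc] := sup_continuous_bounded (t0 - 1) (t0 + 1) spsi.
have HC r s : t0 - 1 < r < t0 + 1 -> `|psi r s| <= C.
  by move=> /andP[r1 r2]; apply: HCc; rewrite !ltW.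
have i1 : integ `[a, b] (fun=> 1 : R) by exact: integ_cst.
have d1 : is_derive t0 1 (fun t => \int[mu]_(s in `[a, b]) (u t s ^+ 2 * 1))
    (\int[mu]_(s in `[a, b]) (2 * u t0 s * p t0 s * 1)).
  apply: (@derive_under_Rint _ _ (fun t s => u t s ^+ 2) (fun t s => 2 * u t s * p t s) _ t0
    (2 * Cu * Cp)) => //.
  - by move=> r _; apply: measurable_bounded; exact: continuous_sqr.
  - by move=> r s _; apply: (is_derive_eq (derive_exp 2 (du r s))); rewrite expr1.
  - move=> r s rI _; rewrite (normrM _ (p r s)) (normrM 2) [`|2|]ger0_norm//.
    by apply: ler_pM; [exact: mulr_ge0|exact: normr_ge0|apply: ler_wpM2l => //; exact: HCu|exact: HCp].
have d2 : is_derive t0 1 (fun t => \int[mu]_(s in `[a, b]) (gam t s * g0 s))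
    (\int[mu]_(s in `[a, b]) (psi t0 s * g0 s)).
  apply: (@derive_under_Rint _ _ gam psi _ t0 C) => //.
  - by move=> r _; apply: measurable_bounded; exact: cgam.
  - by move=> r s rI _; exact: HC.
have [G HG] := continuous_bounded_itv a b (@cgam (t0 - 1)).
have d3 : is_derive t0 1 (fun t => \int[mu]_(s in `[a, b]) (gam t s ^+ 2 * 1))
    (\int[mu]_(s in `[a, b]) (2 * gam t0 s * psi t0 s * 1)).
  apply: (@derive_under_Rint _ _ (fun t s => gam t s ^+ 2) (fun t s => 2 * gam t s * psi t s) _ t0
    (2 * (C * 2 + G) * C)) => //.
  - by move=> r _; apply: measurable_bounded; exact: continuous_sqr.
  - by move=> r s _; apply: (is_derive_eq (derive_exp 2 (dgam r s))); rewrite expr1.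
  - move=> r s rI; rewrite /= in_itv/= => sI.
    rewrite !normrM ger0_norm// ler_pM// ?mulr_ge0// ?HC// ler_wpM2l//.
    have /andP[r1 r2] := rI.
    have -> : gam r s = (gam r s - gam (t0 - 1) s) + gam (t0 - 1) s by ring.
    rewrite (le_trans (ler_normD _ _))// lerD// ?HG//.
    have C0 : 0 <= C by apply: le_trans (HC r s rI).
    have tr : t0 - 1 <= r by exact: ltW.
    have cps : continuous (psi ^~ s) by exact: sup_continuous_time.
    rewrite /gam oint_sub//; last by move=> c d; exact: integ_continuous.
    apply: (@le_trans _ _ (C * (r - (t0 - 1)))).
      apply: Rint_le_cst => //; first exact: integ_continuous.
      by move=> q /andP[q1 q2]; apply: HCc; rewrite q1 (le_trans q2)// ltW.
    by rewrite ler_wpM2l//; lra.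
apply: (is_derive_eq (derive_add d1 (derive_add (derive_cst _ t0) (derive_add (derive_scale 2 d2) d3)))).
have icont (f : R -> R) : continuous f -> integ `[a, b] f by move=> cf; exact: integ_continuous.
have cpsi : continuous (psi t0) by have [c _] := spsi; exact: c.
have iup : integ `[a, b] (fun s => u t0 s * p t0 s).
  by apply: icont => s; apply: cvgM; [exact: cu|exact: cp].
have E1 : \int[mu]_(s in `[a, b]) (2 * u t0 s * p t0 s * 1) =
    2 * \int[mu]_(s in `[a, b]) (u t0 s * p t0 s).
  by rewrite -RintegralZl//; apply: eq_Rintegral => s _; ring.
have ipg : integ `[a, b] (fun s => psi t0 s * g t0 s) by exact: igU.
have E2 : 2 * \int[mu]_(s in `[a, b]) (psi t0 s * g0 s) +
    \int[mu]_(s in `[a, b]) (2 * gam t0 s * psi t0 s * 1) =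
    2 * \int[mu]_(s in `[a, b]) (psi t0 s * g t0 s).
  have ip0 : integ `[a, b] (fun s => psi t0 s * g0 s).
    have [mf [M HM]] := measurable_bounded a b cpsi.
    exact: (integ_mul_bounded _ _ mf HM).
  rewrite -!RintegralZl// -RintegralD//; [|exact: integ_scale|]; last first.
    apply: icont => s; apply: cvgM; last exact: cvg_cst.
    by apply: cvgM; [apply: cvgM; [exact: cvg_cst|exact: cgam]|exact: cpsi].
  by apply: eq_Rintegral => s _; rewrite /g; ring.
have E3 : \int[mu]_(s in `[a, b]) (psi t0 s * g t0 s) = - \int[mu]_(s in `[a, b]) (u t0 s * p t0 s).
  transitivity (beta * \int[mu]_(s in `[a, b]) (u t0 s * g t0 s) +
    2^-1 * \int[mu]_(s in `[a, b]) (u t0 s ^+ 2 * g t0 s) -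
    \int[mu]_(s in `[a, b]) (v t0 s * g t0 s)).
    have cu2 : continuous (fun s => u t0 s ^+ 2).
      exact: continuous_sqr.
    have j1 := igU t0 a b (@cu t0); have j2 := igU t0 a b cu2; have j3 := igU t0 a b (@cv t0).
    rewrite -!RintegralZl// -RintegralD//; [|exact: integ_scale|exact: integ_scale].
    rewrite -RintegralB//; last by apply: integ_add => //; exact: integ_scale.
    by apply: eq_Rintegral => s _; rewrite /psi /w /flux; ring.
  by rewrite Rint_g_u Rint_g_u2 Rint_g_v; ring.
by rewrite E1 add0r E2 E3; ring.
Qed.

Lemma solution_uniform_holder : exists2 E, 0 <= E & forall t x y, a <= x -> x <= y -> y <= b ->
  (u t y - u t x) ^+ 2 <= E * (y - x).
Proof.
have sq0 (f : R -> R) : 0 <= \int[mu]_(s in `[a, b]) f s ^+ 2.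
  by apply: Rintegral_ge0 => s _; exact: sqr_ge0.
exists (energy 0); first by rewrite energyE addr_ge0.
move=> t x y ax xy yb; apply: le_trans (u_half_holder_by t ax xy yb) _.
rewrite ler_wpM2r ?subr_ge0// (is_derive_0_is_cst 0 t derive_energy) energyE.
by rewrite lerDr.
Qed.

End CompactlySupportedSolution.

(** * Dispersal *)

Section Dispersal.
Context {R : realType}.
Local Notation mu := (@lebesgue_measure R).
Local Notation integ D f := (mu.-integrable D (EFin \o f)).

Lemma Rint_subitv_le (f : R -> R) (a b x y : R) : a <= x -> x <= y -> y <= b ->
  integ `[a, b] f -> (forall s, 0 <= f s) ->
  \int[mu]_(s in `[x, y]) f s <= \int[mu]_(s in `[a, b]) f s.
Proof.
move=> ax xy yb fi f0; have ay := le_trans ax xy.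
rewrite (Rint_itv_split ay yb fi) (Rint_itv_split ax xy); last first.
  by apply: integ_subset fi => //; apply: subset_itvl; rewrite bnd_simp.
by rewrite -addrA addrC -addrA lerDl addr_ge0// Rintegral_ge0.
Qed.

Lemma Rint_sqr_eq0 (f : R -> R) (a b : R) : continuous f ->
  \int[mu]_(s in `[a, b]) f s ^+ 2 = 0 -> forall x, a < x < b -> f x = 0.
Proof.
move=> cf f0 x /andP[ax xb].
have c2 := continuous_sqr cf.
have i2 c d : integ `[c, d] (fun s => f s ^+ 2) by exact: integ_continuous.
have d0 : derive1 (oint (fun s => f s ^+ 2) a) x = 0.
  apply: (@near_cst_derive _ _ _ 0); near=> y.
  have ay : a <= y by rewrite ltW//; near: y; exact: lt_nbhsr.
  have yb : y <= b by rewrite ltW//; near: y; exact: lt_nbhsl.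
  rewrite /oint ay; apply/eqP; rewrite eq_le; apply/andP; split.
    by rewrite -f0; apply: Rint_subitv_le => // s; exact: sqr_ge0.
  by apply: Rintegral_ge0 => s _; exact: sqr_ge0.
have := derive1_is (derive_oint a x c2); rewrite d0 => /esym/eqP.
by rewrite sqrf_eq0 => /eqP.
Unshelve. all: by end_near. Qed.

Variables (beta : R) (u w p v : R -> R -> R) (A B E : R).
Hypothesis AB : A <= B.
Hypothesis wE : forall t x, w t x = flux beta (u t x).
Hypothesis cu : forall t, continuous (u t).
Hypothesis du : forall t x : R, is_derive t 1 (u ^~ x) (p t x).
Hypothesis dv : forall t x : R, is_derive x 1 (v t) (- p t x).
Hypothesis dp : forall t x : R, is_derive x 1 (p t) (w t x - v t x).
Hypothesis out : forall t x, ~~ (A <= x <= B) -> [/\ u t x = 0, p t x = 0 & v t x = 0].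
Hypothesis p_bound : forall t M, (forall x, `|w t x| <= M) -> forall x, `|p t x| <= M.
Hypothesis E0 : 0 <= E.
Hypothesis holder : forall t x y, A - 1 <= x -> x <= y -> y <= B + 1 ->
  (u t y - u t x) ^+ 2 <= E * (y - x).

Let a : R := A - 1.
Let b : R := B + 1.
Let ab : a < b. Proof. by rewrite /a /b; move: AB; lra. Qed.
Let a_out : ~~ (A <= a <= B). Proof. by rewrite negb_and -ltNge /a gtrBl ltr01. Qed.
Let b_out : ~~ (A <= b <= B). Proof. by rewrite negb_and -!ltNge /b ltrDl ltr01 orbT. Qed.
Let inside x : A <= x <= B -> a <= x <= b.
Proof. by move=> /andP[Ax xB]; rewrite /a /b; apply/andP; split; lra. Qed.

Let cv t : continuous (v t). Proof. by move=> x; exact: derive_continuous (dv t x). Qed.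
Let cp t : continuous (p t). Proof. by move=> x; exact: derive_continuous (dp t x). Qed.
Let cw t : continuous (w t).
Proof.
have -> : w t = fun x => flux beta (u t x) by apply/funext => x; rewrite wE.
move=> x; apply: cvgD; first by apply: cvgM; [exact: cvg_cst|exact: cu].
by apply: cvgM; [exact: continuous_sqr|exact: cvg_cst].
Qed.

(** As [u] vanishes at [a], the Hölder bound gives [u ^ 2 <= E (b - a)]; adding 1 dominates the
    square root. *)
Let Cu : R := 1 + E * (b - a).
Let Cu0 : 0 <= Cu. Proof. by rewrite addr_ge0// mulr_ge0// subr_ge0 ltW. Qed.

Let u_le t x : `|u t x| <= Cu.
Proof.
have [xAB|xo] := boolP (A <= x <= B); last by have [-> _ _] := out t xo; rewrite normr0.
have /andP[ax xb] := inside xAB.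
have := holder t (lexx a) ax xb; have [-> _ _] := out t a_out.
rewrite subr0 -real_normK ?num_real// => H.
have H2 : E * (x - a) <= E * (b - a) by rewrite ler_wpM2l// lerD2r.
rewrite /Cu; move: H2 H (normr_ge0 (u t x)).
move: (E * (b - a)) (E * (x - a)) (`|u t x|) => K1 K2 n; nra.
Qed.

Let Cw : R := (`|beta| + Cu) * Cu.

Let w_le_u t x : `|w t x| <= (`|beta| + Cu) * `|u t x|.
Proof.
have -> : w t x = (beta + u t x / 2) * u t x by rewrite wE /flux; ring.
rewrite normrM ler_wpM2r// (le_trans (ler_normD _ _))// lerD2l normrM.
have := u_le t x; have := normr_ge0 (u t x); rewrite [`|2^-1|]ger0_norm//.
by move: (`|u t x|) => n; lra.
Qed.

Let w_le t x : `|w t x| <= Cw.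
Proof. by apply: le_trans (w_le_u t x) _; rewrite ler_wpM2l// addr_ge0. Qed.

Let p_le t x : `|p t x| <= Cw. Proof. by apply: p_bound; exact: w_le. Qed.

Let mbnd (f : R -> R) : continuous f -> measurable_fun `[a, b]%classic f /\
  exists M, forall s, (`[a, b]%classic : set R) s -> `|f s| <= M.
Proof.
move=> cf; split; first exact: continuous_measurable.
by have [M HM] := continuous_bounded_itv a b cf; exists M => s; rewrite /= in_itv; exact: HM.
Qed.

Let k (s : R) : R := expR (- 3 * s).
Let dk (s : R) : is_derive s 1 k (k s * - 3).
Proof.
apply: derive_expR; apply: (is_derive_eq (derive_scale (- 3) (derive_id s))); ring.
Qed.
Let ck : continuous k. Proof. by move=> s; exact: derive_continuous (dk s). Qed.

Let q t (s : R) : R := p t s ^+ 2 + v t s ^+ 2.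
Let cq t : continuous (q t).
Proof. by move=> s; apply: cvgD; exact: continuous_sqr. Qed.
Let D t : R := \int[mu]_(s in `[a, b]) q t s.

Let hm (x : R) : R := beta * x ^+ 2 / 2 + x ^+ 3 / 6.
Let G t : R := \int[mu]_(s in `[a, b]) (hm (u t s) * k s).

Let chm t : continuous (fun s => hm (u t s)).
Proof.
have -> : (fun s => hm (u t s)) = (fun s => (beta / 2 + u t s / 6) * (u t s * u t s)).
  by apply/funext => s; rewrite /hm; field.
apply: continuous_mul; last exact: continuous_mul.
move=> s; apply: cvgD; first exact: cvg_cst.
by apply: cvgM; [exact: cu|exact: cvg_cst].
Qed.

Let dG (t0 : R) : is_derive t0 1 G (\int[mu]_(s in `[a, b]) (w t0 s * p t0 s * k s)).
Proof.
apply: (@derive_under_Rint _ _ (fun t s => hm (u t s)) (fun t s => w t s * p t s) _ t0 (Cw * Cw)) => //.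
- exact: integ_continuous.
- by move=> t _; apply: mbnd; exact: chm.
- move=> t s _; rewrite /hm.
  have d2 := derive_scale (beta / 2) (derive_exp 2 (du t s)).
  have d3 := derive_scale (1 / 6) (derive_exp 3 (du t s)).
  have := derive_add d2 d3; rewrite (_ : (fun y => _) = (fun t => beta * u t s ^+ 2 / 2 + u t s ^+ 3 / 6)).
    by move=> H; apply: (is_derive_eq H); rewrite wE /flux /=; field.
  by apply/funext => y; field.
- by move=> t s _ _; rewrite normrM; apply: ler_pM; rewrite ?normr_ge0 ?w_le ?p_le.
Qed.

Let G_bounded : exists2 C, 0 <= C & forall t, `|G t| <= C.
Proof.
pose C1 := (`|beta| * Cu ^+ 2 / 2 + Cu ^+ 3 / 6) * k a; exists (C1 * (b - a)).
  by rewrite mulr_ge0 ?subr_ge0 ?(ltW ab)// mulr_ge0 ?expR_ge0// addr_ge0// divr_ge0// ?mulr_ge0// exprn_ge0.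
move=> t; apply: Rint_le_cst; first exact: ltW.
  by apply: integ_continuous; apply: continuous_mul => //; exact: chm.
move=> s /andP[as_ _]; rewrite normrM [`|k s|]ger0_norm ?expR_ge0//.
apply: ler_pM; rewrite ?expR_ge0//; last by rewrite /k ler_expR; lra.
have pw n : `|u t s ^+ n| <= Cu ^+ n by rewrite normrX lerXn2r// nnegrE.
rewrite /hm (le_trans (ler_normD _ _))// lerD//.
  by rewrite 2!normrM [`|2^-1|]ger0_norm// ler_wpM2r// ler_wpM2l// pw.
by rewrite normrM [`|6^-1|]ger0_norm// ler_wpM2r// pw.
Qed.

(* With [v' = - p] and [p' = w - v], the derivative of [k (p^2 / 2 + v^2)]
   is [k (p w - 3 / 2 ((p + v)^2 + v^2))]. *)
Let dissipation t : k b / 2 * D t <= \int[mu]_(s in `[a, b]) (w t s * p t s * k s).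
Proof.
pose Q s := k s * (2^-1 * p t s ^+ 2 + v t s ^+ 2).
pose Q' s := k s * (p t s * w t s - 3 / 2 * ((p t s + v t s) ^+ 2 + v t s ^+ 2)).
have dQ (s : R) : is_derive s 1 Q (Q' s).
  have d1 := derive_add (derive_scale 2^-1 (derive_exp 2 (dp t s))) (derive_exp 2 (dv t s)).
  by apply: (is_derive_eq (derive_mul (dk s) d1)); rewrite /Q' /=; field.
have cQ' : continuous Q'.
  apply: continuous_mul => //; apply: continuous_subf; first exact: continuous_mul.
  apply: continuous_mul; first by move=> s; exact: cvg_cst.
  by apply: continuous_addf; apply: continuous_sqr => //; exact: continuous_addf.
have IQ : \int[mu]_(s in `[a, b]) Q' s = 0.
  rewrite (Rint_FTC (ltW ab) dQ cQ') /Q.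
  have [_ -> ->] := out t a_out; have [_ -> ->] := out t b_out.
  by rewrite !expr0n /= !mulr0 !addr0 !mulr0 subrr.
have ci : continuous (fun s => w t s * p t s * k s).
  by apply: continuous_mul => //; exact: continuous_mul.
have icq : integ `[a, b] (fun s => k b / 2 * q t s).
  by apply: integ_scale => //; exact: integ_continuous.
rewrite -[leRHS]subr0 -IQ -RintegralB//; try exact: integ_continuous.
rewrite /D -RintegralZl//; last exact: integ_continuous.
apply: le_Rintegral => //.
  by apply: integ_sub => //; exact: integ_continuous.
move=> s; rewrite /= in_itv/= => /andP[_ sb].
have -> : w t s * p t s * k s - Q' s = k s * (3 / 2 * ((p t s + v t s) ^+ 2 + v t s ^+ 2)).
  by rewrite /Q'; ring.
have kb : k b <= k s by rewrite /k ler_expR; lra.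
have H : 2^-1 * q t s <= 3 / 2 * ((p t s + v t s) ^+ 2 + v t s ^+ 2).
  rewrite /q -subr_ge0; move: (p t s) (v t s) => x y.
  rewrite (_ : _ - _ = (x + 3 / 2 * y) ^+ 2 + 4^-1 * y ^+ 2); last by field.
  by apply: addr_ge0; [exact: sqr_ge0|apply: mulr_ge0 => //; exact: sqr_ge0].
apply: (@le_trans _ _ (k s * (2^-1 * q t s))).
  by rewrite -mulrA ler_wpM2r// mulr_ge0// /q addr_ge0// sqr_ge0.
by rewrite ler_wpM2l// expR_ge0.
Qed.

(** The mean value theorem reads the growth of [G] over a window at a single time. If [D] exceeded
    [e] there, [G] would grow by [2 C + 1], more than [|G| <= C] permits; this fixes the length
    [n]. *)
Let small_density e : 0 < e -> exists2 n, 0 < n & forall T, exists2 t, T <= t <= T + n & D t <= e.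
Proof.
move=> e0; have [C C0 HC] := G_bounded.
have kb0 : 0 < k b / 2 by rewrite divr_gt0 ?expR_gt0.
pose n := (2 * C + 1) / (k b / 2 * e).
have n0 : 0 < n.
  by apply: divr_gt0; [apply: ltr_wpDl => //; exact: mulr_ge0|exact: mulr_gt0].
exists n => // T.
have cG : {within `[T, T + n], continuous G}.
  by apply: continuous_subspaceT => y; exact: derive_continuous (dG y).
have Tn : T <= T + n by rewrite lerDl ltW.
have [t] := MVT_segment Tn (fun r _ => dG r) cG.
rewrite in_itv/= => tI H; exists t => //.
rewrite leNgt; apply/negP => De.
have H1 : k b / 2 * e * n <= G (T + n) - G T.
  rewrite H [T + n]addrC addrK; apply: ler_wpM2r; first exact: ltW.
  apply: le_trans (dissipation t); apply: ler_wpM2l; exact: ltW.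
have E1 : k b / 2 * e * n = 2 * C + 1.
  by rewrite /n mulrC divfK// gt_eqF// mulr_gt0.
have := HC (T + n); have := HC T; rewrite E1 !ler_norml in H1 *.
move: (G (T + n)) (G T) H1 => g1 g2; lra.
Qed.

Let w_modulus e : 0 < e -> exists2 h, 0 < h <= 1 & forall t x y, a <= x -> x <= y -> y <= b ->
  y - x <= h -> `|w t y - w t x| <= e.
Proof.
move=> e0; pose L := `|beta| + Cu + 1.
have L0 : 0 < L by rewrite ltr_wpDl// addr_ge0.
have eL : 0 < e / L by rewrite divr_gt0.
have E1 : 0 < E + 1 by rewrite ltr_wpDl.
exists (Num.min 1 ((e / L) ^+ 2 / (E + 1))).
  by rewrite lt_min ltr01 divr_gt0 ?exprn_gt0//= ge_min lexx.
move=> t x y ax xy yb; rewrite le_min => /andP[_ yx].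
have Hu : `|u t y - u t x| <= e / L.
  rewrite -ler_sqr ?nnegrE ?(ltW eL)// real_normK ?num_real//.
  apply: le_trans (holder t ax xy yb) _; rewrite ler_pdivlMr// in yx.
  by apply: le_trans yx; rewrite mulrC ler_wpM2l ?subr_ge0// lerDl.
have -> : w t y - w t x = (u t y - u t x) * (beta + (u t y + u t x) / 2).
  by rewrite !wE /flux; field.
rewrite normrM (_ : e = e / L * L); last by rewrite divfK// gt_eqF.
apply: ler_pM => //; rewrite (le_trans (ler_normD _ _))// /L -addrA lerD2l.
rewrite normrM [`|2^-1|]ger0_norm// ler_pdivrMr// (le_trans (ler_normD _ _))//.
by apply: le_trans (lerD (u_le t y) (u_le t x)) _; move: Cu => z; lra.
Qed.

(** Multiply [p' = w - v] by the parabola [eta], which vanishes at both ends of [[x, x + h]] and has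
    integral [h ^ 3 / 6], and integrate by parts. Then [w t x * h ^ 3 / 6] is controlled by the
    integrals of [|p|] and [|v|] and by the oscillation of [w] over a length [h], which is small
    uniformly in time. *)
Let w_small e : 0 < e -> exists2 d, 0 < d & forall t, D t <= d -> forall x, `|w t x| <= e.
Proof.
move=> e0; have e12 : 0 < e / 12 by rewrite divr_gt0.
have [h /andP[h0 h1] Hh] := w_modulus e12.
(* The budget [e h ^ 3 / 6] is shared equally between the oscillation of [w] and two terms of size
   [dl], which come from [|r| <= dl / 2 + r ^ 2 / dl]. *)
pose dl := e * h ^+ 3 / 24; have dl0 : 0 < dl by rewrite divr_gt0// mulr_gt0// exprn_gt0.
exists (dl ^+ 2) => [|t Dt x]; first exact: exprn_gt0.
have [xAB|xo] := boolP (A <= x <= B); last first.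
  rewrite wE; have [-> _ _] := out t xo.
  by rewrite /flux mulr0 expr0n mul0r addr0 normr0 ltW.
have /andP[ax xb] := inside xAB; have /andP[_ xB] := xAB.
have xh : x <= x + h by rewrite lerDl ltW.
have xhb : x + h <= b by rewrite /b lerD.
pose eta y := (y - x) * (x + h - y).
(* The polynomial in the second term is the primitive of [eta] from [x]. *)
pose F y := eta y * p t y - w t x * (h / 2 * (y - x) ^+ 2 - 3^-1 * (y - x) ^+ 3).
pose F' y := (x + h - y - (y - x)) * p t y + eta y * (w t y - v t y - w t x).
have dF (y : R) : is_derive y 1 F (F' y).
  have dyx := derive_sub (derive_id y) (derive_cst x y).
  have deta := derive_mul dyx (derive_sub (derive_cst (x + h) y) (derive_id y)).
  have d1 := derive_mul deta (dp t y).
  have d2 := derive_sub (derive_scale (h / 2) (derive_exp 2 dyx)) (derive_scale 3^-1 (derive_exp 3 dyx)).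
  by apply: (is_derive_eq (derive_sub d1 (derive_scale (w t x) d2))); rewrite /F' /eta /=; field.
have caff (c : R) : continuous (fun y : R => y - c).
  by move=> y; apply: cvgB; [exact: cvg_id|exact: cvg_cst].
have caff2 (c : R) : continuous (fun y : R => c - y).
  by move=> y; apply: cvgB; [exact: cvg_cst|exact: cvg_id].
have ceta : continuous eta by exact: continuous_mul.
have cF' : continuous F'.
  apply: continuous_addf.
    by apply: continuous_mul => //; exact: continuous_subf.
  apply: continuous_mul => //; apply: continuous_subf; first exact: continuous_subf.
  by move=> y; exact: cvg_cst.
have IF : \int[mu]_(s in `[x, x + h]) F' s = - (w t x * (h ^+ 3 / 6)).
  by rewrite (Rint_FTC xh dF cF') /F /eta; field.
have le_F' s : x <= s <= x + h -> `|F' s| <= dl + h ^+ 2 * (e / 12) + dl^-1 * q t s.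
  move=> /andP[xs sh].
  have sb : s <= b by exact: le_trans xhb.
  have Hw : `|w t s - w t x| <= e / 12 by apply: Hh => //; rewrite lerBlDl.
  have eta0 : 0 <= eta s by rewrite mulr_ge0// subr_ge0.
  have eta1 : eta s <= h ^+ 2 by rewrite /eta; nra.
  have eta2 : eta s <= 1 by apply: le_trans eta1 _; rewrite expr_le1// ltW.
  have amgm (r : R) : `|r| <= dl / 2 + dl^-1 * r ^+ 2.
    rewrite -[r ^+ 2]real_normK ?num_real//.
    have : 0 <= dl^-1 * (`|r| - dl / 2) ^+ 2 by rewrite mulr_ge0 ?sqr_ge0// invr_ge0 ltW.
    have -> : dl^-1 * (`|r| - dl / 2) ^+ 2 = dl^-1 * `|r| ^+ 2 - `|r| + dl / 4.
      by field; rewrite gt_eqF.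
    by move: (dl^-1 * `|r| ^+ 2) (`|r|) => z1 z2; lra.
  have -> : F' s = (x + h - s - (s - x)) * p t s + (eta s * (w t s - w t x) - eta s * v t s).
    by rewrite /F'; ring.
  have P1 : `|(x + h - s - (s - x)) * p t s| <= dl / 2 + dl^-1 * p t s ^+ 2.
    rewrite normrM; apply: le_trans (amgm (p t s)); rewrite ler_piMl//.
    by rewrite ler_norml; apply/andP; split; lra.
  have P2 : `|eta s * v t s| <= dl / 2 + dl^-1 * v t s ^+ 2.
    by rewrite normrM [`|eta s|]ger0_norm//; apply: le_trans (amgm (v t s)); rewrite ler_piMl.
  have P3 : `|eta s * (w t s - w t x)| <= h ^+ 2 * (e / 12).
    by rewrite normrM [`|eta s|]ger0_norm// ler_pM.
  apply: le_trans (ler_normD _ _) _.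
  rewrite (_ : dl + _ + _ = (dl / 2 + dl^-1 * p t s ^+ 2) +
      (h ^+ 2 * (e / 12) + (dl / 2 + dl^-1 * v t s ^+ 2))); last by rewrite /q; field; rewrite gt_eqF.
  by apply: lerD => //; apply: le_trans (ler_normB _ _) _; exact: lerD.
have iq c d : integ `[c, d] (q t) by exact: integ_continuous.
have K : `|w t x| * (h ^+ 3 / 6) <= e * (h ^+ 3 / 6).
  have <- : `|\int[mu]_(s in `[x, x + h]) F' s| = `|w t x| * (h ^+ 3 / 6).
    by rewrite IF normrN normrM [X in _ * X]ger0_norm// divr_ge0// exprn_ge0// ltW.
  apply: (@le_trans _ _ (\int[mu]_(s in `[x, x + h]) (dl + h ^+ 2 * (e / 12) + dl^-1 * q t s))).
    apply: Rint_le_norm => //; first exact: integ_continuous.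
    by apply: integ_add => //; [exact: integ_cst|exact: integ_scale].
  rewrite RintegralD//; [|exact: integ_cst|exact: integ_scale].
  rewrite Rint_cst// RintegralZl// [x + h]addrC addrK.
  have I2 : \int[mu]_(s in `[x, h + x]) q t s <= dl ^+ 2.
    apply: le_trans Dt; rewrite addrC; apply: Rint_subitv_le => // s.
    by rewrite /q addr_ge0// sqr_ge0.
  have I3 : dl^-1 * \int[mu]_(s in `[x, h + x]) q t s <= dl.
    by rewrite ler_pdivrMl// -expr2.
  apply: le_trans (lerD (lexx _) I3) _.
  have : dl * h <= dl by rewrite ler_piMr// ltW.
  have -> : e * (h ^+ 3 / 6) = (h ^+ 2 * (e / 12)) * h + 2 * dl by rewrite /dl; field.
  by rewrite mulrDl; move: (dl * h) (h ^+ 2 * (e / 12) * h) => z1 z2; lra.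
by rewrite ler_pM2r// divr_gt0// exprn_gt0 in K.
Qed.

(** For [beta != 0], [|w| >= |beta| |u| / 2] as long as [|u| <= |beta|]. Since [u] starts from 0 at
    [a], leaving this range would mean a point with [|u| = |beta|], where [|w| >= beta ^ 2 / 2]: the
    bound [beta ^ 2 / 4] in [d] forbids it. For [beta = 0], [w = u ^ 2 / 2]. *)
Let u_small_of_w e : 0 < e -> exists2 d, 0 < d & forall t, (forall x, `|w t x| <= d) ->
  forall x, `|u t x| <= e.
Proof.
move=> e0; have [b0|b0] := eqVneq beta 0.
  exists (e ^+ 2 / 2) => [|t Hw x]; first by rewrite divr_gt0// exprn_gt0.
  rewrite -ler_sqr ?nnegrE ?(ltW e0)//.
  have := Hw x; rewrite wE /flux b0 mul0r add0r normrM normrX [`|2^-1|]ger0_norm//.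
  by rewrite ler_pM2r.
have B0 : 0 < `|beta| by rewrite normr_gt0.
pose d := Num.min (`|beta| ^+ 2 / 4) (`|beta| * e / 2).
exists d => [|t Hw x]; first by rewrite lt_min !divr_gt0 ?exprn_gt0 ?mulr_gt0.
have Hlow y : `|u t y| <= `|beta| -> `|beta| / 2 * `|u t y| <= `|w t y|.
  move=> ub; have -> : w t y = (beta - (- (u t y / 2))) * u t y by rewrite wE /flux; field.
  rewrite normrM ler_wpM2r//; apply: le_trans (lerB_dist _ _).
  by rewrite normrN normrM [`|2^-1|]ger0_norm//; move: ub; move: (`|u t y|) => z; lra.
have ub : `|u t x| <= `|beta|.
  have [xAB|xo] := boolP (A <= x <= B); last by have [-> _ _] := out t xo; rewrite normr0.
  have /andP[ax _] := inside xAB; rewrite leNgt; apply/negP => ub.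
  have cn : {within `[a, x], continuous (fun s => `|u t s|)}.
    by apply: continuous_subspaceT => s; apply: cvg_norm; exact: cu.
  have [|y _ Ey] := @IVT _ (fun s => `|u t s|) a x `|beta| ax cn.
    have [-> _ _] := out t a_out; rewrite normr0.
    by rewrite ge_min le_max (ltW B0) (ltW ub) orbT.
  have := Hlow y; rewrite Ey lexx => /(_ isT) H.
  have := le_trans H (Hw y); rewrite le_min => /andP[+ _].
  by move: B0; move: (`|beta|) => z; nra.
have := le_trans (Hlow x ub) (Hw x); rewrite le_min => /andP[_].
by rewrite mulrAC ler_pM2r// ler_pM2l.
Qed.

Let u_recurrently_small e : 0 < e -> exists2 n, 0 < n & forall T,
  exists2 t, T <= t <= T + n & forall x, `|u t x| <= e.
Proof.
move=> e0; have [d d0 Hd] := u_small_of_w e0.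
have [d' d'0 Hd'] := w_small d0; have [n n0 Hn] := small_density d'0.
exists n => // T; have [t tT Dt] := Hn T; exists t => //.
by apply: Hd; exact: Hd'.
Qed.

Let iu t (f : R -> R) : continuous f -> integ `[a, b] (fun s => u t s * f s).
Proof. by move=> cf; apply: integ_continuous; exact: continuous_mul. Qed.

Let cid : continuous (fun s : R => s). Proof. by move=> s; exact: cvg_id. Qed.
Let cone : continuous (fun _ : R => 1 : R). Proof. by move=> s; exact: cvg_cst. Qed.

Let derive_moment (f : R -> R) (t0 : R) : continuous f ->
  is_derive t0 1 (fun t => \int[mu]_(s in `[a, b]) (u t s * f s))
    (\int[mu]_(s in `[a, b]) (p t0 s * f s)).
Proof.
move=> cf; apply: (@derive_under_Rint _ _ u p _ t0 Cw) => //.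
- exact: integ_continuous.
- by move=> t _; exact: mbnd.
Qed.

Let moment_small (f : R -> R) : continuous f -> exists2 C, 0 < C & forall t e,
  (forall x, `|u t x| <= e) -> `|\int[mu]_(s in `[a, b]) (u t s * f s)| <= C * e.
Proof.
move=> cf; have [M HM] := continuous_bounded_itv a b cf.
have M0 : 0 <= M by apply: le_trans (HM a _) => //; rewrite lexx ltW.
exists ((M + 1) * (b - a)) => [|t e He]; first by rewrite mulr_gt0 ?subr_gt0// ltr_wpDl.
rewrite mulrAC; apply: Rint_le_cst; [exact: ltW|exact: iu|].
move=> s sI; rewrite normrM mulrC; apply: ler_pM => //.
by apply: le_trans (HM s sI) _; rewrite lerDl.
Qed.

(** Conservation comes from [p = - v_x]; a constant that is arbitrarily small at some times is 0. *)
Let mass0 t : \int[mu]_(s in `[a, b]) u t s = 0.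
Proof.
pose M t := \int[mu]_(s in `[a, b]) (u t s * 1).
have dM (r : R) : is_derive r 1 M 0.
  apply: (is_derive_eq (derive_moment r cone)).
  have cnp : continuous (fun s => - p r s) by move=> s; apply: cvgN; exact: cp.
  have := Rint_FTC (ltW ab) (dv r) cnp.
  have [_ _ ->] := out r a_out; have [_ _ ->] := out r b_out; rewrite subrr => H.
  transitivity (\int[mu]_(s in `[a, b]) (- 1 * - p r s)).
    by apply: eq_Rintegral => s _; ring.
  by rewrite RintegralZl// ?H ?mulr0//; exact: integ_continuous.
transitivity (M t); first by apply: eq_Rintegral => s _; rewrite mulr1.
apply/eqP/contraT => M0; have [C C0 HC] := moment_small cone.
have e0 : 0 < `|M t| / (2 * C) by rewrite divr_gt0 ?normr_gt0// mulr_gt0.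
have [n _ /(_ 0)[r _ Hr]] := u_recurrently_small e0.
have := HC r _ Hr; rewrite -/(M r) (is_derive_0_is_cst r t dM).
have -> : C * (`|M t| / (2 * C)) = `|M t| / 2 by field; rewrite gt_eqF.
have : 0 < `|M t| by rewrite normr_gt0.
by move: (`|M t|) => z; lra.
Qed.

Let derive_first_moment (t0 : R) :
  is_derive t0 1 (fun t => \int[mu]_(s in `[a, b]) (u t s * s))
    (2^-1 * \int[mu]_(s in `[a, b]) u t0 s ^+ 2).
Proof.
apply: (is_derive_eq (derive_moment t0 cid)).
have cps : continuous (fun s => p t0 s * s) by exact: continuous_mul.
(* Its derivative is [s p - w] and it vanishes at both ends, so [\int s p = \int w]. *)
pose F s := - (s * v t0 s) - p t0 s.
have dF (s : R) : is_derive s 1 F (p t0 s * s - w t0 s).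
  have := derive_sub (derive_opp (derive_mul (derive_id s) (dv t0 s))) (dp t0 s).
  by move=> H; apply: (is_derive_eq H); ring.
have cF : continuous (fun s => p t0 s * s - w t0 s).
  by move=> s; apply: cvgB; [exact: cps|exact: cw].
have := Rint_FTC (ltW ab) dF cF; rewrite /F.
have [_ -> ->] := out t0 a_out; have [_ -> ->] := out t0 b_out.
rewrite !mulr0 !subrr RintegralB//; try exact: integ_continuous.
move=> /eqP; rewrite subr_eq0 => /eqP ->.
have iu1 : integ `[a, b] (u t0) by exact: integ_continuous.
have iu2 : integ `[a, b] (fun s => u t0 s ^+ 2) by apply: integ_continuous; exact: continuous_sqr.
transitivity (beta * \int[mu]_(s in `[a, b]) u t0 s + 2^-1 * \int[mu]_(s in `[a, b]) u t0 s ^+ 2).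
  rewrite -!RintegralZl// -RintegralD//; try exact: integ_scale.
  by apply: eq_Rintegral => s _; rewrite wE /flux; ring.
by rewrite mass0 mulr0 add0r.
Qed.

Lemma compactly_supported_solution_eq0 t x : u t x = 0.
Proof.
pose X t := \int[mu]_(s in `[a, b]) (u t s * s).
have sq0 r : 0 <= 2^-1 * \int[mu]_(s in `[a, b]) u r s ^+ 2.
  by rewrite mulr_ge0// Rintegral_ge0// => s _; exact: sqr_ge0.
have cX : continuous X by move=> r; exact: derive_continuous (derive_first_moment r).
have X_mono r s : r <= s -> X r <= X s.
  move=> rs; have cr : {within `[r, s], continuous X} by exact: continuous_subspaceT.
  have [q' _] := MVT_segment rs (fun r _ => derive_first_moment r) cr.
  by rewrite -/(X r) -/(X s) -subr_ge0 => ->; rewrite mulr_ge0// subr_ge0.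
have [C C0 HC] := moment_small cid.
have Xe r e : 0 < e -> `|X r| <= e.
  move=> e0; have eC : 0 < e / C by rewrite divr_gt0.
  have [n n0 Hn] := u_recurrently_small eC.
  (* [X] is nondecreasing: a later time with small [u] bounds [X r] from above, an earlier one from
     below. *)
  have [t1 /andP[t1r _] /HC] := Hn r; have [t2 /andP[_ t2r] /HC] := Hn (r - n).
  rewrite subrK in t2r.
  rewrite ![C * _]mulrC !divfK ?gt_eqF// -/(X t1) -/(X t2) !ler_norml.
  move=> /andP[X2 _] /andP[_ X1]; apply/andP; split.
    exact: le_trans X2 (X_mono _ _ t2r).
  exact: le_trans (X_mono _ _ t1r) X1.
have X0 r : X r = 0.
  apply/eqP/contraT => Xr; have := Xe r (`|X r| / 2).
  have X1 : 0 < `|X r| by rewrite normr_gt0.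
  by rewrite divr_gt0// => /(_ isT); move: (`|X r|) X1 => z; lra.
have dX0 : is_derive t 1 X 0.
  by rewrite (_ : X = fun=> 0); [exact: derive_cst|apply/funext].
have : 2^-1 * \int[mu]_(s in `[a, b]) u t s ^+ 2 = 0.
  by have [_ <-] := derive_first_moment t; have [_ <-] := dX0.
move=> /eqP; rewrite mulf_eq0 invr_eq0 pnatr_eq0 /= => /eqP u2.
have [/andP[Ax xB]|xo] := boolP (A <= x <= B); last by have [] := out t xo.
by apply: (Rint_sqr_eq0 (@cu t) u2); rewrite /a /b; apply/andP; split; lra.
Qed.

End Dispersal.

(** * From almost everywhere supports to pointwise ones, and assembly of the argument *)

Lemma continuous_supported_eq0 (R : realType) (f : R -> R) (A B : R) : A <= B ->
  continuous f -> supported_in `[A, B] f -> forall x, ~~ (A <= x <= B) -> f x = 0.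
Proof.
move=> AB cf fAB x xAB.
(* Twice the distance to [[A, B]]: the product [f * dist] is continuous and zero almost everywhere,
   hence zero, while [dist] is nonzero outside the interval. *)
pose dist (y : R) := `|y - A| + `|y - B| - (B - A).
have cdist : continuous dist.
  apply: continuous_subf => [|y]; last exact: cvg_cst.
  by apply: continuous_addf => y; apply: cvg_norm; apply: cvgB; [exact: cvg_id|exact: cvg_cst|exact: cvg_id|exact: cvg_cst].
have : (fun y => f y * dist y) = (fun=> 0).
  apply: continuous_ae_eq; [exact: continuous_mul|by move=> y; exact: cvg_cst|].
  apply: ae_imp fAB => y Hy; have [/andP[Ay yB]|yAB] := boolP (A <= y <= B).
    by rewrite /dist ger0_norm ?subr_ge0// ler0_norm ?subr_le0//; ring.
  by rewrite Hy ?mul0r// => /=; rewrite in_itv/=; exact/negP.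
move=> /(congr1 (fun g => g x)) /eqP; rewrite mulf_eq0 => /orP[/eqP//|].
move: xAB; rewrite /dist negb_and -!ltNge => /orP[xA|Bx] /eqP; have := AB.
  by rewrite !ltr0_norm ?subr_lt0 ?(lt_le_trans xA)//; lra.
by rewrite !gtr0_norm ?subr_gt0 ?(le_lt_trans AB)//; lra.
Qed.

Unset Implicit Arguments.
Set Strict Implicit.
Set Printing Implicit Defensive.

Theorem proposition2p6 (R : realType) (beta : R) (z : R -> R -> R)
    (z_cont : continuous_H1 z) (z_sol : distributional_solution beta z)
    (A B : R) (leAB : A <= B)
    (I : set R) (I_itv : is_interval I) (I_open : open I) (I_neq0 : I !=set0)
    (z_supp : forall t, I t -> supported_in `[A, B] (z t)) :
  forall t, {ae (@lebesgue_measure R), forall x, z t x = 0}.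
Proof.
have zL2 t : L2 (z t) by have [/(_ t)[]] := z_cont.
have [u [zu u_prim u_unif]] := H1_continuous_representative z_cont.
have su : sup_continuous u.
  split; [|split] => // t; have [Lu [g ug]] := u_prim t; first exact: primitive_continuous ug.
  have sq0 (f : R -> R) : 0 <= \int[lebesgue_measure]_s (f s ^+ 2).
    by apply: Rintegral_ge0 => s _; exact: sqr_ge0.
  pose S := \int[lebesgue_measure]_s (u t s ^+ 2) + \int[lebesgue_measure]_s (g s ^+ 2).
  have S0 : 0 <= S by exact: addr_ge0.
  (* [1 + S] is an admissible [e] in the Sobolev bound because [S <= (1 + S) ^ 2]. *)
  exists (2 * (1 + S)) => x; apply: (primitive_sup_bound x Lu ug); first by rewrite ltr_pwDl.
  by rewrite -/S; move: S S0 => y y0; nra.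
have sw := sup_continuous_flux beta su; have [cw [bw _]] := sw.
have [b [b1 [b2 [C [C0 [sb [db [db1 [b_supp [b_le [b1_le [b2_far [b2_near [b_cvg b1_cvg]]]]]]]]]]]]]]
  := @exp_abs_approximation R.
pose p t x := resolvent_dx (fun y => flux beta (u t y)) x.
have du (t x : R) : is_derive t 1 (u ^~ x) (p t x).
  apply: (@derive_of_integral _ (u ^~ x) (p ^~ x)).
    move=> r; apply: cvgM; first exact: cvg_cst.
    exact: (sup_continuous_Rint sw (integ_dx_kernel x)).
  move=> s r sr; apply: (integral_evolution C0 sb db db1 b_supp b_le b1_le b2_far b2_near b_cvg b1_cvg su) => //.
  exact: (weak_evolution z_sol zL2 zu su).
have [t0 It0] := I_neq0.
have [/= d d0 Hd] := open_nbhs_nbhs (conj I_open It0).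
have out : forall t x, ~~ (A <= x <= B) -> u t x = 0 /\ p t x = 0.
  apply: (support_propagation (t0 := t0) su du d0) => t td; apply: continuous_supported_eq0 => //.
    by have [cu _] := su; exact: cu.
  have /Hd/z_supp : ball_ Num.norm t0 d t by rewrite /ball_/= distrC.
  by move=> zt; apply: ae_imp (ae_and (zu t) zt) => x [<-].
have ell t : exists v : R -> R, (forall x : R, is_derive x 1 v (- p t x)) /\
    (forall x : R, is_derive x 1 (p t) (flux beta (u t x) - v x)) /\
    (forall x, ~~ (A <= x <= B) -> v x = 0).
  apply: elliptic_compact_support => // x /(out t)[u0 p0]; split => //.
  by rewrite u0 /flux mulr0 expr0n mul0r addr0.
have [v Hv] := choice ell.
have [Lu0 [g0 u0_prim]] := u_prim 0.
have [E E0 HE] := solution_uniform_holder leAB su du out (fun t => (Hv t).1)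
  (fun t => (Hv t).2.1) (fun t => (Hv t).2.2) u0_prim.
have u_eq0 : forall t x, u t x = 0.
  apply: (@compactly_supported_solution_eq0 _ beta u (fun t x => flux beta (u t x)) p v A B E) => //.
  - by have [cu _] := su.
  - by move=> t; have [] := Hv t.
  - by move=> t; have [_ []] := Hv t.
  - by move=> t x xo; have [] := out t x xo; have [_ [_ ->]] := Hv t.
  - by move=> t M wM x; apply: resolvent_dx_bound => //; apply: continuous_measurable.
by move=> t; apply: ae_imp (zu t) => x ->.
Qed.
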